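(* There exists a displacement $y:\Lambda\to\mathbb{R}$ which is a globally stable equilibrium and has net Burgers vector $B[y]=1$.
   Context: Let $\mathsf R_6$ denote rotation of $\mathbb R^2$ through angle $\pi/3$, $a_1=(1,0)^T$, $a_i=\mathsf R_6^{i-1}a_1$ (indices mod 6), and $\Lambda:=(\tfrac12,\tfrac{\sqrt3}{6})^T+\{m a_1+n a_2: m,n\in\mathbb Z\}$ (a triangular lattice; the origin is the barycentre of one of its elementary triangles). The set of bonds is $\mathcal B=\{(\xi,\eta)\in\Lambda^2:|\xi-\eta|=1\}$ (ordered pairs); for $b=(\xi,\eta)$, $-b=(\eta,\xi)$ and for $y:\Lambda\to\mathbb R$, $Dy_b=y(\eta)-y(\xi)$. For a bond $b$, $|b|$ denotes the distance from the origin to the closed segment $b$. A cell is a triple $C=(\xi,\zeta,\eta)$ of lattice points with $(\xi,\zeta),(\zeta,\eta),(\eta,\xi)\in\mathcal B$; it is positively oriented if the vertices are in counterclockwise order, and $\partial C=(\xi,\zeta)+(\zeta,\eta)+(\eta,\xi)$. For $\alpha:\mathcal B\to\mathbb R$ and a formal sum of bonds $\Gamma=\sum_k b_k$, $\int_\Gamma\alpha=\sum_k\alpha_{b_k}$. For $y:\Lambda\to\mathbb R$, $[Dy]$ is the set of $\alpha:\mathcal B\to[-\tfrac12,\tfrac12]$ with $\alpha_{-b}=-\alpha_b$ and $Dy_b-\alpha_b\in\mathbb Z$ for all $b$. A dislocation core of $\alpha$ is a positively oriented cell $C$ with $\int_{\partial C}\alpha\neq0$; $\mathcal C^\pm[\alpha]$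 denotes the set of dislocation cores. If $y$ admits some $\alpha\in[Dy]$ with $\alpha_b\to0$ as $|b|\to\infty$, the net Burgers vector is $B[y]:=\sum_{C\in\mathcal C^\pm[\alpha]}\int_{\partial C}\alpha$ (this is finite and independent of the choice of $\alpha\in[Dy]$). The pair potential $\psi\in C(\mathbb R)\cap C^4(\mathbb R\setminus(\mathbb Z+\tfrac12))$ satisfies: ($\psi$1) $\psi$ is 1-periodic; ($\psi$2) $\psi$ and $\psi(\tfrac12+\cdot)$ are even; ($\psi$3) $\psi(r)=0$ iff $r\in\mathbb Z$; ($\psi$4) $\psi''(0)=\mu>0$; ($\psi$5) $\psi(x)\ge\tfrac12\psi''(0)x^2$ for all $x\in[-\tfrac12,\tfrac12]$. Let $\xi_0=(0,\sqrt3/3)^T$ and $\mathscr W_0=\{v:\Lambda\to\mathbb R: v(\xi_0)=0,\ \{b: Dv_b\ne0\}\text{ bounded}\}$. For $y$ and $u\in\mathscr W_0$, $E(y+u;y):=\sum_{b\in\mathcal B}[\psi(Dy_b+Du_b)-\psi(Dy_b)]$ (a finite sum). A displacement $y$ is a globally stable equilibrium if $E(y+u;y)\ge0$ for all $u\in\mathscr W_0$.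
   Formalization: The point ξ_0=(0,√3/3) of the context does not lie in Λ, so v(ξ_0)=0 is undefined; test displacements are pinned instead at the lattice point (0,-√3/3), which does not change the energy differences or the notion of stability. *)

(* Defs.v *)
From Stdlib Require Import Reals Lra ZArith List.
From Coquelicot Require Import Coquelicot.
Open Scope R_scope.

(** Lattice points are indexed by (m,n) : Z*Z, standing for
    (1/2, sqrt3/6) + m a1 + n a2 with a1 = (1,0), a2 = (1/2, sqrt3/2). *)
Definition pt := (Z * Z)%type.

Definition posx (p : pt) : R := / 2 + IZR (fst p) + IZR (snd p) / 2.
Definition posy (p : pt) : R := sqrt 3 / 6 + IZR (snd p) * (sqrt 3 / 2).

Definition bond := (pt * pt)%type.
Definition is_bond (b : bond) : Prop :=
  (posx (snd b) - posx (fst b)) ^ 2 + (posy (snd b) - posy (fst b)) ^ 2 = 1.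
Definition opp_bond (b : bond) : bond := (snd b, fst b).

(** |b| : distance from the origin to the closed segment b. *)
Definition bond_dist (b : bond) : R :=
  let px := posx (fst b) in let py := posy (fst b) in
  let dx := posx (snd b) - px in let dy := posy (snd b) - py in
  let t := Rmax 0 (Rmin 1 (- (px * dx + py * dy) / (dx * dx + dy * dy))) in
  sqrt ((px + t * dx) ^ 2 + (py + t * dy) ^ 2).

Definition D (y : pt -> R) (b : bond) : R := y (snd b) - y (fst b).

Definition in_Dy (y : pt -> R) (alpha : bond -> R) : Prop :=
  forall b, is_bond b ->
    - / 2 <= alpha b <= / 2 /\
    alpha (opp_bond b) = - alpha b /\
    exists k : Z, D y b - alpha b = IZR k.

Definition decays (alpha : bond -> R) : Prop :=
  forall eps, 0 < eps -> exists Rr, forall b, is_bond b -> Rr < bond_dist b ->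
    Rabs (alpha b) < eps.

(** Positively oriented cells: each elementary triangle is represented exactly
    once by (p, up): for up = true the triangle (p, p+a1, p+a2), for up = false
    the triangle (p+a1, p+a1+a2, p+a2); both vertex triples are counterclockwise. *)
Definition cell := (pt * bool)%type.
Definition shift (p : pt) (i j : Z) : pt := ((fst p + i)%Z, (snd p + j)%Z).
Definition cell_vertices (c : cell) : pt * pt * pt :=
  let p := fst c in
  if snd c then (p, shift p 1 0, shift p 0 1)
  else (shift p 1 0, shift p 1 1, shift p 0 1).

Definition circ (alpha : bond -> R) (c : cell) : R :=
  match cell_vertices c with
  | (xi, zeta, eta) => alpha (xi, zeta) + alpha (zeta, eta) + alpha (eta, xi)
  end.

Fixpoint sumR {A : Type} (f : A -> R) (l : list A) : R :=
  match l with nil => 0 | x :: l' => f x + sumR f l' end.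

(** B[y] = Bv : computed from some admissible alpha in [Dy] decaying at infinity;
    the set of dislocation cores is finite (listed by cs) and the sum of the
    circulations over the cores equals Bv. *)
Definition net_burgers (y : pt -> R) (Bv : R) : Prop :=
  exists alpha : bond -> R, in_Dy y alpha /\ decays alpha /\
    exists cs : list cell, NoDup cs /\
      (forall c, In c cs <-> circ alpha c <> 0) /\
      sumR (circ alpha) cs = Bv.

(** Pinning point xi_0 (lattice index (0,-1), i.e. (0,-sqrt3/3)). *)
Definition xi0 : pt := (0%Z, (-1)%Z).

Definition in_W0 (v : pt -> R) : Prop :=
  v xi0 = 0 /\
  exists Rr, forall b, is_bond b -> D v b <> 0 -> bond_dist b <= Rr.

(** Global stability: E(y+u;y) >= 0, where E is the (finite) sum over all bonds;
    any finite duplicate-free list of bonds containing all bonds with Du_b <> 0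
    computes it (terms with Du_b = 0 vanish). *)
Definition globally_stable (psi : R -> R) (y : pt -> R) : Prop :=
  forall u : pt -> R, in_W0 u ->
  forall L : list bond, NoDup L -> (forall b, In b L -> is_bond b) ->
    (forall b, is_bond b -> D u b <> 0 -> In b L) ->
    0 <= sumR (fun b => psi (D y b + D u b) - psi (D y b)) L.

Definition not_half_int (x : R) : Prop := forall k : Z, x <> IZR k + / 2.

Definition psi_regular (psi : R -> R) : Prop :=
  (forall x, continuous psi x) /\
  (forall x, not_half_int x ->
     (forall k, (k <= 4)%nat -> ex_derive_n psi k x) /\
     continuous (Derive_n psi 4) x).

Definition psi_assumptions (psi : R -> R) : Prop :=
  psi_regular psi /\
  (forall x, psi (x + 1) = psi x) /\
  (forall x, psi (- x) = psi x) /\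
  (forall x, psi (/ 2 + - x) = psi (/ 2 + x)) /\
  (forall r, psi r = 0 <-> exists k : Z, r = IZR k) /\
  0 < Derive_n psi 2 0 /\
  (forall x, - / 2 <= x <= / 2 -> psi x >= / 2 * Derive_n psi 2 0 * x ^ 2).

(* Main.v *)
Require Import Defs.
From Stdlib Require Import Reals Lra Lia ZArith List Permutation.
From Stdlib Require Import Classical ClassicalEpsilon FunctionalExtensionality Cantor.
From Coquelicot Require Import Coquelicot.
Import ListNotations.
Open Scope R_scope.

(** Direct method. A lift [a] of [Dy] is a flow on the honeycomb of cells, with integer outflow at
    each cell, and by (psi5) the energy is bounded below by that of the quadratic potential, the
    Dirichlet energy of the flow. Compared with the flow [ang c0] of a single vortex, the
    deletion-contraction expansion of the effective resistance shows that every core of charge -1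
    costs a fixed amount of energy; hence a minimising sequence for the class of a single vortex
    has boundedly many cores. The remaining energy is, up to constants, the logarithmic interaction
    of the cores plus the squared distance of [a] to the superposition of their vortices. For total
    charge 1 and well separated clusters, a bounded interaction forces one cluster to have charge 1
    and the others to be neutral. Recentring at the charge 1 cluster and passing to a
    local limit by a diagonal argument keeps global minimality, and the limit of [a] differs from a
    finite superposition of vortices of total charge 1 by a square summable flow, so it decays. *)

(** * Finite sums *)

(** The obstacle is to bound the number of cores: the logarithmic expansion of the energy has an
    error quadratic in that number, so it is useful only once the number is bounded. The bound comes
    from integrality. Deletion-contraction writes the effective energy of a charge distribution [s]
    as a nonnegative combination of squares of the charges [s(A)] of sets of cells. For integers
    [s(A)^2 >= s(A)], with equality for a single unit charge, so the energy of [s] is at least the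
    sum of [s c] times the energy of a unit charge at [c]. Deep inside a suitable large box that
    energy hardly depends on [c]; hence total charge 1 costs at least as much as one vortex, up to a
    constant. A charge -1 gains 2 in [s(A)^2 >= s(A)] on the singleton of its cell, and the weight
    of that singleton is bounded below. The energy of one vortex diverges, so only differences with
    [ang c0] occur. Replacing [psi] by its parabola there costs a fourth power, which is summable
    because [ang] decays like the inverse distance. The vortex of a minimising sequence may drift to
    infinity, hence the recentring. *)

Lemma sumR_ext {A : Type} (f g : A -> R) (l : list A) :
  (forall x, In x l -> f x = g x) -> sumR f l = sumR g l.
Proof.
  induction l as [|a l IH]; intros H; simpl; [reflexivity|].
  rewrite (H a) by (left; reflexivity).
  rewrite IH; [reflexivity|]. intros x Hx; apply H; right; exact Hx.
Qed.

Lemma sumR_plus {A : Type} (f g : A -> R) (l : list A) :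
  sumR (fun x => f x + g x) l = sumR f l + sumR g l.
Proof. induction l as [|a l IH]; simpl; [ring|]. rewrite IH; ring. Qed.

Lemma sumR_minus {A : Type} (f g : A -> R) (l : list A) :
  sumR (fun x => f x - g x) l = sumR f l - sumR g l.
Proof. induction l as [|a l IH]; simpl; [ring|]. rewrite IH; ring. Qed.

Lemma sumR_scal {A : Type} (c : R) (f : A -> R) (l : list A) :
  sumR (fun x => c * f x) l = c * sumR f l.
Proof. induction l as [|a l IH]; simpl; [ring|]. rewrite IH; ring. Qed.

Lemma sumR_le {A : Type} (f g : A -> R) (l : list A) :
  (forall x, In x l -> f x <= g x) -> sumR f l <= sumR g l.
Proof.
  induction l as [|a l IH]; intros H; simpl; [lra|].
  assert (H1 := H a (or_introl eq_refl)).
  assert (sumR f l <= sumR g l) by (apply IH; intros x Hx; apply H; right; exact Hx).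
  lra.
Qed.

Lemma sumR_0 {A : Type} (f : A -> R) (l : list A) :
  (forall x, In x l -> f x = 0) -> sumR f l = 0.
Proof.
  induction l as [|a l IH]; intros H; simpl; [reflexivity|].
  rewrite (H a) by (left; reflexivity).
  rewrite IH; [ring|]. intros x Hx; apply H; right; exact Hx.
Qed.

Lemma sumR_nonneg {A : Type} (f : A -> R) (l : list A) :
  (forall x, In x l -> 0 <= f x) -> 0 <= sumR f l.
Proof.
  intros H. rewrite <- (sumR_0 (fun _ : A => 0) l) by reflexivity.
  apply sumR_le; exact H.
Qed.

Lemma sumR_app {A : Type} (f : A -> R) (l1 l2 : list A) :
  sumR f (l1 ++ l2) = sumR f l1 + sumR f l2.
Proof. induction l1 as [|a l IH]; simpl; [ring|]. rewrite IH; ring. Qed.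

Lemma sumR_map {A B : Type} (f : B -> R) (g : A -> B) (l : list A) :
  sumR f (map g l) = sumR (fun x => f (g x)) l.
Proof. induction l as [|a l IH]; simpl; [reflexivity|]. rewrite IH; reflexivity. Qed.

Lemma sumR_flat_map {A B : Type} (f : B -> R) (g : A -> list B) (l : list A) :
  sumR f (flat_map g l) = sumR (fun x => sumR f (g x)) l.
Proof.
  induction l as [|a l IH]; simpl; [reflexivity|]. rewrite sumR_app, IH; reflexivity.
Qed.

Lemma sumR_perm {A : Type} (f : A -> R) (l1 l2 : list A) :
  Permutation l1 l2 -> sumR f l1 = sumR f l2.
Proof. intros H; induction H; simpl; lra. Qed.

Lemma sumR_const {A : Type} (c : R) (l : list A) :
  sumR (fun _ => c) l = INR (length l) * c.
Proof.
  induction l as [|a l IH]; [simpl; ring|].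
  change (length (a :: l)) with (S (length l)). rewrite S_INR. simpl. rewrite IH; ring.
Qed.

Lemma sumR_exchange {A B : Type} (f : A -> B -> R) (l : list A) (l' : list B) :
  sumR (fun x => sumR (f x) l') l = sumR (fun y => sumR (fun x => f x y) l) l'.
Proof.
  induction l as [|a l IH]; simpl.
  - symmetry; apply sumR_0; reflexivity.
  - rewrite IH. rewrite <- sumR_plus. reflexivity.
Qed.

Lemma sumR_abs {A : Type} (f : A -> R) (l : list A) :
  Rabs (sumR f l) <= sumR (fun x => Rabs (f x)) l.
Proof.
  induction l as [|a l IH]; simpl; [rewrite Rabs_R0; lra|].
  eapply Rle_trans; [apply Rabs_triang|]. lra.
Qed.

Lemma sumR_filter {A : Type} (f : A -> R) (b : A -> bool) (l : list A) :
  sumR f (filter b l) = sumR (fun x => if b x then f x else 0) l.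
Proof.
  induction l as [|a l IH]; simpl; [reflexivity|].
  destruct (b a); simpl; rewrite IH; ring.
Qed.

Lemma sumR_support {A : Type} (f : A -> R) (l1 l2 : list A) :
  NoDup l1 -> NoDup l2 -> (forall x, f x <> 0 -> (In x l1 <-> In x l2)) ->
  sumR f l1 = sumR f l2.
Proof.
  intros N1 N2 H.
  set (b := fun x => if Req_EM_T (f x) 0 then false else true).
  assert (E : forall l, sumR f l = sumR f (filter b l)).
  { intros l. rewrite sumR_filter. apply sumR_ext; intros x _. unfold b.
    destruct (Req_EM_T (f x) 0); auto. }
  rewrite (E l1), (E l2). apply sumR_perm, NoDup_Permutation.
  - apply NoDup_filter; exact N1.
  - apply NoDup_filter; exact N2.
  - intros x. rewrite !filter_In. unfold b.
    destruct (Req_EM_T (f x) 0) as [e|n]; split; intros [Hx Hb]; try discriminate;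
      split; auto; apply (H x n); exact Hx.
Qed.

Lemma sumR_incl {A : Type} (f : A -> R) (l1 l2 : list A) :
  NoDup l1 -> NoDup l2 -> incl l1 l2 -> (forall x, In x l2 -> 0 <= f x) ->
  sumR f l1 <= sumR f l2.
Proof.
  intros N1 N2 Hi Hp.
  set (b := fun x => if excluded_middle_informative (In x l1) then true else false).
  assert (E : sumR f l1 = sumR f (filter b l2)).
  { apply sumR_perm, NoDup_Permutation; [exact N1|apply NoDup_filter; exact N2|].
    intros x. rewrite filter_In. unfold b.
    destruct (excluded_middle_informative (In x l1)) as [h|h]; split.
    - intros; split; auto.
    - intros _; exact h.
    - intros; contradiction.
    - intros [_ h']; discriminate. }
  rewrite E, sumR_filter. apply sumR_le. intros x Hx.
  destruct (b x); [lra|apply Hp; exact Hx].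
Qed.

Lemma NoDup_map_inj {A B : Type} (g : A -> B) (l : list A) :
  (forall x y, In x l -> In y l -> g x = g y -> x = y) -> NoDup l -> NoDup (map g l).
Proof.
  induction l as [|a l IH]; intros Hi Hn; simpl; constructor.
  - inversion_clear Hn as [|? ? Ha Hl]. intros Hin. apply in_map_iff in Hin.
    destruct Hin as [y [e Hy]]. apply Ha.
    rewrite <- (Hi y a); auto; [right; exact Hy|left; reflexivity].
  - inversion_clear Hn as [|? ? Ha Hl]. apply IH; auto.
    intros x y Hx Hy. apply Hi; right; assumption.
Qed.

(** Meant for translations and reflections, which do not map a box onto a box: only the nonzero
    terms have to be matched. *)
Lemma sumR_reindex {A B : Type} (phi : A -> B) (f : A -> R) (g : B -> R)
    (l1 : list A) (l2 : list B) :
  NoDup l1 -> NoDup l2 ->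
  (forall x y, phi x = phi y -> x = y) ->
  (forall x, In x l1 -> f x = g (phi x)) ->
  (forall x, In x l1 -> f x <> 0 -> In (phi x) l2) ->
  (forall y, In y l2 -> g y <> 0 -> exists x, In x l1 /\ phi x = y) ->
  sumR f l1 = sumR g l2.
Proof.
  intros N1 N2 Hi He H1 H2.
  rewrite (sumR_ext f (fun x => g (phi x)) l1) by exact He.
  rewrite <- (sumR_map g phi). apply sumR_support.
  - apply NoDup_map_inj; auto.
  - exact N2.
  - intros y Hy; split; intros Hin.
    + apply in_map_iff in Hin. destruct Hin as [x [e Hx]]. rewrite <- e.
      apply H1; auto. rewrite He by exact Hx. rewrite e; exact Hy.
    + destruct (H2 y Hin Hy) as [x [Hx e]]. rewrite <- e. apply in_map; exact Hx.
Qed.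

Lemma sumR_delta {A : Type} (dec : forall x y : A, {x = y} + {x <> y})
    (a : A) (f : A -> R) (l : list A) :
  NoDup l -> In a l -> sumR (fun x => if dec a x then f x else 0) l = f a.
Proof.
  intros N Ha.
  rewrite (sumR_support _ l (a :: nil)).
  - simpl. destruct (dec a a); [ring|contradiction].
  - exact N.
  - constructor; [simpl; tauto|constructor].
  - intros x. destruct (dec a x) as [e|n]; [|intros h; contradiction].
    intros _; subst; simpl; tauto.
Qed.

Lemma sumR_CS {A : Type} (f g : A -> R) (l : list A) :
  (sumR (fun x => f x * g x) l) ^ 2 <= sumR (fun x => f x ^ 2) l * sumR (fun x => g x ^ 2) l.
Proof.
  set (a := sumR (fun x => f x ^ 2) l). set (b := sumR (fun x => g x ^ 2) l).
  set (c := sumR (fun x => f x * g x) l).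
  assert (H : forall t, 0 <= a - 2 * t * c + t ^ 2 * b).
  { intros t. replace (a - 2 * t * c + t ^ 2 * b) with (sumR (fun x => (f x - t * g x) ^ 2) l).
    - apply sumR_nonneg; intros x _; apply pow2_ge_0.
    - unfold a, b, c. rewrite <- !sumR_scal, <- sumR_minus, <- sumR_plus.
      apply sumR_ext; intros; ring. }
  assert (Hb : 0 <= b) by (apply sumR_nonneg; intros; apply pow2_ge_0).
  assert (Ha : 0 <= a) by (apply sumR_nonneg; intros; apply pow2_ge_0).
  destruct (Rle_lt_or_eq_dec 0 b Hb) as [Hp|Hz].
  - specialize (H (c / b)).
    replace (a - 2 * (c / b) * c + (c / b) ^ 2 * b) with ((a * b - c ^ 2) / b) in H by (field; lra).
    assert (0 <= (a * b - c ^ 2) / b * b) by (apply Rmult_le_pos; lra).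
    replace ((a * b - c ^ 2) / b * b) with (a * b - c ^ 2) in H0 by (field; lra). lra.
  - rewrite <- Hz. destruct (Req_dec c 0) as [e|n]; [rewrite e; lra|].
    (* When [b = 0] the polynomial is affine in [t], and this [t] gives it the value -1. *)
    specialize (H ((a + 1) / (2 * c))). rewrite <- Hz in H.
    replace (a - 2 * ((a + 1) / (2 * c)) * c + ((a + 1) / (2 * c)) ^ 2 * 0) with (-1) in H
      by (field; lra).
    lra.
Qed.

(** * Cut decompositions of resistor networks *)

(* [None] is the ground. A contracted network is represented by an identification
   map [pi] through which potentials are read. *)
Definition net_energy {V : Type} (eps : R) (vs : list V) (es : list (option V * option V))
    (u : option V -> R) : R :=
  eps * sumR (fun v => u (Some v) ^ 2) vs + sumR (fun e => (u (fst e) - u (snd e)) ^ 2) es.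

(** Legendre form of the Dirichlet principle: the maximum over potentials grounded at [None] is the
    energy of the current fed by [s]. For a unit dipole it is the effective resistance. *)
Definition net_dual {V : Type} (eps : R) (vs : list V) (es : list (option V * option V))
    (s : V -> R) (u : option V -> R) : R :=
  2 * sumR (fun v => s v * u (Some v)) vs - net_energy eps vs es u.

Definition charge {V : Type} (vs : list V) (A : V -> bool) (s : V -> R) : R :=
  sumR (fun v => if A v then s v else 0) vs.

(** Singletons have their own weights [d], apart from the sets in [L], because the gain per negative
    core is read off the diagonal. *)
Definition cut_form {V : Type} (vs : list V) (d : V -> R) (L : list (R * (V -> bool)))
    (s t : V -> R) : R :=
  sumR (fun v => d v * (s v * t v)) vs +
  sumR (fun x => fst x * (charge vs (snd x) s * charge vs (snd x) t)) L.

Definition cut_rep {V : Type} (eps : R) (vs : list V) (pi : option V -> option V)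
    (es : list (option V * option V)) (d : V -> R) (L : list (R * (V -> bool))) : Prop :=
  (forall v, 0 <= d v) /\ (forall x, In x L -> 0 <= fst x) /\
  forall s,
    (forall u, u None = 0 ->
       net_dual eps vs es s (fun x => u (pi x)) <= cut_form vs d L s s) /\
    (exists u, u None = 0 /\
       net_dual eps vs es s (fun x => u (pi x)) = cut_form vs d L s s).

Definition unit_charge {V : Type} (dec : forall x y : V, {x = y} + {x <> y}) (a : option V) (v : V) : R :=
  match a with Some w => if dec w v then 1 else 0 | None => 0 end.

Definition node_in {V : Type} (vs : list V) (a : option V) : Prop :=
  match a with Some w => In w vs | None => True end.

Lemma sumR_unit_charge {V : Type} dec (vs : list V) (a : option V) (u : option V -> R) :
  NoDup vs -> node_in vs a -> u None = 0 ->
  sumR (fun v => unit_charge dec a v * u (Some v)) vs = u a.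
Proof.
  intros N Ha Hu. destruct a as [w|]; simpl in *.
  - rewrite (sumR_ext _ (fun v => if dec w v then u (Some v) else 0)).
    + rewrite (sumR_delta dec w (fun v => u (Some v))); auto.
    + intros v _. destruct (dec w v); ring.
  - rewrite Hu. apply sumR_0. intros; ring.
Qed.

Lemma charge_lin {V : Type} (vs : list V) A (s t : V -> R) (x : R) :
  charge vs A (fun v => s v + x * t v) = charge vs A s + x * charge vs A t.
Proof.
  unfold charge. rewrite <- sumR_scal, <- sumR_plus. apply sumR_ext.
  intros v _; destruct (A v); ring.
Qed.

Lemma cut_form_quad {V : Type} (vs : list V) d L (s t : V -> R) (x : R) :
  cut_form vs d L (fun v => s v + x * t v) (fun v => s v + x * t v) =
  cut_form vs d L s s + 2 * x * cut_form vs d L s t + x ^ 2 * cut_form vs d L t t.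
Proof.
  unfold cut_form.
  set (a := sumR (fun v => d v * ((s v + x * t v) * (s v + x * t v))) vs).
  assert (Ea : a = sumR (fun v => d v * (s v * s v)) vs
     + 2 * x * sumR (fun v => d v * (s v * t v)) vs
     + x ^ 2 * sumR (fun v => d v * (t v * t v)) vs).
  { unfold a. rewrite <- !sumR_scal, <- !sumR_plus. apply sumR_ext; intros; ring. }
  rewrite Ea.
  match goal with |- _ + ?b = _ => set (bb := b) end.
  assert (Eb : bb = sumR (fun y => fst y * (charge vs (snd y) s * charge vs (snd y) s)) L
     + 2 * x * sumR (fun y => fst y * (charge vs (snd y) s * charge vs (snd y) t)) L
     + x ^ 2 * sumR (fun y => fst y * (charge vs (snd y) t * charge vs (snd y) t)) L).
  { unfold bb. rewrite <- !sumR_scal, <- !sumR_plus. apply sumR_ext.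
    intros y _. rewrite charge_lin; ring. }
  rewrite Eb; ring.
Qed.

Lemma cut_form_nonneg {V : Type} (vs : list V) d L (s : V -> R) :
  (forall v, 0 <= d v) -> (forall x, In x L -> 0 <= fst x) -> 0 <= cut_form vs d L s s.
Proof.
  intros Hd HL. unfold cut_form. apply Rplus_le_le_0_compat; apply sumR_nonneg.
  - intros v _. apply Rmult_le_pos; [apply Hd|nra].
  - intros x Hx. apply Rmult_le_pos; [apply HL; exact Hx|nra].
Qed.

Definition scale_cuts {V : Type} (c : R) (L : list (R * (V -> bool))) :=
  map (fun x => (c * fst x, snd x)) L.

Lemma cut_form_mix {V : Type} (vs : list V) d0 L0 d1 L1 (a b : R) (s t : V -> R) :
  cut_form vs (fun v => a * d0 v + b * d1 v) (scale_cuts a L0 ++ scale_cuts b L1) s t =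
  a * cut_form vs d0 L0 s t + b * cut_form vs d1 L1 s t.
Proof.
  unfold cut_form. rewrite sumR_app. unfold scale_cuts. rewrite !sumR_map. simpl.
  rewrite (sumR_ext (fun x => a * fst x * _) (fun x => a * (fst x * (charge vs (snd x) s * charge vs (snd x) t))) L0) by (intros; ring).
  rewrite (sumR_ext (fun x => b * fst x * _) (fun x => b * (fst x * (charge vs (snd x) s * charge vs (snd x) t))) L1) by (intros; ring).
  rewrite (sumR_ext (fun v => (a * d0 v + b * d1 v) * (s v * t v))
     (fun v => a * (d0 v * (s v * t v)) + b * (d1 v * (s v * t v))) vs) by (intros; ring).
  rewrite sumR_plus, !sumR_scal. ring.
Qed.

Lemma opt_dec {V : Type} (dec : forall x y : V, {x = y} + {x <> y}) :
  forall x y : option V, {x = y} + {x <> y}.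
Proof. decide equality. Defined.

(** The renamed class is that of [a], except when [a] is grounded: then it is that of [b], so that
    [None] remains the name of the ground. *)
Definition merge {V : Type} (dec : forall x y : V, {x = y} + {x <> y})
    (pi : option V -> option V) (a b x : option V) : option V :=
  let from := match pi a with None => pi b | Some _ => pi a end in
  let to := match pi a with None => None | Some _ => pi b end in
  if opt_dec dec (pi x) from then to else pi x.

Lemma merge_eq {V : Type} dec (pi : option V -> option V) a b (u : option V -> R) :
  u (pi a) = u (pi b) -> forall x, u (merge dec pi a b x) = u (pi x).
Proof.
  intros H x. unfold merge. destruct (opt_dec dec (pi x) _) as [e|n]; [|reflexivity].
  rewrite e. destruct (pi a); congruence.
Qed.

(** With [merge_eq], identifies the potentials of the contracted network with those taking equal
    values at the two ends of the edge. *)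
Lemma merge_lift {V : Type} dec (pi : option V -> option V) a b (u : option V -> R) :
  pi a <> pi b -> u None = 0 ->
  exists u', u' None = 0 /\ u' (pi a) = u' (pi b) /\
    forall x, u (merge dec pi a b x) = u' (pi x).
Proof.
  intros Hab Hu.
  set (from := match pi a with None => pi b | Some _ => pi a end).
  set (to := match pi a with None => None | Some _ => pi b end).
  exists (fun y => if opt_dec dec y from then u to else u y). repeat split.
  - destruct (opt_dec dec None from) as [e|n]; [|exact Hu].
    unfold from in e. destruct (pi a); congruence.
  - destruct (opt_dec dec (pi a) from) as [e|n], (opt_dec dec (pi b) from) as [e'|n'];
      try reflexivity; unfold from, to in *; destruct (pi a); congruence.
  - intros x. unfold merge. fold from to. destruct (opt_dec dec (pi x) from); reflexivity.
Qed.

Lemma net_dual_shift {V : Type} dec eps (vs : list V) es (s : V -> R) a b x (u : option V -> R) :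
  NoDup vs -> node_in vs a -> node_in vs b -> u None = 0 ->
  net_dual eps vs es (fun v => s v + x * (unit_charge dec a v - unit_charge dec b v)) u =
  net_dual eps vs es s u + 2 * x * (u a - u b).
Proof.
  intros N Ha Hb Hu. unfold net_dual.
  rewrite (sumR_ext _ (fun v => s v * u (Some v)
    + x * (unit_charge dec a v * u (Some v) - unit_charge dec b v * u (Some v))) vs) by (intros; ring).
  rewrite sumR_plus, sumR_scal, sumR_minus, !sumR_unit_charge by assumption. ring.
Qed.

Lemma net_dual_cons {V : Type} eps (vs : list V) a b es (s : V -> R) (u : option V -> R) :
  net_dual eps vs ((a, b) :: es) s u = net_dual eps vs es s u - (u a - u b) ^ 2.
Proof. unfold net_dual, net_energy. simpl. ring. Qed.

Lemma net_dual_ext {V : Type} eps (vs : list V) es (s : V -> R) (u u' : option V -> R) :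
  (forall x, u x = u' x) -> net_dual eps vs es s u = net_dual eps vs es s u'.
Proof. intros H. rewrite (functional_extensionality u u' H). reflexivity. Qed.

(* Maximising [- (t - B)^2 / r - t^2] over [t = u a - u b] gives the value for the network
   with the edge; restricting to [t = 0] gives the contracted one. *)
Lemma cut_rep_edge {V : Type} dec eps (vs : list V) pi a b es d0 L0 dc Lc :
  NoDup vs -> node_in vs a -> node_in vs b -> pi None = None -> pi a <> pi b ->
  cut_rep eps vs pi es d0 L0 -> cut_rep eps vs (merge dec pi a b) es dc Lc ->
  let r := cut_form vs d0 L0 (fun v => unit_charge dec a v - unit_charge dec b v)
             (fun v => unit_charge dec a v - unit_charge dec b v) in
  0 < r /\
  cut_rep eps vs pi ((a, b) :: es)
    (fun v => / (1 + r) * d0 v + r / (1 + r) * dc v)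
    (scale_cuts (/ (1 + r)) L0 ++ scale_cuts (r / (1 + r)) Lc).
Proof.
  intros N Ha Hb Hpi Hab [Hd0 [HL0 H0]] [Hdc [HLc Hc]] r.
  set (be := fun v => unit_charge dec a v - unit_charge dec b v) in *.
  set (F := fun s (u : option V -> R) => net_dual eps vs es s (fun x => u (pi x))).
  set (Q := fun s => cut_form vs d0 L0 s s).
  set (B := fun s => cut_form vs d0 L0 s be).
  assert (Hshift : forall s x u, u None = 0 ->
     F (fun v => s v + x * be v) u = F s u + 2 * x * (u (pi a) - u (pi b))).
  { intros s x u Hu. unfold F, be. rewrite net_dual_shift; auto. rewrite Hpi; exact Hu. }
  assert (HQ : forall s x, Q (fun v => s v + x * be v) = Q s + 2 * x * B s + x ^ 2 * r).
  { intros s x. unfold Q, B, r. apply cut_form_quad. }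
  (* The hypothesis for the charge [s + x be] is a family of upper bounds on [F s u] with a free
     parameter [x]. *)
  assert (Hup : forall s x u, u None = 0 ->
     F s u <= Q s + 2 * x * (B s - (u (pi a) - u (pi b))) + x ^ 2 * r).
  { intros s x u Hu. destruct (H0 (fun v => s v + x * be v)) as [h _].
    specialize (h u Hu). fold (F (fun v => s v + x * be v) u) in h.
    fold (Q (fun v => s v + x * be v)) in h. rewrite Hshift, HQ in h by exact Hu. lra. }
  assert (Hr0 : 0 <= r) by (apply cut_form_nonneg; assumption).
  (* With zero resistance these bounds would be affine in [x], of nonzero slope for a potential that
     separates the two ends, hence violated for some [x]. *)
  assert (Hr : 0 < r).
  { destruct (Rle_lt_or_eq_dec 0 r Hr0) as [h|h]; [exact h|exfalso].
    assert (Hu : exists u : option V -> R, u None = 0 /\ u (pi a) - u (pi b) <> 0).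
    { exists (fun y => match y with None => 0 | Some _ =>
        match pi a with None => 1 | Some _ => if opt_dec dec y (pi a) then 1 else 0 end end).
      split; [reflexivity|].
      destruct (pi a) as [pa|] eqn:Ea, (pi b) as [pb|] eqn:Eb.
      - destruct (opt_dec dec (Some pa) (Some pa)) as [_|n]; [|congruence].
        destruct (opt_dec dec (Some pb) (Some pa)); [congruence|lra].
      - destruct (opt_dec dec (Some pa) (Some pa)) as [_|n]; [lra|congruence].
      - lra.
      - congruence. }
    destruct Hu as [u [Hu Hdel]].
    set (s0 := fun _ : V => 0). set (de := u (pi a) - u (pi b)) in *.
    assert (HB0 : B s0 = 0).
    { unfold B, cut_form, s0. rewrite (sumR_0 (fun v => d0 v * _)) by (intros; ring).
      rewrite sumR_0; [ring|]. intros y _.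
      replace (charge vs (snd y) (fun _ => 0)) with 0; [ring|].
      symmetry; apply sumR_0. intros v _; destruct (snd y v); reflexivity. }
    specialize (Hup s0 ((Q s0 - F s0 u + 1) / (2 * de)) u Hu). fold de in Hup.
    rewrite HB0, <- h in Hup.
    replace (2 * ((Q s0 - F s0 u + 1) / (2 * de)) * (0 - de)) with (- (Q s0 - F s0 u + 1)) in Hup
      by (field; exact Hdel).
    lra. }
  assert (Hup2 : forall s u, u None = 0 ->
     F s u <= Q s - (u (pi a) - u (pi b) - B s) ^ 2 / r).
  { intros s u Hu. specialize (Hup s ((u (pi a) - u (pi b) - B s) / r) u Hu).
    eapply Rle_trans; [exact Hup|]. right. field. lra. }
  (* The maximiser for [s + x be] makes the bound sharp, which determines its potential drop across
     the edge. *)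
  assert (Hatt : forall s x, exists u, u None = 0 /\
     u (pi a) - u (pi b) = B s + x * r /\ F s u = Q s - x ^ 2 * r).
  { intros s x. destruct (H0 (fun v => s v + x * be v)) as [_ [u [Hu e]]].
    fold (F (fun v => s v + x * be v) u) in e. fold (Q (fun v => s v + x * be v)) in e.
    rewrite Hshift, HQ in e by exact Hu.
    exists u. split; [exact Hu|].
    specialize (Hup2 s u Hu). set (de := u (pi a) - u (pi b)) in *.
    assert (E : de = B s + x * r).
    { assert (h : (de - B s - x * r) ^ 2 / r <= 0).
      { replace ((de - B s - x * r) ^ 2 / r)
          with ((de - B s) ^ 2 / r - 2 * x * (de - B s) + x ^ 2 * r) by (field; lra). lra. }
      assert (h' : (de - B s - x * r) ^ 2 <= 0).
      { apply Rmult_le_reg_r with (/ r); [apply Rinv_0_lt_compat; exact Hr|].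
        rewrite Rmult_0_l. exact h. }
      nra. }
    split; [exact E|]. rewrite E in e. lra. }
  assert (HQc : forall s, cut_form vs dc Lc s s = Q s - B s ^ 2 / r).
  { intros s. destruct (Hc s) as [hle [u [Hu e]]]. apply Rle_antisym.
    - destruct (merge_lift dec pi a b u Hab Hu) as [u' [Hu' [Heq Hlift]]].
      rewrite <- e. rewrite (net_dual_ext _ _ _ _ _ (fun x => u' (pi x)) Hlift).
      fold (F s u'). specialize (Hup2 s u' Hu'). rewrite Heq in Hup2.
      replace (u' (pi b) - u' (pi b) - B s) with (- B s) in Hup2 by ring.
      replace ((- B s) ^ 2) with (B s ^ 2) in Hup2 by ring. exact Hup2.
    - destruct (Hatt s (- (B s / r))) as [u' [Hu' [hd hF]]].
      replace (B s + - (B s / r) * r) with 0 in hd by (field; lra).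
      replace (Q s - B s ^ 2 / r) with (F s u') by (rewrite hF; field; lra).
      unfold F. rewrite <- (net_dual_ext _ _ _ _ _ _ (merge_eq dec pi a b u' ltac:(lra))).
      apply hle; exact Hu'. }
  split; [exact Hr|].
  assert (H1r : 0 < / (1 + r)) by (apply Rinv_0_lt_compat; lra).
  assert (H2r : 0 < r / (1 + r)) by (apply Rdiv_lt_0_compat; lra).
  split; [|split].
  - intros v. specialize (Hd0 v); specialize (Hdc v).
    apply Rplus_le_le_0_compat; apply Rmult_le_pos; lra.
  - intros x Hx. apply in_app_or in Hx. unfold scale_cuts in Hx.
    destruct Hx as [Hx|Hx]; apply in_map_iff in Hx; destruct Hx as [y [e Hy]]; subst x; simpl;
      apply Rmult_le_pos; try lra; auto.
  - intros s. rewrite cut_form_mix. fold (Q s). rewrite HQc.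
    assert (Ev : / (1 + r) * Q s + r / (1 + r) * (Q s - B s ^ 2 / r) = Q s - B s ^ 2 / (1 + r))
      by (field; lra).
    rewrite Ev. split.
    + intros u Hu. rewrite net_dual_cons. fold (F s u). specialize (Hup2 s u Hu).
      set (de := u (pi a) - u (pi b)) in *.
      assert (h : 0 <= (de - B s) ^ 2 / r + de ^ 2 - B s ^ 2 / (1 + r)).
      { replace ((de - B s) ^ 2 / r + de ^ 2 - B s ^ 2 / (1 + r))
          with (((1 + r) * de - B s) ^ 2 / (r * (1 + r))) by (field; lra).
        apply Rmult_le_pos; [apply pow2_ge_0|]. left; apply Rinv_0_lt_compat; nra. }
      lra.
    + destruct (Hatt s (- (B s / (1 + r)))) as [u [Hu [hd hF]]].
      exists u. split; [exact Hu|]. rewrite net_dual_cons. fold (F s u). rewrite hF.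
      change ((fun x => u (pi x)) a) with (u (pi a)). change ((fun x => u (pi x)) b) with (u (pi b)).
      rewrite hd. field. lra.
Qed.

Lemma cut_rep_loop {V : Type} eps (vs : list V) pi a b es d L :
  pi a = pi b -> cut_rep eps vs pi es d L -> cut_rep eps vs pi ((a, b) :: es) d L.
Proof.
  intros Hab [Hd [HL H]]. split; [exact Hd|split; [exact HL|]].
  assert (E : forall s (u : option V -> R), net_dual eps vs ((a, b) :: es) s (fun x => u (pi x)) =
     net_dual eps vs es s (fun x => u (pi x))).
  { intros s u. rewrite net_dual_cons, Hab. ring. }
  intros s. destruct (H s) as [h1 [u [Hu h2]]]. split.
  - intros u' Hu'. rewrite E. auto.
  - exists u. split; [exact Hu|]. rewrite E; exact h2.
Qed.

Definition isolated {V : Type} (vs : list V) (pi : option V -> option V) (v : V) : Prop :=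
  pi (Some v) <> None /\ forall w, In w vs -> pi (Some w) = pi (Some v) -> w = v.

Definition untouched {V : Type} (es : list (option V * option V)) (v : V) : Prop :=
  forall e, In e es -> fst e <> Some v /\ snd e <> Some v.

Lemma sumR_fibers {V : Type} (dec : forall x y : V, {x = y} + {x <> y}) (vs : list V)
    (pi : option V -> option V) (cl : list (option V)) (g : V -> R) :
  NoDup cl -> (forall v, In v vs -> g v <> 0 -> In (pi (Some v)) cl) ->
  sumR g vs = sumR (fun c => sumR (fun v => if opt_dec dec (pi (Some v)) c then g v else 0) vs) cl.
Proof.
  intros N H. rewrite sumR_exchange. apply sumR_ext. intros v Hv.
  destruct (Req_dec (g v) 0) as [e|n].
  - rewrite e. symmetry. apply sumR_0. intros c _. destruct (opt_dec _ _ _); reflexivity.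
  - rewrite (sumR_delta (opt_dec dec) (pi (Some v)) (fun _ => g v)); auto.
Qed.

(** Without edges, each class is tied to the ground only, with conductance [eps] times its size, so
    a charge [q] on it contributes [q^2] over that conductance. One-element classes are entered in
    the diagonal. *)
Lemma cut_rep_nil {V : Type} (dec : forall x y : V, {x = y} + {x <> y}) eps (vs : list V) pi :
  NoDup vs -> 0 < eps ->
  exists d L, cut_rep eps vs pi [] d L /\
    forall v, In v vs -> isolated vs pi v -> / eps <= d v.
Proof.
  intros N He.
  set (cl := filter (fun c => match c with None => false | Some _ => true end)
               (nodup (opt_dec dec) (map (fun v => pi (Some v)) vs))).
  assert (Ncl : NoDup cl) by (apply NoDup_filter, NoDup_nodup).
  assert (Hcl : forall c, In c cl <-> c <> None /\ exists v, In v vs /\ pi (Some v) = c).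
  { intros c. unfold cl. rewrite filter_In, nodup_In, in_map_iff. split.
    - intros [[v [e Hv]] h]. split; [destruct c; congruence|exists v; auto].
    - intros [h [v [Hv e]]]. split; [exists v; auto|destruct c; congruence]. }
  set (mem := fun c v => if opt_dec dec (pi (Some v)) c then true else false).
  set (cnt := fun c => charge vs (mem c) (fun _ => 1)).
  assert (Hcnt : forall c, In c cl -> 0 < cnt c).
  { intros c Hc. apply Hcl in Hc. destruct Hc as [_ [v [Hv e]]].
    unfold cnt, charge. apply Rlt_le_trans with 1; [lra|].
    assert (E1 := sumR_delta dec v (fun _ => 1) vs N Hv). cbv beta in E1.
    apply Rle_trans with (sumR (fun x => if dec v x then 1 else 0) vs); [lra|].
    apply sumR_le. intros w _.
    unfold mem. destruct (dec v w) as [e'|n]; destruct (opt_dec dec (pi (Some w)) c); try lra.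
    exfalso; congruence. }
  set (iso := fun v => isolated vs pi v).
  set (d := fun v => if excluded_middle_informative (iso v) then / eps else 0).
  set (sing := fun c => exists v, In v vs /\ iso v /\ pi (Some v) = c).
  set (w := fun c => if excluded_middle_informative (sing c) then 0 else / (eps * cnt c)).
  set (L := map (fun c => (w c, mem c)) cl).
  assert (Hd : forall v, 0 <= d v).
  { intros v. unfold d. destruct (excluded_middle_informative _); [|lra].
    left; apply Rinv_0_lt_compat; exact He. }
  exists d, L. split.
  2:{ intros v _ Hv. unfold d. destruct (excluded_middle_informative _); [lra|contradiction]. }
  split; [exact Hd|split].
  { intros x Hx. apply in_map_iff in Hx. destruct Hx as [c [e Hc]]. subst x. simpl. unfold w.
    destruct (excluded_middle_informative _); [lra|].
    left; apply Rinv_0_lt_compat. specialize (Hcnt c Hc). nra. }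
  intros s.
  assert (HQ : cut_form vs d L s s = sumR (fun c => charge vs (mem c) s ^ 2 / (eps * cnt c)) cl).
  { unfold cut_form, L. rewrite sumR_map. simpl.
    rewrite (sumR_fibers dec vs pi cl (fun v => d v * (s v * s v)) Ncl).
    2:{ intros v Hv h. apply Hcl. split; [|exists v; auto]. unfold d in h.
        destruct (excluded_middle_informative (iso v)) as [[i _]|i]; [exact i|].
        rewrite Rmult_0_l in h; congruence. }
    rewrite <- sumR_plus. apply sumR_ext. intros c Hc.
    unfold w. destruct (excluded_middle_informative (sing c)) as [[v [Hv [Hi e]]]|ns].
    - assert (K : forall g : V -> R, sumR (fun x => if opt_dec dec (pi (Some x)) c then g x else 0) vs = g v).
      { intros g. rewrite <- (sumR_delta dec v g vs N Hv). apply sumR_ext. intros x Hx.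
        destruct (opt_dec dec (pi (Some x)) c) as [e1|n1], (dec v x) as [e2|n2]; auto.
        - exfalso; apply n2. symmetry. apply (proj2 Hi); congruence.
        - subst x; contradiction. }
      assert (Kc : forall g : V -> R, charge vs (mem c) g = g v).
      { intros g. rewrite <- (K g). apply sumR_ext. intros x _. unfold mem.
        destruct (opt_dec dec (pi (Some x)) c); reflexivity. }
      rewrite K. unfold cnt. rewrite !Kc. unfold d.
      destruct (excluded_middle_informative (iso v)); [|contradiction]. field. lra.
    - rewrite (sumR_0 (fun v => if opt_dec dec (pi (Some v)) c then _ else 0)).
      + specialize (Hcnt c Hc). field. lra.
      + intros v Hv. destruct (opt_dec dec (pi (Some v)) c) as [e|n]; [|reflexivity].
        unfold d. destruct (excluded_middle_informative (iso v)) as [i|i]; [|ring].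
        exfalso; apply ns; exists v; auto. }
  assert (HF : forall u : option V -> R, u None = 0 ->
     net_dual eps vs [] s (fun x => u (pi x)) =
     sumR (fun c => 2 * (charge vs (mem c) s * u c) - eps * cnt c * u c ^ 2) cl).
  { intros u Hu. unfold net_dual, net_energy. simpl (sumR _ []).
    rewrite Rplus_0_r, <- !sumR_scal, <- sumR_minus.
    rewrite (sumR_fibers dec vs pi cl).
    - apply sumR_ext. intros c _. unfold cnt.
      replace (2 * (charge vs (mem c) s * u c) - eps * charge vs (mem c) (fun _ => 1) * u c ^ 2)
        with ((2 * u c) * charge vs (mem c) s - (eps * u c ^ 2) * charge vs (mem c) (fun _ => 1)) by ring.
      unfold charge. rewrite <- !sumR_scal, <- sumR_minus. apply sumR_ext. intros v _.
      unfold mem. destruct (opt_dec dec (pi (Some v)) c) as [e|n]; [rewrite e|]; ring.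
    - exact Ncl.
    - intros v Hv h. apply Hcl. split; [|exists v; auto]. intros e.
      apply h. rewrite e, Hu. ring. }
  rewrite HQ. split.
  - intros u Hu. rewrite HF by exact Hu. apply sumR_le. intros c Hc.
    specialize (Hcnt c Hc). set (q := charge vs (mem c) s). set (k := eps * cnt c).
    assert (0 < k) by (unfold k; nra).
    assert (h : 0 <= (q - k * u c) ^ 2 / k).
    { apply Rmult_le_pos; [apply pow2_ge_0|left; apply Rinv_0_lt_compat; exact H]. }
    replace ((q - k * u c) ^ 2 / k) with (q ^ 2 / k - 2 * (q * u c) + k * u c ^ 2) in h
      by (field; lra). lra.
  - set (u0 := fun c => match c with None => 0 | Some _ => charge vs (mem c) s / (eps * cnt c) end).
    exists u0.
    split; [reflexivity|]. rewrite (HF u0 eq_refl). unfold u0. apply sumR_ext. intros c Hc.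
    assert (Hn : c <> None) by (apply Hcl in Hc; tauto).
    specialize (Hcnt c Hc). destruct c as [c|]; [|congruence]. field. lra.
Qed.

(** * Lower bounds for the diagonal of a cut decomposition *)

Lemma merge_None {V : Type} (dec : forall x y : V, {x = y} + {x <> y}) (pi : option V -> option V) a b :
  pi None = None -> pi a <> pi b -> merge dec pi a b None = None.
Proof.
  intros H Hab. unfold merge. rewrite H. destruct (opt_dec dec None _) as [e|n]; [|reflexivity].
  destruct (pi a); congruence.
Qed.

Lemma isolated_merge {V : Type} (dec : forall x y : V, {x = y} + {x <> y}) (vs : list V) (pi : option V -> option V) a b v :
  pi None = None -> node_in vs a -> node_in vs b ->
  a <> Some v -> b <> Some v -> isolated vs pi v -> isolated vs (merge dec pi a b) v.
Proof.
  intros Hn Ha Hb Hav Hbv [Hv Hi].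
  assert (K : forall x, node_in vs x -> x <> Some v -> pi x <> pi (Some v)).
  { intros [x|] Hx hx e; [|congruence]. apply hx. f_equal. apply Hi; assumption. }
  assert (Ka := K a Ha Hav). assert (Kb := K b Hb Hbv).
  assert (E : merge dec pi a b (Some v) = pi (Some v)).
  { unfold merge. destruct (opt_dec dec (pi (Some v)) _) as [e|n]; [|reflexivity].
    destruct (pi a); congruence. }
  split; [congruence|]. intros w Hw e. rewrite E in e. unfold merge in e.
  destruct (opt_dec dec (pi (Some w)) _) as [e'|n']; [|apply Hi; auto].
  destruct (pi a); congruence.
Qed.

(* The extra diagonal threshold [thr] survives adding an edge: it is met by both the
   deleted and the contracted network; [q] gains from the deleted one only. *)
Lemma cut_rep_cons {V : Type} (dec : forall x y : V, {x = y} + {x <> y}) eps (vs : list V) pi a b es (thr : V -> R) q t rmax :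
  NoDup vs -> node_in vs a -> node_in vs b -> pi None = None -> 0 <= t ->
  (pi a <> pi b -> forall u : option V -> R, u None = 0 ->
     2 * (u (pi a) - u (pi b)) - net_energy eps vs es (fun x => u (pi x)) <= rmax) ->
  0 <= rmax ->
  (exists d L, cut_rep eps vs pi es d L /\
     forall v, thr v + (if dec q v then t else 0) <= d v) ->
  (pi a <> pi b -> exists d L, cut_rep eps vs (merge dec pi a b) es d L /\ forall v, thr v <= d v) ->
  exists d L, cut_rep eps vs pi ((a, b) :: es) d L /\
     forall v, thr v + (if dec q v then t / (1 + rmax) else 0) <= d v.
Proof.
  intros N Ha Hb Hpi Ht Hr Hrm [d0 [L0 [H0 T0]]] Hc.
  destruct (opt_dec dec (pi a) (pi b)) as [e|n].
  - exists d0, L0. split; [apply cut_rep_loop; assumption|].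
    intros v. specialize (T0 v). destruct (dec q v); [|exact T0].
    assert (t / (1 + rmax) <= t); [|lra].
    apply Rmult_le_reg_r with (1 + rmax); [lra|]. unfold Rdiv.
    rewrite Rmult_assoc, Rinv_l by lra. nra.
  - destruct (Hc n) as [dc [Lc [H1 T1]]].
    destruct (cut_rep_edge dec eps vs pi a b es d0 L0 dc Lc N Ha Hb Hpi n H0 H1) as [Hrp H2].
    set (r := cut_form vs d0 L0 _ _) in *.
    assert (Hrr : r <= rmax).
    { destruct H0 as [_ [_ H0]].
      destruct (H0 (fun v => unit_charge dec a v - unit_charge dec b v)) as [_ [u [Hu e]]].
      fold r in e. rewrite <- e. specialize (Hr n u Hu).
      unfold net_dual.
      rewrite (sumR_ext _ (fun v => unit_charge dec a v * u (pi (Some v)) - unit_charge dec b v * u (pi (Some v))))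
        by (intros; ring).
      rewrite sumR_minus.
      rewrite (sumR_unit_charge dec vs a (fun x => u (pi x)) N Ha) by (rewrite Hpi; exact Hu).
      rewrite (sumR_unit_charge dec vs b (fun x => u (pi x)) N Hb) by (rewrite Hpi; exact Hu).
      exact Hr. }
    eexists; eexists; split; [exact H2|].
    intros v. specialize (T0 v); specialize (T1 v). cbv beta.
    assert (P1 : 0 < / (1 + r)) by (apply Rinv_0_lt_compat; lra).
    apply Rle_trans with (/ (1 + r) * (thr v + (if dec q v then t else 0)) + r / (1 + r) * thr v).
    + replace (/ (1 + r) * (thr v + (if dec q v then t else 0)) + r / (1 + r) * thr v)
        with (thr v + / (1 + r) * (if dec q v then t else 0)) by (field; lra).
      apply Rplus_le_compat_l. destruct (dec q v); [|lra].
      unfold Rdiv. rewrite Rmult_comm. apply Rmult_le_compat_r; [exact Ht|].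
      apply Rinv_le_contravar; lra.
    + apply Rplus_le_compat.
      * apply Rmult_le_compat_l; lra.
      * apply Rmult_le_compat_l; [|exact T1]. unfold Rdiv. nra.
Qed.

Lemma net_energy_two {V : Type} (dec : forall x y : V, {x = y} + {x <> y})
    eps (vs : list V) es (u : option V -> R) q w :
  0 < eps -> NoDup vs -> In q vs -> In w vs -> q <> w ->
  eps * (u (Some q) ^ 2 + u (Some w) ^ 2) <= net_energy eps vs es u.
Proof.
  intros He N Hq Hw Hqw. unfold net_energy.
  assert (0 <= sumR (fun e => (u (fst e) - u (snd e)) ^ 2) es)
    by (apply sumR_nonneg; intros; apply pow2_ge_0).
  assert (u (Some q) ^ 2 + u (Some w) ^ 2 <= sumR (fun v => u (Some v) ^ 2) vs); [|nra].
  rewrite <- (sumR_delta dec q (fun v => u (Some v) ^ 2) vs N Hq).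
  rewrite <- (sumR_delta dec w (fun v => u (Some v) ^ 2) vs N Hw).
  rewrite <- sumR_plus. apply sumR_le. intros x _.
  destruct (dec q x), (dec w x); subst; try congruence;
    try (assert (h := pow2_ge_0 (u (Some x))); lra).
Qed.

(** Young's inequality: a connection of resistance at most [rmax] between [a] and [b] bounds the
    effective resistance. *)
Lemma net_energy_le_inv {V : Type} eps (vs : list V) es (u : option V -> R) rmax :
  0 < rmax -> 0 < eps ->
  forall a b, (u a - u b) ^ 2 <= rmax * sumR (fun e => (u (fst e) - u (snd e)) ^ 2) es ->
  2 * (u a - u b) - net_energy eps vs es u <= rmax.
Proof.
  intros Hr He a b H. unfold net_energy.
  assert (0 <= sumR (fun v => u (Some v) ^ 2) vs) by (apply sumR_nonneg; intros; apply pow2_ge_0).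
  set (t := u a - u b) in *. set (S := sumR _ es) in *.
  assert (2 * t <= rmax + S); [|nra].
  assert (h : 0 <= (t - rmax) ^ 2) by apply pow2_ge_0.
  assert (rmax * (2 * t) <= rmax * (rmax + S)) by nra.
  apply Rmult_le_reg_l with rmax; assumption.
Qed.

(** The edge to [nb q 0] is last in the list, hence added first: it then provides the connection of
    bounded resistance needed for the two others. *)
Definition star {V : Type} (nb : V -> nat -> V) (q : V) : list (option V * option V) :=
  [(Some q, Some (nb q 1%nat)); (Some q, Some (nb q 2%nat)); (Some q, Some (nb q 0%nat))].

Definition well_formed {V : Type} (vs : list V) (es : list (option V * option V)) : Prop :=
  forall e, In e es -> node_in vs (fst e) /\ node_in vs (snd e).

(** An isolated vertex met by no edge keeps its weight [/ eps], since each edge step is a convex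
    combination of the deleted and the contracted network and both have this weight. *)
Lemma cut_rep_exists {V : Type} (dec : forall x y : V, {x = y} + {x <> y}) eps (vs : list V) es :
  NoDup vs -> 0 < eps -> well_formed vs es -> forall pi, pi None = None ->
  exists d L, cut_rep eps vs pi es d L /\
    forall v, In v vs -> isolated vs pi v -> untouched es v -> / eps <= d v.
Proof.
  intros N He. induction es as [|[a b] es IH]; intros W pi Hpi.
  - destruct (cut_rep_nil dec eps vs pi N He) as [d [L [H T]]].
    exists d, L. split; auto.
  - assert (W' : well_formed vs es) by (intros e h; apply W; right; exact h).
    destruct (W (a, b) (or_introl eq_refl)) as [Ha Hb]. simpl in Ha, Hb.
    assert (Hi : 0 < / eps) by (apply Rinv_0_lt_compat; exact He).
    assert (U : forall v, untouched ((a, b) :: es) v -> a <> Some v /\ b <> Some v /\ untouched es v).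
    { intros v h. destruct (h (a, b) (or_introl eq_refl)) as [h1 h2]. split; [exact h1|].
      split; [exact h2|]. intros e he. apply h. right; exact he. }
    destruct (IH W' pi Hpi) as [d0 [L0 [H0 T0]]].
    destruct (opt_dec dec (pi a) (pi b)) as [e|n].
    + exists d0, L0. split; [apply cut_rep_loop; assumption|].
      intros v Hv hi hu. apply T0; auto. apply U; exact hu.
    + destruct (IH W' (merge dec pi a b) (merge_None dec pi a b Hpi n)) as [dc [Lc [H1 T1]]].
      destruct (cut_rep_edge dec eps vs pi a b es d0 L0 dc Lc N Ha Hb Hpi n H0 H1) as [Hrp H2].
      set (r := cut_form vs d0 L0 _ _) in *.
      eexists; eexists; split; [exact H2|].
      intros v Hv hi hu. destruct (U v hu) as [h1 [h2 h3]].
      specialize (T0 v Hv hi h3).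
      specialize (T1 v Hv (isolated_merge dec vs pi a b v Hpi Ha Hb h1 h2 hi) h3).
      assert (P1 : 0 < / (1 + r)) by (apply Rinv_0_lt_compat; lra).
      assert (P2 : 0 < r / (1 + r)) by (apply Rdiv_lt_0_compat; lra).
      apply Rle_trans with (/ (1 + r) * / eps + r / (1 + r) * / eps); [right; field; lra|].
      apply Rplus_le_compat; apply Rmult_le_compat_l; lra.
Qed.

(** The last clause says that outside the stars the neighbours of [q] are connected with resistance
    at most 4. *)
Definition star_center {V : Type} (vs : list V) (nb : V -> nat -> V)
    (E0 : list (option V * option V)) (D : list V) (q : V) : Prop :=
  In q vs /\ (forall i, (i < 3)%nat -> In (nb q i) vs /\ ~ In (nb q i) D /\ nb q i <> q) /\
  untouched E0 q /\
  forall (u : option V -> R) i, (i < 3)%nat ->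
    (u (Some (nb q i)) - u (Some (nb q 0%nat))) ^ 2 <=
    4 * sumR (fun e => (u (fst e) - u (snd e)) ^ 2) E0.

Lemma untouched_flat_star {V : Type} (nb : V -> nat -> V) E0 D (v : V) :
  ~ In v D -> (forall q, In q D -> forall i, (i < 3)%nat -> nb q i <> v) -> untouched E0 v ->
  untouched (flat_map (star nb) D ++ E0) v.
Proof.
  intros Hv Hn H0 e He. apply in_app_or in He. destruct He as [He|He]; [|auto].
  apply in_flat_map in He. destruct He as [q [Hq He]].
  assert (q <> v) by congruence.
  simpl in He. destruct He as [e1|[e1|[e1|[]]]]; subst e; simpl; split; intros h; injection h as h;
    try contradiction.
  - exact (Hn q Hq 1%nat ltac:(lia) h).
  - exact (Hn q Hq 2%nat ltac:(lia) h).
  - exact (Hn q Hq 0%nat ltac:(lia) h).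
Qed.

(* In each star the probability that all three edges are deleted is at least [eps / 108]
   up to the factor gained from the isolated vertex of conductance [eps]. *)
Lemma cut_rep_stars {V : Type} (dec : forall x y : V, {x = y} + {x <> y}) eps (vs : list V)
    nb E0 (D : list V) :
  NoDup vs -> 0 < eps <= 1 -> well_formed vs E0 -> NoDup D ->
  (forall q, In q D -> star_center vs nb E0 D q) ->
  forall pi, pi None = None -> (forall q, In q D -> isolated vs pi q) ->
  exists d L, cut_rep eps vs pi (flat_map (star nb) D ++ E0) d L /\
    (forall q, In q D -> / 108 <= d q) /\
    (forall v, In v vs -> isolated vs pi v -> untouched (flat_map (star nb) D ++ E0) v -> / eps <= d v).
Proof.
  intros N He W0. induction D as [|q D IH]; intros ND HD pi Hpi Hiso.
  - destruct (cut_rep_exists dec eps vs E0 N (proj1 He) W0 pi Hpi) as [d [L [H T]]].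
    exists d, L. split; [exact H|split; [intros q []|exact T]].
  - inversion_clear ND as [|? ? HqD ND'].
    assert (HD' : forall q', In q' D -> star_center vs nb E0 D q').
    { intros q' Hq'. destruct (HD q' (or_intror Hq')) as [h1 [h2 [h3 h4]]].
      split; [exact h1|split; [|split; assumption]].
      intros i Hi. destruct (h2 i Hi) as [a [b c]]. split; [exact a|split; [|exact c]].
      intros h; apply b; right; exact h. }
    specialize (IH ND' HD').
    destruct (HD q (or_introl eq_refl)) as [Hqv [Hnb [Hq0 Hpath]]].
    set (rest := flat_map (star nb) D ++ E0) in *.
    assert (Efull : flat_map (star nb) (q :: D) ++ E0 = star nb q ++ rest).
    { unfold rest. simpl. reflexivity. }
    rewrite Efull.
    assert (Hi : 0 < / eps) by (apply Rinv_0_lt_compat; lra).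
    set (P := fun v => In v vs /\ isolated vs pi v /\ untouched (star nb q ++ rest) v).
    set (thr := fun v => if excluded_middle_informative (In v D) then / 108
                         else if excluded_middle_informative (P v) then / eps else 0).
    (* The maps obtained by contracting edges of the star of [q] are of this kind: the centres in
       [D] and the vertices met by no edge stay isolated, so the induction hypothesis applies to
       them. *)
    set (good := fun pi' : option V -> option V => pi' None = None /\
            (forall q', In q' D -> isolated vs pi' q') /\ (forall v, P v -> isolated vs pi' v)).
    assert (Hrest : forall v, untouched (star nb q ++ rest) v -> untouched rest v).
    { intros v h e h'. apply h. apply in_or_app; right; exact h'. }
    assert (Wrest : well_formed vs rest).
    { intros e h. unfold rest in h. apply in_app_or in h. destruct h as [h|h]; [|apply W0; exact h].
      apply in_flat_map in h. destruct h as [q' [Hq' h]].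
      destruct (HD' q' Hq') as [k1 [k2 _]].
      simpl in h. destruct h as [e1|[e1|[e1|[]]]]; subst e; simpl; split; auto; apply k2; lia. }
    assert (X0 : forall pi', good pi' -> exists d L, cut_rep eps vs pi' rest d L /\ forall v, thr v <= d v).
    { intros pi' [G1 [G2 G3]]. destruct (IH pi' G1 G2) as [d [L [H [T1 T2]]]].
      exists d, L. split; [exact H|]. intros v. unfold thr.
      destruct (excluded_middle_informative (In v D)); [auto|].
      destruct (excluded_middle_informative (P v)) as [p|p]; [|apply H].
      apply T2; [apply p|apply G3; exact p|apply Hrest; apply p]. }
    assert (Hne : forall i, (i < 3)%nat -> nb q i <> q) by (intros i h; apply Hnb; exact h).
    assert (Gm : forall pi' i, (i < 3)%nat -> good pi' ->
       pi' (Some q) <> pi' (Some (nb q i)) -> good (merge dec pi' (Some q) (Some (nb q i)))).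
    { intros pi' i hi [G1 [G2 G3]] hn. split; [apply merge_None; assumption|split].
      - intros q' Hq'. apply isolated_merge; auto; simpl; auto.
        + apply Hnb; exact hi.
        + intros h; inversion h; subst; contradiction.
        + intros h; inversion h; subst. apply (proj1 (proj2 (Hnb i hi))). right; assumption.
      - intros v p. assert (hu : untouched (star nb q ++ rest) v) by apply p.
        apply isolated_merge; auto; simpl; auto.
        + apply Hnb; exact hi.
        + apply (hu (Some q, Some (nb q 1%nat))). simpl; auto.
        + destruct i as [|[|[|i]]].
          * apply (hu (Some q, Some (nb q 0%nat))). simpl; auto.
          * apply (hu (Some q, Some (nb q 1%nat))). simpl; auto.
          * apply (hu (Some q, Some (nb q 2%nat))). simpl; auto.
          * lia. }
    assert (R2 : forall pi' es' i, (i < 3)%nat -> forall u : option V -> R, u None = 0 ->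
       2 * (u (pi' (Some q)) - u (pi' (Some (nb q i)))) -
         net_energy eps vs es' (fun x => u (pi' x)) <= 2 / eps).
    { intros pi' es' i hi u Hu.
      assert (h := net_energy_two dec eps vs es' (fun x => u (pi' x)) q (nb q i) (proj1 He) N Hqv
         (proj1 (Hnb i hi)) (not_eq_sym (Hne i hi))). cbv beta in h.
      set (x := u (pi' (Some q))) in *. set (y := u (pi' (Some (nb q i)))) in *.
      assert (K : forall z, 2 * z <= / eps + eps * z ^ 2).
      { intros z. assert (k : 0 <= (eps * z - 1) ^ 2 * / eps) by (apply Rmult_le_pos; [apply pow2_ge_0|lra]).
        replace ((eps * z - 1) ^ 2 * / eps) with (eps * z ^ 2 - 2 * z + / eps) in k by (field; lra). lra. }
      assert (K1 := K x). assert (K2 := K (- y)). replace ((- y) ^ 2) with (y ^ 2) in K2 by ring.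
      unfold Rdiv. lra. }
    assert (Pos2 : 0 <= 2 / eps) by (unfold Rdiv; lra).
    assert (STEP : forall i es', (i < 3)%nat ->
       (forall pi', good pi' -> exists d L, cut_rep eps vs pi' es' d L /\ forall v, thr v <= d v) ->
       forall pi', good pi' ->
         exists d L, cut_rep eps vs pi' ((Some q, Some (nb q i)) :: es') d L /\ forall v, thr v <= d v).
    { intros i es' hi X pi' G.
      destruct (cut_rep_cons dec eps vs pi' (Some q) (Some (nb q i)) es' thr q 0 (2 / eps)) as [d [L [H T]]]; auto.
      - simpl; apply Hnb; exact hi.
      - apply G.
      - lra.
      - destruct (X pi' G) as [d [L [H T]]]. exists d, L. split; [exact H|].
        intros v. specialize (T v). destruct (dec q v); lra.
      - exists d, L. split; [exact H|]. intros v. specialize (T v).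
        replace (0 / (1 + 2 / eps)) with 0 in T by (unfold Rdiv; ring).
        destruct (dec q v); lra. }
    assert (G : good pi).
    { split; [exact Hpi|split].
      - intros q' h; apply Hiso; right; exact h.
      - intros v h; apply h. }
    (* No edge of [rest] meets [q], which is therefore an isolated vertex of weight [/ eps] before
       its star is added. *)
    assert (Y0 : exists d L, cut_rep eps vs pi rest d L /\
               forall v, thr v + (if dec q v then / eps else 0) <= d v).
    { destruct (IH pi Hpi (fun q' h => Hiso q' (or_intror h))) as [d [L [H [T1 T2]]]].
      exists d, L. split; [exact H|]. intros v.
      assert (Hthr : thr v <= d v).
      { unfold thr. destruct (excluded_middle_informative (In v D)); [auto|].
        destruct (excluded_middle_informative (P v)) as [p|p]; [|apply H].
        apply T2; [apply p|apply p|apply Hrest; apply p]. }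
      destruct (dec q v) as [e|n]; [|lra]. subst v.
      assert (E : thr q = 0).
      { unfold thr. destruct (excluded_middle_informative (In q D)); [contradiction|].
        destruct (excluded_middle_informative (P q)) as [p|p]; [|reflexivity].
        exfalso. assert (hu : untouched (star nb q ++ rest) q) by apply p.
        destruct (hu (Some q, Some (nb q 1%nat))) as [k _]; [simpl; auto|]. apply k; reflexivity. }
      rewrite E, Rplus_0_l. apply T2; [exact Hqv|apply Hiso; left; reflexivity|].
      apply untouched_flat_star; auto.
      intros q' Hq' i hi h. destruct (HD q' (or_intror Hq')) as [_ [k _]].
      apply (proj1 (proj2 (k i hi))). left; symmetry; exact h. }
    assert (weak : forall es' t t', t' <= t ->
       (exists d L, cut_rep eps vs pi es' d L /\ forall v, thr v + (if dec q v then t else 0) <= d v) ->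
       (exists d L, cut_rep eps vs pi es' d L /\ forall v, thr v + (if dec q v then t' else 0) <= d v)).
    { intros es' t t' h [d [L [H T]]]. exists d, L. split; [exact H|].
      intros v; specialize (T v). destruct (dec q v); lra. }
    (* For the first edge only the leak to the ground bounds the resistance, by [2 / eps]. The
       remaining weight is [/ eps / (1 + 2 / eps) = / (eps + 2)], which is at least [/ 3]. *)
    assert (Y1 : exists d L, cut_rep eps vs pi ((Some q, Some (nb q 0%nat)) :: rest) d L /\
               forall v, thr v + (if dec q v then / 3 else 0) <= d v).
    { apply (weak _ (/ eps / (1 + 2 / eps))).
      - replace (/ eps / (1 + 2 / eps)) with (/ (eps + 2)).
        + apply Rinv_le_contravar; lra.
        + field. split; [lra|]. lra.
      - apply cut_rep_cons; auto; try lra.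
        + simpl; apply Hnb; lia.
        + intros hn. apply X0, Gm; auto. }
    (* Resistance 5: the first star edge in series with the connection of resistance 4 between
       neighbours. *)
    assert (Hcs : forall (pi' : option V -> option V) es' i, (i < 3)%nat -> forall u : option V -> R,
       sumR (fun e => (u (pi' (fst e)) - u (pi' (snd e))) ^ 2) ((Some q, Some (nb q 0%nat)) :: rest) <=
       sumR (fun e => (u (pi' (fst e)) - u (pi' (snd e))) ^ 2) es' ->
       2 * (u (pi' (Some q)) - u (pi' (Some (nb q i)))) -
         net_energy eps vs es' (fun x => u (pi' x)) <= 5).
    { intros pi' es' i hi u hs.
      apply (net_energy_le_inv eps vs es' (fun x => u (pi' x)) 5 ltac:(lra) (proj1 He) (Some q) (Some (nb q i))).
      cbv beta. eapply Rle_trans; [|apply Rmult_le_compat_l; [lra|exact hs]].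
      simpl. assert (p := Hpath (fun x => u (pi' x)) i hi). cbv beta in p.
      unfold rest. rewrite sumR_app.
      assert (0 <= sumR (fun e => (u (pi' (fst e)) - u (pi' (snd e))) ^ 2) (flat_map (star nb) D))
        by (apply sumR_nonneg; intros; apply pow2_ge_0).
      set (S0 := sumR _ E0) in *. set (S1 := sumR _ (flat_map _ _)) in *.
      set (x := u (pi' (Some q))) in *. set (y := u (pi' (Some (nb q i)))) in *.
      set (z := u (pi' (Some (nb q 0%nat)))) in *.
      assert (h : 0 <= (2 * (x - z) - (z - y) / 2) ^ 2) by apply pow2_ge_0. nra. }
    assert (Y2 : exists d L, cut_rep eps vs pi ((Some q, Some (nb q 2%nat)) :: (Some q, Some (nb q 0%nat)) :: rest) d L /\
               forall v, thr v + (if dec q v then / 18 else 0) <= d v).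
    { apply (weak _ (/ 3 / (1 + 5))); [lra|].
      apply cut_rep_cons; auto; try lra.
      - simpl; apply Hnb; lia.
      - intros _ u Hu. apply (Hcs pi _ 2%nat); [lia|]. lra.
    }
    (* Each of the last two edges costs a factor [/ (1 + 5)], and [/ 3 * / 6 * / 6 = / 108]. *)
    assert (Y3 : exists d L, cut_rep eps vs pi (star nb q ++ rest) d L /\
               forall v, thr v + (if dec q v then / 108 else 0) <= d v).
    { apply (weak _ (/ 18 / (1 + 5))); [lra|].
      apply cut_rep_cons; auto; try lra.
      - simpl; apply Hnb; lia.
      - intros _ u Hu. apply (Hcs pi _ 1%nat); [lia|].
        simpl. assert (h := pow2_ge_0 (u (pi (Some q)) - u (pi (Some (nb q 2%nat))))). simpl in h. lra.
      - intros hn. apply STEP; [lia| |apply Gm; auto].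
        intros pi' G'. apply STEP; auto. }
    destruct Y3 as [d [L [H T]]]. exists d, L. split; [exact H|split].
    + intros q' [e|h].
      * subst q'. specialize (T q). destruct (dec q q); [|congruence].
        assert (0 <= thr q); [|lra]. unfold thr.
        destruct (excluded_middle_informative _); [lra|]. destruct (excluded_middle_informative _); lra.
      * specialize (T q'). unfold thr in T. destruct (excluded_middle_informative (In q' D)); [|contradiction].
        destruct (dec q q'); lra.
    + intros v Hv hi hu. specialize (T v). unfold thr in T.
      destruct (excluded_middle_informative (In v D)) as [h|h].
      * exfalso. assert (k : untouched rest v) by (apply Hrest; exact hu).
        destruct (k (Some v, Some (nb v 1%nat))) as [k' _]; [|apply k'; reflexivity].
        unfold rest. apply in_or_app; left. apply in_flat_map. exists v. split; [exact h|simpl; auto].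
      * destruct (excluded_middle_informative (P v)) as [p|p]; [|exfalso; apply p; split; auto].
        destruct (dec q v); lra.
Qed.

(** The charge [x] of every set is an integer, so [x^2 >= x]. A unit charge gives each set charge 0
    or 1, so the linear terms add up to the sum of [s i] times the values on unit charges. On [D]
    the diagonal retains the surplus [s q * (s q - 1)], which is 2 for charge -1. *)
Lemma cut_form_integral_gap {V : Type} (dec : forall x y : V, {x = y} + {x <> y}) (vs : list V)
    d L (s : V -> R) (D : list V) c :
  NoDup vs -> NoDup D -> incl D vs -> 0 <= c ->
  (forall v, 0 <= d v) -> (forall x, In x L -> 0 <= fst x) ->
  (forall v, exists k : Z, s v = IZR k) -> (forall q, In q D -> c <= d q) ->
  sumR (fun i => s i * cut_form vs d L (unit_charge dec (Some i)) (unit_charge dec (Some i))) vs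
    + c * sumR (fun q => s q * (s q - 1)) D <= cut_form vs d L s s.
Proof.
  intros N ND Hincl Hc Hd HL Hs HD.
  assert (Hint : forall x, (exists k : Z, x = IZR k) -> 0 <= x * (x - 1)).
  { intros x [k ->]. rewrite <- minus_IZR, <- mult_IZR. apply IZR_le. nia. }
  assert (Hch : forall A, exists k : Z, charge vs A s = IZR k).
  { intros A. unfold charge. clear N Hincl. induction vs as [|v l IHl]; simpl.
    - exists 0%Z; reflexivity.
    - destruct IHl as [k ->]. destruct (Hs v) as [k' ->].
      destruct (A v); [exists (k' + k)%Z; rewrite plus_IZR; ring|exists k; ring]. }
  assert (Hu : forall A i, In i vs -> charge vs A (unit_charge dec (Some i)) = if A i then 1 else 0).
  { intros A i Hi. unfold charge, unit_charge.
    rewrite (sumR_ext _ (fun v => if dec i v then (if A v then 1 else 0) else 0)).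
    - rewrite (sumR_delta dec i (fun v => if A v then 1 else 0)); auto.
    - intros v _. destruct (A v), (dec i v); reflexivity. }
  assert (E : sumR (fun i => s i * cut_form vs d L (unit_charge dec (Some i)) (unit_charge dec (Some i))) vs
     = sumR (fun v => d v * s v) vs + sumR (fun x => fst x * charge vs (snd x) s) L).
  { rewrite (sumR_ext (A:=V) _ (fun i => d i * s i + sumR (fun x : R * (V -> bool) => fst x * (if snd x i then s i else 0)) L)).
    - rewrite sumR_plus. f_equal. rewrite sumR_exchange. apply sumR_ext. intros x _.
      rewrite sumR_scal. reflexivity.
    - intros i Hi. unfold cut_form. rewrite Rmult_plus_distr_l. f_equal.
      + rewrite (sumR_ext _ (fun v => if dec i v then d v else 0)).
        * rewrite (sumR_delta dec i d) by auto. ring.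
        * intros v _. unfold unit_charge. destruct (dec i v); ring.
      + rewrite <- sumR_scal. apply sumR_ext. intros x _. rewrite Hu by exact Hi.
        destruct (snd x i); ring. }
  rewrite E. unfold cut_form.
  assert (H1 : c * sumR (fun q => s q * (s q - 1)) D <= sumR (fun v => d v * (s v * (s v - 1))) vs).
  { rewrite <- sumR_scal.
    apply Rle_trans with (sumR (fun v => d v * (s v * (s v - 1))) D).
    - apply sumR_le. intros q Hq. apply Rmult_le_compat_r; [apply Hint, Hs|auto].
    - apply sumR_incl; auto. intros v _. apply Rmult_le_pos; [apply Hd|apply Hint, Hs]. }
  assert (H2 : sumR (fun x => fst x * charge vs (snd x) s) L <=
               sumR (fun x => fst x * (charge vs (snd x) s * charge vs (snd x) s)) L).
  { apply sumR_le. intros x Hx. apply Rmult_le_compat_l; [apply HL; exact Hx|].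
    assert (h := Hint _ (Hch (snd x))). lra. }
  rewrite (sumR_ext _ (fun v => d v * (s v * s v) - d v * s v) vs) in H1 by (intros; ring).
  rewrite sumR_minus in H1. lra.
Qed.

(** * Flows on the honeycomb of cells *)

(* Bond [(p, j)] separates the up cell of [p] from the down cell of [p - fv j]; it is the
   side [p + a1 -> p + a2], [p + a2 -> p], [p -> p + a1] of the up cell for [j = 0, 1, 2].
   A 1-form read on these oriented sides is a flow from up cells to down cells, and its
   circulation around a cell is the outflow of the cell. *)
Definition fv (j : nat) : pt :=
  match j with 0%nat => (0, 0)%Z | 1%nat => (1, 0)%Z | _ => (0, 1)%Z end.
Definition padd (p q : pt) : pt := (fst p + fst q, snd p + snd q)%Z.
Definition psub (p q : pt) : pt := (fst p - fst q, snd p - snd q)%Z.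
Definition flow := pt -> nat -> R.
Definition sum3 (f : nat -> R) : R := f 0%nat + f 1%nat + f 2%nat.

Definition divf (a : flow) (c : cell) : R :=
  if snd c then sum3 (a (fst c)) else - sum3 (fun j => a (padd (fst c) (fv j)) j).
Definition grad (u : cell -> R) : flow := fun p j => u (p, true) - u (psub p (fv j), false).

Definition zrange (n : nat) : list Z :=
  map (fun k => (Z.of_nat k - Z.of_nat n)%Z) (seq 0 (2 * n + 1)).
Definition bx (n : nat) : list pt := list_prod (zrange n) (zrange n).
Definition bonds (n : nat) : list (pt * nat) := list_prod (bx n) [0%nat; 1%nat; 2%nat].
Definition cells (n : nat) : list cell := list_prod (bx n) [true; false].
Definition bsum (n : nat) (f : flow) : R := sumR (fun b => f (fst b) (snd b)) (bonds n).

Arguments bx : simpl never.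
Arguments bonds : simpl never.
Arguments cells : simpl never.

Ltac pt_eq := unfold padd, psub in *; simpl in *;
  repeat match goal with p : pt |- _ => destruct p end; simpl in *; f_equal; try lia.

Lemma In_zrange (n : nat) (z : Z) : In z (zrange n) <-> (Z.abs z <= Z.of_nat n)%Z.
Proof.
  unfold zrange. rewrite in_map_iff. split.
  - intros [k [e Hk]]. apply in_seq in Hk. lia.
  - intros H. exists (Z.to_nat (z + Z.of_nat n)). split; [lia|]. apply in_seq. lia.
Qed.

Lemma In_bx (n : nat) (p : pt) :
  In p (bx n) <-> (Z.abs (fst p) <= Z.of_nat n /\ Z.abs (snd p) <= Z.of_nat n)%Z.
Proof.
  destruct p as [i j]. unfold bx. etransitivity; [apply in_prod_iff|]. rewrite !In_zrange. reflexivity.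
Qed.

Lemma In_bonds n b : In b (bonds n) <-> In (fst b) (bx n) /\ (snd b < 3)%nat.
Proof.
  destruct b as [p j]. unfold bonds. etransitivity; [apply in_prod_iff|]. simpl. intuition lia.
Qed.

Lemma In_cells n c : In c (cells n) <-> In (fst c) (bx n).
Proof.
  destruct c as [p b]. unfold cells. etransitivity; [apply in_prod_iff|]. simpl. destruct b; tauto.
Qed.

Lemma NoDup_list_prod {A B : Type} (l : list A) (l' : list B) :
  NoDup l -> NoDup l' -> NoDup (list_prod l l').
Proof.
  intros H H'. induction H as [|a l Ha Hl IH]; simpl; [constructor|].
  apply NoDup_app; [|exact IH|].
  - apply NoDup_map_inj; [|exact H']. intros x y _ _ e; congruence.
  - intros x Hx Hx'. apply in_map_iff in Hx. destruct Hx as [y [e _]]. subst x.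
    apply in_prod_iff in Hx'. tauto.
Qed.

Lemma NoDup_bx n : NoDup (bx n).
Proof.
  assert (NoDup (zrange n)).
  { apply NoDup_map_inj; [intros; lia|apply seq_NoDup]. }
  apply NoDup_list_prod; assumption.
Qed.

Lemma NoDup_bonds n : NoDup (bonds n).
Proof.
  apply NoDup_list_prod; [apply NoDup_bx|]. repeat constructor; simpl; intuition discriminate.
Qed.

Lemma NoDup_cells n : NoDup (cells n).
Proof.
  apply NoDup_list_prod; [apply NoDup_bx|]. repeat constructor; simpl; intuition discriminate.
Qed.

Lemma sumR_list_prod {A B : Type} (f : A * B -> R) (l : list A) (l' : list B) :
  sumR f (list_prod l l') = sumR (fun a => sumR (fun b => f (a, b)) l') l.
Proof.
  induction l as [|a l IH]; simpl; [reflexivity|]. rewrite sumR_app, sumR_map, IH. reflexivity.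
Qed.

Lemma bsum_unfold n f : bsum n f = sumR (fun p => sum3 (f p)) (bx n).
Proof.
  unfold bsum, bonds. rewrite sumR_list_prod. apply sumR_ext. intros p _. simpl. unfold sum3. ring.
Qed.

Lemma sumR_cells n f : sumR f (cells n) = sumR (fun p => f (p, true) + f (p, false)) (bx n).
Proof.
  unfold cells. etransitivity; [apply (sumR_list_prod f)|]. apply sumR_ext. intros p _. simpl. ring.
Qed.

Lemma bx_mono n m : (n <= m)%nat -> incl (bx n) (bx m).
Proof. intros H p. rewrite !In_bx. lia. Qed.

Lemma bx_fv n p j : In p (bx n) -> In (padd p (fv j)) (bx (S n)) /\ In (psub p (fv j)) (bx (S n)).
Proof.
  rewrite !In_bx. destruct p as [x y]. unfold padd, psub. destruct j as [|[|j]]; simpl fst; simpl snd; lia.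
Qed.

Lemma padd_psub p q : padd (psub p q) q = p.
Proof. pt_eq. Qed.
Lemma psub_padd p q : psub (padd p q) q = p.
Proof. pt_eq. Qed.

Definition csupp (n : nat) (u : cell -> R) : Prop := forall c, ~ In (fst c) (bx n) -> u c = 0.

(** [grad] is adjoint to [divf]; the larger box contains every bond that meets a cell in the support
    of [u]. *)
Lemma sum_by_parts n m a u : csupp n u -> (n < m)%nat ->
  bsum m (fun p j => a p j * grad u p j) = sumR (fun c => u c * divf a c) (cells m).
Proof.
  intros Hu Hm. rewrite bsum_unfold, sumR_cells.
  assert (E : forall j, sumR (fun p => a p j * u (psub p (fv j), false)) (bx m) =
     sumR (fun p => a (padd p (fv j)) j * u (p, false)) (bx m)).
  { intros j. apply (sumR_reindex (fun p => psub p (fv j))); try apply NoDup_bx.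
    - intros x y e. rewrite <- (padd_psub x (fv j)), e. apply padd_psub.
    - intros x _. rewrite padd_psub. reflexivity.
    - intros x _ h. apply NNPP. intros k. apply h. rewrite Hu; [ring|].
      simpl. intros k'. apply k. apply (bx_mono n m); [lia|exact k'].
    - intros y _ h. exists (padd y (fv j)). split; [|apply psub_padd].
      apply NNPP. intros k. apply h. rewrite (Hu (y, false)); [ring|].
      simpl. intros k'. apply k. apply (bx_mono (S n) m); [lia|]. apply bx_fv; exact k'. }
  rewrite (sumR_ext _ (fun p => u (p, true) * divf a (p, true)
     - (a p 0%nat * u (psub p (fv 0), false) + a p 1%nat * u (psub p (fv 1), false)
        + a p 2%nat * u (psub p (fv 2), false))))
    by (intros p _; unfold grad, divf, sum3; simpl; ring).
  rewrite sumR_minus, !sumR_plus, !E, <- !sumR_plus, <- sumR_minus.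
  apply sumR_ext. intros p _. unfold divf, sum3. simpl. ring.
Qed.

(** Cells outside box [n] are grounded, as trial potentials vanish there. Bonds are taken in box
    [n + 1], since the down cells of box [n] have sides based there. *)
Definition box_dual (n : nat) (eps : R) (s u : cell -> R) : R :=
  2 * sumR (fun c => s c * u c) (cells n) - eps * sumR (fun c => u c ^ 2) (cells n)
  - bsum (S n) (fun p j => grad u p j ^ 2).

Definition box_max (n : nat) (eps : R) (s : cell -> R) (q : R) : Prop :=
  (forall u, csupp n u -> box_dual n eps s u <= q) /\ exists u, csupp n u /\ box_dual n eps s u = q.

(** Thomson's principle: the square of [a - grad u], for the maximiser [u], is expanded and the
    mixed term summed by parts. *)
Lemma box_max_le_energy n eps s q a : 0 <= eps -> box_max n eps s q ->
  (forall c, In c (cells n) -> divf a c = s c) ->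
  q <= bsum (S n) (fun p j => a p j ^ 2).
Proof.
  intros He [_ [u [Hu e]]] Ha. rewrite <- e. unfold box_dual.
  assert (0 <= sumR (fun c => u c ^ 2) (cells n)) by (apply sumR_nonneg; intros; apply pow2_ge_0).
  assert (E : sumR (fun c => s c * u c) (cells n) = bsum (S n) (fun p j => a p j * grad u p j)).
  { rewrite (sum_by_parts n (S n)) by (auto; lia).
    rewrite (sumR_ext _ (fun c => u c * divf a c)) by (intros c Hc; rewrite Ha by exact Hc; ring).
    apply sumR_support; try apply NoDup_cells. intros c Hc. rewrite !In_cells. split.
    - apply bx_mono; lia.
    - intros _. apply NNPP. intros k. apply Hc. rewrite Hu by exact k. ring. }
  rewrite E. unfold bsum.
  assert (0 <= sumR (fun b => (a (fst b) (snd b) - grad u (fst b) (snd b)) ^ 2) (bonds (S n)))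
    by (apply sumR_nonneg; intros; apply pow2_ge_0).
  rewrite (sumR_ext _ (fun b => a (fst b) (snd b) ^ 2 - 2 * (a (fst b) (snd b) * grad u (fst b) (snd b))
     + grad u (fst b) (snd b) ^ 2)) in H0 by (intros; ring).
  rewrite sumR_plus, sumR_minus, sumR_scal in H0. nra.
Qed.

(** * The box of cells as a resistor network with stars *)

Lemma pt_dec (p q : pt) : {p = q} + {p <> q}.
Proof. decide equality; apply Z.eq_dec. Defined.
Lemma cell_dec (c c' : cell) : {c = c'} + {c <> c'}.
Proof. decide equality; [apply Bool.bool_dec|apply pt_dec]. Defined.

Definition delta (c c' : cell) : R := if cell_dec c c' then 1 else 0.

Definition node (n : nat) (c : cell) : option cell :=
  if in_dec pt_dec (fst c) (bx n) then Some c else None.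
Definition edge (n : nat) (b : pt * nat) : option cell * option cell :=
  (node n (fst b, true), node n (psub (fst b) (fv (snd b)), false)).
Definition touched (D : list cell) (b : pt * nat) : bool :=
  if in_dec cell_dec (fst b, true) D then true
  else if in_dec cell_dec (psub (fst b) (fv (snd b)), false) D then true else false.
Definition nbr (c : cell) (i : nat) : cell :=
  if snd c then (psub (fst c) (fv i), false) else (padd (fst c) (fv i), true).
Definition side (c : cell) (i : nat) : pt * nat :=
  ((if snd c then fst c else padd (fst c) (fv i)), i).

Lemma node_Some n c : In (fst c) (bx n) -> node n c = Some c.
Proof. intros H. unfold node. destruct (in_dec pt_dec (fst c) (bx n)); [reflexivity|contradiction]. Qed.

Lemma node_None n c : ~ In (fst c) (bx n) -> node n c = None.
Proof. intros H. unfold node. destruct (in_dec pt_dec (fst c) (bx n)); [contradiction|reflexivity]. Qed.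

Lemma node_in_cells n c : node_in (cells n) (node n c).
Proof.
  unfold node. destruct (in_dec pt_dec (fst c) (bx n)); simpl; [|exact I].
  rewrite In_cells. assumption.
Qed.

(* A class of cells of one orientation and one parity: no two of its members are
   consecutive cells of that orientation around a lattice point. *)
Definition spread (n : nat) (b e1 e2 : bool) (D : list cell) : Prop :=
  NoDup D /\ forall q, In q D -> snd q = b /\ Z.even (fst (fst q)) = e1 /\
    Z.even (snd (fst q)) = e2 /\ In (fst q) (bx n).

(** Cells of the same orientation never share a side, so the stars of the members of [D] are
    disjoint. *)
Lemma touched_star_sum n b e1 e2 D (g : pt * nat -> R) :
  spread n b e1 e2 D ->
  sumR (fun x => if touched D x then g x else 0) (bonds (S n)) =
  sumR (fun q => g (side q 1%nat) + g (side q 2%nat) + g (side q 0%nat)) D.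
Proof.
  intros [ND HD].
  transitivity (bsum (S n) (fun p j => if touched D (p, j) then g (p, j) else 0)).
  { apply sumR_ext. intros [p j] _. reflexivity. }
  rewrite bsum_unfold. unfold sum3.
  rewrite (sumR_ext _ (fun p => (if touched D (p, 1%nat) then g (p, 1%nat) else 0)
     + (if touched D (p, 2%nat) then g (p, 2%nat) else 0)
     + (if touched D (p, 0%nat) then g (p, 0%nat) else 0))) by (intros; ring).
  rewrite !sumR_plus.
  assert (E : forall j, (j < 3)%nat ->
    sumR (fun q => g (side q j)) D =
    sumR (fun p => if touched D (p, j) then g (p, j) else 0) (bx (S n))).
  { intros j _.
    rewrite (sumR_ext (fun q => g (side q j)) (fun q => g (side (fst q, b) j)))
      by (intros [p b'] hq; destruct (HD _ hq) as [h _]; simpl in h; subst b'; reflexivity).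
    transitivity (sumR (fun p => g (side (p, b) j)) (map fst D));
      [symmetry; apply (sumR_map (fun p => g (side (p, b) j)) fst)|].
    apply (sumR_reindex (fun p => if b then p else padd p (fv j))).
    - apply NoDup_map_inj; [|exact ND]. intros [p bp] [p' bp'] h h' e. simpl in e. subst p'.
      destruct (HD _ h) as [k _], (HD _ h') as [k' _]. simpl in k, k'. congruence.
    - apply NoDup_bx.
    - intros x y e. destruct b; [exact e|]. rewrite <- (psub_padd x (fv j)), e. apply psub_padd.
    - intros p hp. apply in_map_iff in hp. destruct hp as [[p' bp] [e hq]]. simpl in e. subst p'.
      destruct (HD _ hq) as [k _]. simpl in k. subst bp.
      unfold touched, side. simpl. destruct b; simpl.
      + destruct (in_dec cell_dec (p, true) D); [reflexivity|contradiction].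
      + rewrite psub_padd. destruct (in_dec cell_dec (padd p (fv j), true) D); [reflexivity|].
        destruct (in_dec cell_dec (p, false) D); [reflexivity|contradiction].
    - intros p hp _. apply in_map_iff in hp. destruct hp as [q [e hq]]. subst p.
      destruct (HD _ hq) as [_ [_ [_ k]]]. destruct b; [apply (bx_mono n); auto|apply bx_fv; exact k].
    - intros p _ h. unfold touched in h. simpl in h.
      destruct (in_dec cell_dec (p, true) D) as [i|i].
      + exists p. destruct (HD _ i) as [k _]. simpl in k. subst b. split; [|reflexivity].
        apply in_map_iff. exists (p, true). auto.
      + destruct (in_dec cell_dec (psub p (fv j), false) D) as [i'|i']; [|congruence].
        destruct (HD _ i') as [k _]. simpl in k. subst b.
        exists (psub p (fv j)). split; [|apply padd_psub].
        apply in_map_iff. exists (psub p (fv j), false). auto. }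
  rewrite (E 1%nat), (E 2%nat), (E 0%nat) by lia. reflexivity.
Qed.

Lemma four_squares (a b c d e : R) :
  (a - e) ^ 2 <= 4 * ((a - b) ^ 2 + (b - c) ^ 2 + (c - d) ^ 2 + (d - e) ^ 2).
Proof.
  set (x := a - b). set (y := b - c). set (z := c - d). set (t := d - e).
  replace (a - e) with (x + y + z + t) by (unfold x, y, z, t; ring).
  assert (0 <= (x - y) ^ 2) by apply pow2_ge_0. assert (0 <= (x - z) ^ 2) by apply pow2_ge_0.
  assert (0 <= (x - t) ^ 2) by apply pow2_ge_0. assert (0 <= (y - z) ^ 2) by apply pow2_ge_0.
  assert (0 <= (y - t) ^ 2) by apply pow2_ge_0. assert (0 <= (z - t) ^ 2) by apply pow2_ge_0.
  nra.
Qed.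

Definition rest_edges (n : nat) (D : list cell) : list (option cell * option cell) :=
  map (edge n) (filter (fun x => negb (touched D x)) (bonds (S n))).

Lemma rest_edges_ge n D (u : option cell -> R) (l : list (pt * nat)) :
  NoDup l -> (forall b, In b l -> In b (bonds (S n)) /\ touched D b = false) ->
  sumR (fun b => (u (fst (edge n b)) - u (snd (edge n b))) ^ 2) l <=
  sumR (fun e => (u (fst e) - u (snd e)) ^ 2) (rest_edges n D).
Proof.
  intros N H. unfold rest_edges. rewrite sumR_map. apply sumR_incl.
  - exact N.
  - apply NoDup_filter, NoDup_bonds.
  - intros b hb. apply filter_In. destruct (H b hb) as [h1 h2]. rewrite h2. auto.
  - intros; apply pow2_ge_0.
Qed.

Ltac nodup4 := repeat (apply NoDup_cons;
  [simpl; intros h; repeat (destruct h as [h|h]; [first [discriminate h | injection h; intros; lia]|]); exact h|]);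
  apply NoDup_nil.
Ltac pair_eq := unfold nbr, psub, padd; simpl;
  repeat first [reflexivity | lia | apply (f_equal2 pair) | apply (f_equal Some)].

(* The other five sides of a hexagon through a cell link its neighbours. *)
Lemma hexagon_path n m b e1 e2 D q (u : option cell -> R) i :
  spread m b e1 e2 D -> (m + 3 <= n)%nat -> In q D -> (i < 3)%nat ->
  (u (Some (nbr q i)) - u (Some (nbr q 0%nat))) ^ 2 <=
  4 * sumR (fun e => (u (fst e) - u (snd e)) ^ 2) (rest_edges n D).
Proof.
  intros [ND HD] Hm Hq Hi.
  destruct q as [[x y] bq]. destruct (HD _ Hq) as [hb [h1 [h2 hin]]]. simpl in hb, h1, h2, hin. subst bq.
  assert (Hbx : (Z.abs x <= Z.of_nat m /\ Z.abs y <= Z.of_nat m)%Z) by (apply (proj1 (In_bx m (x, y))); exact hin).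
  assert (Hp : forall b' x' y', In ((x', y'), b') D -> b' = b /\ Z.even x' = e1 /\ Z.even y' = e2).
  { intros b' x' y' h. destruct (HD _ h) as [k1 [k2 [k3 _]]]. simpl in *. auto. }
  assert (Hodd : forall z, Z.even (z + 1) <> Z.even z).
  { intros z h. rewrite Z.even_add in h. destruct (Z.even z); discriminate. }
  assert (Hodd' : forall z, Z.even (z - 1) <> Z.even z).
  { intros z h. rewrite Z.even_sub in h. destruct (Z.even z); discriminate. }
  (* The four bonds of the path join cells of both orientations. Those oriented like [q] differ from
     it by 1 in a coordinate, hence in parity, and the others have the wrong orientation, so the
     path avoids all stars of [D]. *)
  assert (NT : forall x' y' j, (b = true -> Z.even x' <> e1 \/ Z.even y' <> e2) ->
     (b = false -> Z.even (x' - fst (fv j)) <> e1 \/ Z.even (y' - snd (fv j)) <> e2) ->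
     touched D ((x', y'), j) = false).
  { intros x' y' j k1 k2. unfold touched. simpl.
    match goal with |- context [in_dec cell_dec ?a D] => destruct (in_dec cell_dec a D) as [w|w] end.
    - exfalso. destruct (Hp _ _ _ w) as [w1 [w2 w3]]. destruct (k1 (eq_sym w1)); contradiction.
    - match goal with |- context [in_dec cell_dec ?a D] => destruct (in_dec cell_dec a D) as [w'|w'] end; [|reflexivity].
      exfalso. destruct (Hp _ _ _ w') as [w1 [w2 w3]]. destruct (k2 (eq_sym w1)); contradiction. }
  assert (PATH : forall b1 b2 b3 b4 : pt * nat, forall a0 a1 a2 a3 a4 : option cell,
     NoDup [b1; b2; b3; b4] ->
     (forall b', In b' [b1; b2; b3; b4] -> In b' (bonds (S n)) /\ touched D b' = false) ->
     (edge n b1 = (a0, a1) \/ edge n b1 = (a1, a0)) -> (edge n b2 = (a1, a2) \/ edge n b2 = (a2, a1)) ->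
     (edge n b3 = (a2, a3) \/ edge n b3 = (a3, a2)) -> (edge n b4 = (a3, a4) \/ edge n b4 = (a4, a3)) ->
     (u a4 - u a0) ^ 2 <= 4 * sumR (fun e => (u (fst e) - u (snd e)) ^ 2) (rest_edges n D)).
  { intros b1 b2 b3 b4 a0 a1 a2 a3 a4 nd hb k1 k2 k3 k4.
    assert (h := rest_edges_ge n D u _ nd hb). cbn [sumR] in h.
    assert (f := four_squares (u a0) (u a1) (u a2) (u a3) (u a4)).
    assert (E1 : (u (fst (edge n b1)) - u (snd (edge n b1))) ^ 2 = (u a0 - u a1) ^ 2)
      by (destruct k1 as [k|k]; rewrite k; simpl; ring).
    assert (E2 : (u (fst (edge n b2)) - u (snd (edge n b2))) ^ 2 = (u a1 - u a2) ^ 2)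
      by (destruct k2 as [k|k]; rewrite k; simpl; ring).
    assert (E3 : (u (fst (edge n b3)) - u (snd (edge n b3))) ^ 2 = (u a2 - u a3) ^ 2)
      by (destruct k3 as [k|k]; rewrite k; simpl; ring).
    assert (E4 : (u (fst (edge n b4)) - u (snd (edge n b4))) ^ 2 = (u a3 - u a4) ^ 2)
      by (destruct k4 as [k|k]; rewrite k; simpl; ring).
    rewrite E1, E2, E3, E4 in h.
    replace ((u a4 - u a0) ^ 2) with ((u a0 - u a4) ^ 2) by ring. lra. }
  assert (ED : forall x' y' j, (Z.abs x' <= Z.of_nat m + 1)%Z -> (Z.abs y' <= Z.of_nat m + 1)%Z ->
     edge n ((x', y'), j) = (Some ((x', y'), true), Some (psub (x', y') (fv j), false))).
  { intros x' y' j k1 k2. unfold edge. simpl fst. simpl snd.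
    rewrite !node_Some; [reflexivity| |]; rewrite In_bx; simpl fst; simpl snd;
      destruct j as [|[|j]]; simpl fst; simpl snd; lia. }
  assert (IB : forall x' y' j, (Z.abs x' <= Z.of_nat m + 1)%Z -> (Z.abs y' <= Z.of_nat m + 1)%Z -> (j < 3)%nat ->
     In ((x', y'), j) (bonds (S n))).
  { intros x' y' j k1 k2 k3. rewrite In_bonds, In_bx. simpl fst; simpl snd. lia. }
  assert (NN : 0 <= sumR (fun e => (u (fst e) - u (snd e)) ^ 2) (rest_edges n D))
    by (apply sumR_nonneg; intros; apply pow2_ge_0).
  destruct i as [|[|[|i]]]; [|destruct b|destruct b|lia].
  - replace (u (Some (nbr (x, y, b) 0)) - u (Some (nbr (x, y, b) 0))) with 0 by ring. lra.
  - apply (PATH ((x, y + 1)%Z, 2%nat) ((x, y + 1)%Z, 1%nat) ((x - 1, y + 1)%Z, 0%nat) ((x - 1, y + 1)%Z, 2%nat)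
      _ (Some ((x, y + 1)%Z, true)) (Some ((x - 1, y + 1)%Z, false)) (Some ((x - 1, y + 1)%Z, true))).
    + nodup4.
    + intros b' h; simpl in h.
      destruct h as [h|[h|[h|[h|[]]]]]; subst b'; (split; [apply IB; lia|]);
        apply NT; try discriminate; intros _; right; rewrite <- h2; apply Hodd.
    + right. rewrite ED by lia. pair_eq.
    + left. rewrite ED by lia. pair_eq.
    + right. rewrite ED by lia. pair_eq.
    + left. rewrite ED by lia. pair_eq.
  - apply (PATH ((x, y)%Z, 2%nat) ((x + 1, y - 1)%Z, 1%nat) ((x + 1, y - 1)%Z, 0%nat) ((x + 1, y)%Z, 2%nat)
      _ (Some ((x, y - 1)%Z, false)) (Some ((x + 1, y - 1)%Z, true)) (Some ((x + 1, y - 1)%Z, false))).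
    + nodup4.
    + intros b' h; simpl in h.
      destruct h as [h|[h|[h|[h|[]]]]]; subst b'; (split; [apply IB; lia|]);
        apply NT; try discriminate; intros _; right; rewrite <- h2; simpl;
        rewrite ?Z.sub_0_r; apply Hodd'.
    + left. rewrite ED by lia. pair_eq.
    + right. rewrite ED by lia. pair_eq.
    + left. rewrite ED by lia. pair_eq.
    + right. rewrite ED by lia. pair_eq.
  - apply (PATH ((x + 1, y)%Z, 1%nat) ((x + 1, y)%Z, 2%nat) ((x + 1, y - 1)%Z, 0%nat) ((x + 1, y - 1)%Z, 1%nat)
      _ (Some ((x + 1, y)%Z, true)) (Some ((x + 1, y - 1)%Z, false)) (Some ((x + 1, y - 1)%Z, true))).
    + nodup4.
    + intros b' h; simpl in h.
      destruct h as [h|[h|[h|[h|[]]]]]; subst b'; (split; [apply IB; lia|]);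
        apply NT; try discriminate; intros _; left; rewrite <- h1; apply Hodd.
    + right. rewrite ED by lia. pair_eq.
    + left. rewrite ED by lia. pair_eq.
    + right. rewrite ED by lia. pair_eq.
    + left. rewrite ED by lia. pair_eq.
  - apply (PATH ((x, y)%Z, 1%nat) ((x - 1, y + 1)%Z, 2%nat) ((x - 1, y + 1)%Z, 0%nat) ((x, y + 1)%Z, 1%nat)
      _ (Some ((x - 1, y)%Z, false)) (Some ((x - 1, y + 1)%Z, true)) (Some ((x - 1, y + 1)%Z, false))).
    + nodup4.
    + intros b' h; simpl in h.
      destruct h as [h|[h|[h|[h|[]]]]]; subst b'; (split; [apply IB; lia|]);
        apply NT; try discriminate; intros _; left; rewrite <- h1; simpl;
        rewrite ?Z.sub_0_r; apply Hodd'.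
    + left. rewrite ED by lia. pair_eq.
    + right. rewrite ED by lia. pair_eq.
    + left. rewrite ED by lia. pair_eq.
    + right. rewrite ED by lia. pair_eq.
Qed.

Lemma edge_side n m b e1 e2 D q i :
  spread m b e1 e2 D -> (m + 3 <= n)%nat -> In q D ->
  edge n (side q i) = (Some q, Some (nbr q i)) \/ edge n (side q i) = (Some (nbr q i), Some q).
Proof.
  intros [_ HD] Hm Hq. destruct (HD q Hq) as [_ [_ [_ Hin]]].
  assert (Hn : In (fst q) (bx n)) by (apply (bx_mono m); [lia|exact Hin]).
  assert (Hf : forall p, p = padd (fst q) (fv i) \/ p = psub (fst q) (fv i) -> In p (bx n)).
  { intros p hp. apply (bx_mono (S m)); [lia|].
    destruct (bx_fv m (fst q) i Hin) as [k1 k2]. destruct hp; subst p; assumption. }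
  destruct q as [p []]; unfold edge, side, nbr; simpl fst; simpl snd; simpl fst in Hn, Hf.
  - left. rewrite !node_Some; auto.
  - right. rewrite psub_padd, !node_Some; auto.
Qed.

Lemma network_energy_eq n m b e1 e2 D (U : option cell -> R) :
  spread m b e1 e2 D -> (m + 3 <= n)%nat ->
  sumR (fun e => (U (fst e) - U (snd e)) ^ 2) (flat_map (star nbr) D ++ rest_edges n D) =
  bsum (S n) (fun p j => grad (fun c => U (node n c)) p j ^ 2).
Proof.
  intros HS Hm. rewrite sumR_app, sumR_flat_map. unfold rest_edges. rewrite sumR_map, sumR_filter.
  set (g := fun x => (U (fst (edge n x)) - U (snd (edge n x))) ^ 2).
  assert (HSn : spread n b e1 e2 D).
  { destruct HS as [h1 h2]. split; [exact h1|]. intros q hq. destruct (h2 q hq) as [a1 [a2 [a3 a4]]].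
    repeat split; auto. apply (bx_mono m); [lia|exact a4]. }
  assert (E := touched_star_sum n b e1 e2 D g HSn).
  transitivity (sumR (fun x => if touched D x then g x else 0) (bonds (S n)) +
     sumR (fun x => if negb (touched D x) then g x else 0) (bonds (S n))).
  - f_equal. rewrite E. apply sumR_ext. intros q hq. unfold star. cbn [sumR]. unfold g.
    assert (K : forall i, (U (fst (edge n (side q i))) - U (snd (edge n (side q i)))) ^ 2 =
       (U (Some q) - U (Some (nbr q i))) ^ 2).
    { intros i. destruct (edge_side n m b e1 e2 D q i HS Hm hq) as [k|k]; rewrite k; cbn [fst snd]; ring. }
    rewrite !K. cbn [fst snd]. ring.
  - rewrite <- sumR_plus. unfold bsum. apply sumR_ext. intros x _. unfold g, edge, grad.
    destruct (touched D x); cbn [negb fst snd]; ring.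
Qed.

(** [Q s] is the energy of the charge [s] in the box. The margin 3 keeps the stars and the paths
    around them away from the grounded cells. *)
Lemma box_gap n m eps b e1 e2 D :
  spread m b e1 e2 D -> (m + 3 <= n)%nat -> 0 < eps <= 1 ->
  exists Q : (cell -> R) -> R, (forall s, box_max n eps s (Q s)) /\
    forall s, (forall c, exists k : Z, s c = IZR k) ->
      sumR (fun c => s c * Q (delta c)) (cells n) + / 108 * sumR (fun q => s q * (s q - 1)) D <= Q s.
Proof.
  intros HS Hm He.
  assert (HS' := HS). destruct HS' as [ND HD].
  assert (Hin : forall q, In q D -> In q (cells n)).
  { intros q hq. apply In_cells. apply (bx_mono m); [lia|]. apply HD; exact hq. }
  destruct (cut_rep_stars cell_dec eps (cells n) nbr (rest_edges n D) D) with (pi := fun x : option cell => x)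
    as [d [L [[Hd [HL H]] [T _]]]].
  - apply NoDup_cells.
  - exact He.
  - intros e h. unfold rest_edges in h. apply in_map_iff in h. destruct h as [x [hx _]]. subst e.
    split; apply node_in_cells.
  - exact ND.
  - intros q hq. destruct (HD q hq) as [k1 [k2 [k3 k4]]]. split; [auto|split; [|split]].
    + intros i hi. destruct (bx_fv m (fst q) i k4) as [j1 j2].
      assert (j3 : snd (nbr q i) <> snd q) by (unfold nbr; destruct (snd q); simpl; discriminate).
      split; [|split].
      * apply In_cells. apply (bx_mono (S m)); [lia|]. unfold nbr. destruct (snd q); assumption.
      * intros h. destruct (HD _ h) as [k _]. congruence.
      * intros h. apply j3. rewrite h. reflexivity.
    + intros e h. unfold rest_edges in h. apply in_map_iff in h. destruct h as [x [hx h]]. subst e.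
      apply filter_In in h. destruct h as [_ h]. unfold edge. cbn [fst snd].
      unfold touched in h. unfold node.
      split; intros hs; match type of hs with context [in_dec pt_dec ?a ?l] =>
        destruct (in_dec pt_dec a l); [|discriminate] end; injection hs as hs; subst q;
        repeat match type of h with context [in_dec cell_dec ?a D] => destruct (in_dec cell_dec a D) end;
        try discriminate; contradiction.
    + intros u i hi. apply (hexagon_path n m b e1 e2); assumption.
  - reflexivity.
  - intros q hq. split; [discriminate|]. intros w _ e. congruence.
  - exists (fun s => cut_form (cells n) d L s s). split.
    + intros s. destruct (H s) as [h1 [U [HU h2]]].
      assert (K : forall U : option cell -> R, U None = 0 ->
         net_dual eps (cells n) (flat_map (star nbr) D ++ rest_edges n D) s U =
         box_dual n eps s (fun c => U (node n c))).
      { intros U' HU'. unfold net_dual, net_energy, box_dual.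
        rewrite (network_energy_eq n m b e1 e2 D U' HS Hm).
        assert (E1 : forall f : cell -> R -> R, sumR (fun v => f v (U' (Some v))) (cells n) =
           sumR (fun v => f v (U' (node n v))) (cells n)).
        { intros f. apply sumR_ext. intros v hv. rewrite node_Some; [reflexivity|]. apply In_cells; exact hv. }
        rewrite (E1 (fun v x => s v * x)), (E1 (fun v x => x ^ 2)). ring. }
      split.
      * intros u Hu. set (U' := fun x : option cell => match x with Some c => u c | None => 0 end).
        assert (EU : forall c, U' (node n c) = u c).
        { intros c. unfold node. destruct (in_dec pt_dec (fst c) (bx n)); [reflexivity|].
          simpl. symmetry. apply Hu. assumption. }
        specialize (h1 U' eq_refl). change (fun x => U' x) with U' in h1. rewrite K in h1 by reflexivity.
        rewrite (functional_extensionality (fun c => U' (node n c)) u EU) in h1. exact h1.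
      * exists (fun c => U (node n c)). split.
        -- intros c hc. rewrite node_None by exact hc. exact HU.
        -- rewrite <- K by exact HU. exact h2.
    + intros s Hs.
      apply (cut_form_integral_gap cell_dec (cells n) d L s D (/ 108)); auto.
      * apply NoDup_cells.
      * lra.
Qed.

(** * Symmetries of the lattice and dependence of the unit energy on the cell *)

Definition aut (v : pt) (b : bool) (c : cell) : cell :=
  if b then (padd (fst c) v, snd c) else (psub v (fst c), negb (snd c)).
Definition aut_bond (v : pt) (b : bool) (x : pt * nat) : pt * nat :=
  ((if b then padd (fst x) v else padd (psub v (fst x)) (fv (snd x))), snd x).

Lemma aut_inj v b c c' : aut v b c = aut v b c' -> c = c'.
Proof.
  destruct c as [[x y] t], c' as [[x' y'] t'], v as [v1 v2]. unfold aut, padd, psub. destruct b; simpl; intros e.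
  - injection e; intros. subst. repeat (apply (f_equal2 pair)); auto; lia.
  - injection e; intros. assert (t = t') by (destruct t, t'; simpl in *; congruence).
    repeat (apply (f_equal2 pair)); auto; lia.
Qed.

Lemma aut_bond_inj v b x x' : aut_bond v b x = aut_bond v b x' -> x = x'.
Proof.
  destruct x as [[x y] j], x' as [[x' y'] j'], v as [v1 v2]. unfold aut_bond, padd, psub.
  destruct b; simpl; intros e; injection e; intros; subst; repeat (apply (f_equal2 pair)); auto; lia.
Qed.

Lemma grad_aut u v b p j :
  grad (fun c => u (aut v b c)) p j =
  (if b then 1 else -1) * grad u (fst (aut_bond v b (p, j))) j.
Proof.
  unfold grad, aut, aut_bond. destruct b; simpl.
  - replace (padd (psub p (fv j)) v) with (psub (padd p v) (fv j)); [ring|].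
    destruct p, v, (fv j); unfold padd, psub; simpl; f_equal; lia.
  - rewrite psub_padd.
    replace (padd (psub v p) (fv j)) with (psub v (psub p (fv j))); [ring|].
    destruct p, v, (fv j); unfold padd, psub; simpl; f_equal; lia.
Qed.

Lemma grad_supp n u p j : csupp n u -> grad u p j <> 0 ->
  In p (bx n) \/ In (psub p (fv j)) (bx n).
Proof.
  intros Hu h. apply NNPP. intros k. apply h. unfold grad.
  rewrite (Hu (p, true)), (Hu (psub p (fv j), false)) by (simpl; tauto). ring.
Qed.

Ltac bx_lia := rewrite In_bx in *; unfold padd, psub in *; cbn [fst snd] in *; lia.

Lemma box_dual_aut n m l eps u v b c :
  csupp n u -> In v (bx l) -> (n + l <= m)%nat -> In (aut v b c) (cells n) ->
  csupp m (fun x => u (aut v b x)) /\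
  box_dual m eps (delta c) (fun x => u (aut v b x)) = box_dual n eps (delta (aut v b c)) u.
Proof.
  intros Hu Hv Hm Hc.
  assert (Hback : forall x, In (fst (aut v b x)) (bx n) -> In (fst x) (bx m)).
  { intros [[x y] t]. destruct v as [v1 v2]. unfold aut. destruct b; cbn [fst snd]; intros; bx_lia. }
  split.
  { intros x hx. apply Hu. intros h. apply hx, Hback, h. }
  unfold box_dual. f_equal; [f_equal|].
  - assert (E : forall k c' w, In c' (cells k) -> sumR (fun x => delta c' x * w x) (cells k) = w c').
    { intros k c' w h. rewrite (sumR_ext _ (fun x => if cell_dec c' x then w x else 0)).
      - rewrite (sumR_delta cell_dec c' w); auto. apply NoDup_cells.
      - intros x _. unfold delta. destruct (cell_dec c' x); ring. }
    rewrite (E n (aut v b c) u Hc).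
    rewrite (E m c (fun x => u (aut v b x))); [reflexivity|].
    apply In_cells, Hback, In_cells. exact Hc.
  - f_equal. apply (sumR_reindex (aut v b)); try apply NoDup_cells.
    + apply aut_inj.
    + reflexivity.
    + intros x _ h. apply In_cells. apply NNPP. intros k. apply h. rewrite Hu by exact k. ring.
    + intros y hy h. set (w := if b then psub (0,0)%Z v else v).
      assert (Ew : aut v b (aut w b y) = y).
      { unfold w. destruct y as [[y1 y2] t], v as [v1 v2]. unfold aut, padd, psub. destruct b; simpl.
        - repeat (apply (f_equal2 pair)); auto; lia.
        - rewrite Bool.negb_involutive. repeat (apply (f_equal2 pair)); auto; lia. }
      exists (aut w b y). split; [|exact Ew]. apply In_cells, Hback. rewrite Ew. apply In_cells; exact hy.
  - apply (sumR_reindex (aut_bond v b)); try apply NoDup_bonds.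
    + apply aut_bond_inj.
    + intros [p j] _. cbn [fst snd]. rewrite grad_aut.
      change (snd (aut_bond v b (p, j))) with j. destruct b; ring.
    + intros [p j] hx h. cbn [fst snd] in h. rewrite grad_aut in h.
      apply In_bonds in hx. apply In_bonds. split; [|apply hx].
      assert (h' : grad u (fst (aut_bond v b (p, j))) j <> 0) by (intros e; apply h; rewrite e; ring).
      destruct (grad_supp n u _ _ Hu h') as [k|k].
      * apply (bx_mono n); [lia|exact k].
      * rewrite <- (padd_psub (fst (aut_bond v b (p, j))) (fv j)). apply bx_fv. exact k.
    + intros [q j] hy h. cbn [fst snd] in h. apply In_bonds in hy. destruct hy as [_ hj].
      assert (h' : grad u q j <> 0) by (intros e; apply h; rewrite e; ring).
      assert (hs := grad_supp n u q j Hu h'). clear h h'.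
      set (x := ((if b then psub q v else padd (psub v q) (fv j)), j) : pt * nat).
      exists x. split.
      * apply In_bonds. split; [|exact hj]. unfold x. cbn [fst].
        destruct q as [q1 q2], v as [v1 v2].
        destruct b; destruct j as [|[|j]]; unfold fv in hs |- *; destruct hs; bx_lia.
      * unfold x, aut_bond. destruct q as [q1 q2], v as [v1 v2], (fv j) as [f1 f2] eqn:Ef.
        destruct b; cbn [fst snd]; rewrite ?Ef; unfold padd, psub; cbn [fst snd];
          repeat (apply (f_equal2 pair)); auto; lia.
Qed.

Lemma box_max_aut n m l eps v b c q q' :
  In v (bx l) -> (n + l <= m)%nat -> In (aut v b c) (cells n) ->
  box_max n eps (delta (aut v b c)) q -> box_max m eps (delta c) q' -> q <= q'.
Proof.
  intros Hv Hm Hc [_ [u [Hu e]]] [h _].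
  destruct (box_dual_aut n m l eps u v b c Hu Hv Hm Hc) as [h1 h2].
  rewrite <- e, <- h2. apply h, h1.
Qed.

Definition c0 : cell := ((0, 0)%Z, true).

(** The energy grows with the box. A translation, or a point reflection when the orientations
    differ, moves [c] to [c0] and the box by at most [l]. This takes the place of translation
    invariance. *)
Lemma box_max_sandwich n l eps c q q1 q2 :
  In (fst c) (bx l) -> (l <= n)%nat ->
  box_max (n - l) eps (delta c0) q1 -> box_max n eps (delta c) q -> box_max (n + l) eps (delta c0) q2 ->
  q1 <= q <= q2.
Proof.
  intros Hl Hn H1 H H2. destruct c as [[x y] t]. cbn [fst] in Hl. split.
  - assert (E : aut (if t then (- x, - y)%Z else (x, y)) t ((x, y), t) = c0).
    { unfold aut, c0, padd, psub. destruct t; simpl; repeat (apply (f_equal2 pair)); auto; lia. }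
    apply (box_max_aut (n - l) n l eps (if t then (- x, - y)%Z else (x, y)) t ((x, y), t)); try (rewrite E); auto.
    + destruct t; bx_lia.
    + lia.
    + apply In_cells. unfold c0. bx_lia.
  - assert (E : aut (x, y) t c0 = ((x, y), t)).
    { unfold aut, c0, padd, psub. destruct t; simpl; repeat (apply (f_equal2 pair)); auto; lia. }
    apply (box_max_aut n (n + l) l eps (x, y) t c0); try (rewrite E); auto.
    apply In_cells. apply (bx_mono l); auto.
Qed.

(** * The angle form and its harmonic conjugate *)

Lemma Rabs_le_between_mid (a c : R) : Rmin 0 a <= c <= Rmax 0 a -> c ^ 2 <= a ^ 2.
Proof. unfold Rmin, Rmax. destruct (Rle_dec 0 a); intros; nra. Qed.

Lemma cubic_bound_of_derive (f df : R -> R) (K t : R) :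
  f 0 = 0 -> (forall x, Rmin 0 t <= x <= Rmax 0 t -> is_derive f x (df x) /\ Rabs (df x) <= K * x ^ 2) ->
  Rabs (f t) <= K * Rabs t ^ 3.
Proof.
  intros H0 H.
  destruct (MVT_gen f 0 t df) as [c [Hc e]].
  - intros x Hx. apply H. lra.
  - intros x Hx. apply derivable_continuous_pt. exists (df x).
    apply is_derive_Reals. apply H. exact Hx.
  - rewrite H0, !Rminus_0_r in e. rewrite e, Rabs_mult.
    destruct (H c Hc) as [_ h]. assert (k := Rabs_le_between_mid t c Hc).
    assert (0 <= Rabs t) by apply Rabs_pos.
    assert (E : Rabs t ^ 2 = t ^ 2) by apply pow2_abs.
    assert (HK : 0 <= K \/ K < 0) by lra. destruct HK as [HK|HK].
    + replace (K * Rabs t ^ 3) with ((K * Rabs t ^ 2) * Rabs t) by ring.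
      apply Rmult_le_compat_r; [assumption|]. rewrite E. nra.
    + assert (0 <= Rabs (df c)) by apply Rabs_pos.
      assert (c ^ 2 <= 0) by nra. assert (c = 0) by nra.
      destruct (Req_dec t 0) as [e'|n]; [subst t; rewrite Rabs_R0; lra|].
      destruct (H t) as [_ h'].
      { unfold Rmin, Rmax; destruct (Rle_dec 0 t); lra. }
      assert (0 <= Rabs (df t)) by apply Rabs_pos.
      assert (0 < t ^ 2) by (apply pow2_gt_0; exact n). nra.
Qed.

Lemma atan_cubic (y : R) : Rabs (atan y - y) <= Rabs y ^ 3.
Proof.
  rewrite <- (Rmult_1_l (Rabs y ^ 3)).
  apply (cubic_bound_of_derive (fun x => atan x - x) (fun x => / (1 + x ^ 2) - 1)).
  - rewrite atan_0. ring.
  - intros x _. split.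
    + auto_derive; [trivial|]. unfold Rsqr. simpl. ring.
    + assert (0 <= x ^ 2) by apply pow2_ge_0.
      replace (/ (1 + x ^ 2) - 1) with (- (x ^ 2 * / (1 + x ^ 2))) by (field; lra).
      rewrite Rabs_Ropp, Rabs_pos_eq.
      * rewrite Rmult_1_l. rewrite <- (Rmult_1_r (x ^ 2)) at 3. apply Rmult_le_compat_l; [lra|].
        rewrite <- Rinv_1 at 2. apply Rinv_le_contravar; lra.
      * apply Rmult_le_pos; [lra|]. left. apply Rinv_0_lt_compat. lra.
Qed.

(** In the variable [t] the logarithm of the ratio is [ln (1 + t) - ln (1 - t)], an odd function:
    there is no quadratic term. *)
Lemma log_ratio_cubic (a a' : R) : 0 < a -> 0 < a' ->
  let t := (a' - a) / (a' + a) in 2 * t ^ 2 <= 1 ->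
  Rabs (ln a' - ln a - 2 * t) <= 4 * Rabs t ^ 3.
Proof.
  intros Ha Ha' t Ht.
  assert (Hlt : -1 < t < 1) by nra.
  assert (E : ln a' - ln a = ln (1 + t) - ln (1 - t)).
  { assert (E1 : a' = (a' + a) / 2 * (1 + t)) by (unfold t; field; lra).
    assert (E2 : a = (a' + a) / 2 * (1 - t)) by (unfold t; field; lra).
    assert (L1 : ln a' = ln ((a' + a) / 2 * (1 + t))) by (f_equal; exact E1).
    assert (L2 : ln a = ln ((a' + a) / 2 * (1 - t))) by (f_equal; exact E2).
    rewrite L1, L2, !ln_mult by lra. ring. }
  rewrite E.
  apply (cubic_bound_of_derive (fun x => ln (1 + x) - ln (1 - x) - 2 * x)
           (fun x => / (1 + x) + / (1 - x) - 2)).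
  - rewrite Rplus_0_r, Rminus_0_r, ln_1. ring.
  - intros x Hx. assert (k := Rabs_le_between_mid t x Hx).
    assert (-1 < x < 1) by nra. split.
    + auto_derive; [lra|]. field. lra.
    + replace (/ (1 + x) + / (1 - x) - 2) with (2 * x ^ 2 * / (1 - x ^ 2)) by (field; nra).
      assert (h : / (1 - x ^ 2) <= 2).
      { replace 2 with (/ (/ 2)) by field. apply Rinv_le_contravar; lra. }
      assert (0 < / (1 - x ^ 2)) by (apply Rinv_0_lt_compat; lra).
      assert (0 <= x ^ 2) by apply pow2_ge_0.
      rewrite Rabs_pos_eq by nra. nra.
Qed.

Lemma polar_exists (X Y : R) : exists th, X = sqrt (X ^ 2 + Y ^ 2) * cos th /\ Y = sqrt (X ^ 2 + Y ^ 2) * sin th.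
Proof.
  set (r := sqrt (X ^ 2 + Y ^ 2)).
  assert (Hs : 0 <= X ^ 2 + Y ^ 2) by nra.
  assert (Hr2 : r * r = X ^ 2 + Y ^ 2) by (apply sqrt_sqrt; exact Hs).
  assert (Hr : 0 <= r) by apply sqrt_pos.
  destruct (Rle_lt_or_eq_dec 0 r Hr) as [Hp|Hz].
  2:{ exists 0. rewrite <- Hz in Hr2 |- *. assert (X = 0 /\ Y = 0) by (split; nra). lra. }
  set (x := X / r).
  assert (Ex : X = r * x) by (unfold x; field; lra).
  assert (Er : r * r * (x * x) + Y ^ 2 = r * r).
  { rewrite Hr2 at 2. rewrite Ex. ring. }
  assert (Hx2 : x * x <= 1).
  { apply Rmult_le_reg_l with (r * r); [nra|]. assert (hy := pow2_ge_0 Y). lra. }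
  assert (Hx : -1 <= x <= 1) by nra.
  assert (Ec := cos_acos x Hx). assert (Es := sin_acos x Hx).
  assert (Hy : Y ^ 2 = r ^ 2 * (1 - x²)) by (unfold Rsqr; lra).
  assert (H1 : 0 <= 1 - x²) by (unfold Rsqr; lra).
  assert (Hq : Rabs Y = r * sqrt (1 - x²)).
  { rewrite <- (Rabs_pos_eq (r * sqrt (1 - x²))) by (apply Rmult_le_pos; [lra|apply sqrt_pos]).
    apply Rsqr_eq_abs_0. unfold Rsqr.
    replace (r * sqrt (1 - x * x) * (r * sqrt (1 - x * x))) with (r ^ 2 * (sqrt (1 - x²) * sqrt (1 - x²)))
      by (unfold Rsqr; ring).
    rewrite sqrt_sqrt by exact H1. lra. }
  destruct (Rle_dec 0 Y) as [h|h].
  - exists (acos x). rewrite Ec, Es, <- Hq, (Rabs_pos_eq Y) by lra. lra.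
  - exists (- acos x). rewrite cos_neg, sin_neg, Ec, Es.
    rewrite Rabs_left in Hq by lra. lra.
Qed.

Lemma cos_eq_1_period (x : R) : cos x = 1 -> exists k : Z, x = 2 * PI * IZR k.
Proof.
  intros H. replace x with (2 * (x / 2)) in H by field. rewrite cos_2a_sin in H.
  assert (E : sin (x / 2) = 0) by nra.
  destruct (sin_eq_0_0 _ E) as [k Hk]. exists k. lra.
Qed.

Lemma angle_diff (X Y X' Y' th th' : R) :
  X = sqrt (X ^ 2 + Y ^ 2) * cos th -> Y = sqrt (X ^ 2 + Y ^ 2) * sin th ->
  X' = sqrt (X' ^ 2 + Y' ^ 2) * cos th' -> Y' = sqrt (X' ^ 2 + Y' ^ 2) * sin th' ->
  0 < X * X' + Y * Y' ->
  exists k : Z, th' - th = atan ((X * Y' - Y * X') / (X * X' + Y * Y')) + 2 * PI * IZR k.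
Proof.
  set (r := sqrt (X ^ 2 + Y ^ 2)). set (r' := sqrt (X' ^ 2 + Y' ^ 2)).
  intros HX HY HX' HY' Hd.
  set (d := X * X' + Y * Y') in *. set (c := X * Y' - Y * X').
  assert (Hr : r * r = X ^ 2 + Y ^ 2) by (apply sqrt_sqrt; nra).
  assert (Hr' : r' * r' = X' ^ 2 + Y' ^ 2) by (apply sqrt_sqrt; nra).
  assert (P : 0 <= r) by apply sqrt_pos. assert (P' : 0 <= r') by apply sqrt_pos.
  assert (Ed : d = r * r' * cos (th' - th)).
  { unfold d. rewrite HX, HY, HX', HY', cos_minus. ring. }
  assert (Ec : c = r * r' * sin (th' - th)).
  { unfold c. rewrite HX, HY, HX', HY', sin_minus. ring. }
  assert (Prr : 0 < r * r').
  { assert (0 <= r * r') by nra. destruct (Req_dec (r * r') 0) as [e|n]; [rewrite e in Ed; lra|lra]. }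
  set (t := c / d).
  assert (Hsq : sqrt (1 + t²) = r * r' / d).
  { apply sqrt_lem_1.
    - unfold Rsqr; nra.
    - left; apply Rdiv_lt_0_compat; lra.
    - assert (E : (r * r') * (r * r') = d * d + c * c).
      { replace (r * r' * (r * r')) with ((r * r) * (r' * r')) by ring. rewrite Hr, Hr'. unfold c, d. ring. }
      unfold t, Rsqr. apply Rmult_eq_reg_r with (d * d); [|nra].
      replace (r * r' / d * (r * r' / d) * (d * d)) with ((r * r') * (r * r')) by (field; lra).
      rewrite E. field. lra. }
  assert (H1 : cos (th' - th - atan t) = 1).
  { rewrite cos_minus, cos_atan, sin_atan, Hsq.
    replace (cos (th' - th)) with (d / (r * r')) by (rewrite Ed; field; nra).
    replace (sin (th' - th)) with (c / (r * r')) by (rewrite Ec; field; nra).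
    assert (E : (r * r') * (r * r') = d * d + c * c).
    { replace (r * r' * (r * r')) with ((r * r) * (r' * r')) by ring. rewrite Hr, Hr'. unfold c, d. ring. }
    unfold t. replace (d / (r * r') * (1 / (r * r' / d)) + c / (r * r') * (c / d / (r * r' / d)))
      with ((d * d + c * c) / ((r * r') * (r * r'))) by (field; repeat split; nra).
    rewrite <- E. field. nra. }
  destruct (cos_eq_1_period _ H1) as [k Hk]. exists k. fold c. fold t. lra.
Qed.

(** The three sides of a cell are seen from its barycentre under 120 degrees, out of the range of
    [atan]; the relation between cross and inner product identifies this angle. *)
Lemma angle_diff_120 (X Y X' Y' th th' sg : R) :
  X = sqrt (X ^ 2 + Y ^ 2) * cos th -> Y = sqrt (X ^ 2 + Y ^ 2) * sin th ->
  X' = sqrt (X' ^ 2 + Y' ^ 2) * cos th' -> Y' = sqrt (X' ^ 2 + Y' ^ 2) * sin th' ->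
  X * X' + Y * Y' < 0 -> sg ^ 2 = 1 ->
  X * Y' - Y * X' = - sg * sqrt 3 * (X * X' + Y * Y') ->
  exists k : Z, th' - th = sg * (2 * PI / 3) + 2 * PI * IZR k.
Proof.
  set (r := sqrt (X ^ 2 + Y ^ 2)). set (r' := sqrt (X' ^ 2 + Y' ^ 2)).
  intros HX HY HX' HY' Hd Hsg Hc.
  set (d := X * X' + Y * Y') in *. set (c := X * Y' - Y * X') in *.
  assert (Hr : r * r = X ^ 2 + Y ^ 2) by (apply sqrt_sqrt; nra).
  assert (Hr' : r' * r' = X' ^ 2 + Y' ^ 2) by (apply sqrt_sqrt; nra).
  assert (P : 0 <= r) by apply sqrt_pos. assert (P' : 0 <= r') by apply sqrt_pos.
  assert (Ed : d = r * r' * cos (th' - th)).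
  { unfold d. rewrite HX, HY, HX', HY', cos_minus. ring. }
  assert (Ec : c = r * r' * sin (th' - th)).
  { unfold c. rewrite HX, HY, HX', HY', sin_minus. ring. }
  assert (S3 : sqrt 3 * sqrt 3 = 3) by (apply sqrt_sqrt; lra).
  assert (E : (r * r') ^ 2 = (2 * d) ^ 2).
  { replace ((r * r') ^ 2) with ((r * r) * (r' * r')) by ring.
    replace ((r * r) * (r' * r')) with (d ^ 2 + c ^ 2) by (rewrite Hr, Hr'; unfold c, d; ring).
    rewrite Hc. replace ((- sg * sqrt 3 * d) ^ 2) with (sg ^ 2 * (sqrt 3 * sqrt 3) * d ^ 2) by ring.
    rewrite Hsg, S3. ring. }
  assert (E' : r * r' = - 2 * d).
  { apply Rsqr_inj; [apply Rmult_le_pos; assumption|lra|]. unfold Rsqr. lra. }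
  assert (Cc : cos (th' - th) = - / 2).
  { apply Rmult_eq_reg_l with (- 2 * d); [|lra]. rewrite <- E' at 1. rewrite <- Ed. field. }
  assert (Cs : sin (th' - th) = sg * (sqrt 3 / 2)).
  { apply Rmult_eq_reg_l with (- 2 * d); [|lra]. rewrite <- E' at 1. rewrite <- Ec, Hc. field. }
  assert (H1 : cos (th' - th - sg * (2 * PI / 3)) = 1).
  { assert (hs : sg = 1 \/ sg = -1) by (destruct (Rle_dec 0 sg); [left|right]; nra).
    rewrite cos_minus, Cc, Cs.
    assert (K1 : cos (2 * PI / 3) = - / 2).
    { replace (2 * PI / 3) with (2 * (PI / 3)) by field. rewrite cos_2PI3. lra. }
    assert (K2 : sin (2 * PI / 3) = sqrt 3 / 2).
    { replace (2 * PI / 3) with (2 * (PI / 3)) by field. rewrite sin_2PI3. reflexivity. }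
    destruct hs; subst sg.
    - rewrite !Rmult_1_l, K1, K2. replace (- / 2 * - / 2 + sqrt 3 / 2 * (sqrt 3 / 2)) with (/ 4 + (sqrt 3 * sqrt 3) / 4) by field.
      rewrite S3. field.
    - replace (-1 * (2 * PI / 3)) with (- (2 * PI / 3)) by ring. rewrite cos_neg, sin_neg, K1, K2.
      replace (- / 2 * - / 2 + -1 * (sqrt 3 / 2) * - (sqrt 3 / 2)) with (/ 4 + (sqrt 3 * sqrt 3) / 4) by field.
      rewrite S3. field. }
  destruct (cos_eq_1_period _ H1) as [k Hk]. exists k. lra.
Qed.

(* Barycentres of cells in the basis [a1, a2], scaled by 3. *)
Definition bary (c : cell) : pt :=
  let k := if snd c then 1%Z else 2%Z in ((3 * fst (fst c) + k)%Z, (3 * snd (fst c) + k)%Z).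
(** The squared Euclidean norm of [v] in the basis [a1], [a2], whose inner product is 1/2. Hence
    [dist2] is nine times the squared distance of the barycentres. *)
Definition qz (v : pt) : Z := (fst v * fst v + fst v * snd v + snd v * snd v)%Z.
Definition dist2 (c c' : cell) : Z := qz (psub (bary c') (bary c)).
Definition supn (v : pt) : Z := Z.max (Z.abs (fst v)) (Z.abs (snd v)).

Definition src (p : pt) (j : nat) : pt :=
  match j with 0%nat => padd p (1, 0)%Z | 1%nat => padd p (0, 1)%Z | _ => p end.
Definition dst (p : pt) (j : nat) : pt :=
  match j with 0%nat => padd p (0, 1)%Z | 1%nat => p | _ => padd p (1, 0)%Z end.
(** Three times the vector from the barycentre of [c] to the lattice point [q]. *)
Definition rel (c : cell) (q : pt) : pt := psub (3 * fst q, 3 * snd q)%Z (bary c).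

Definition dup (c : cell) (p : pt) : Z := dist2 c (p, true).
Definition ddn (c : cell) (p : pt) (j : nat) : Z := dist2 c (psub p (fv j), false).

Ltac lat_unfold := unfold dup, ddn, dist2, rel, qz, bary, psub, padd, supn in *; cbn [fst snd fv] in *.

(** Twice the inner product of the vectors from [c] to the ends of a bond, through the distances of
    [c] to the two adjacent cells. With [cross_rel] this expresses the tangent of the angle of view
    by those distances, which links the angle to the logarithm. *)
Lemma dot_rel c p j :
  (2 * (fst (rel c (src p j)) * fst (rel c (dst p j)) + snd (rel c (src p j)) * snd (rel c (dst p j)))
   + (fst (rel c (src p j)) * snd (rel c (dst p j)) + snd (rel c (src p j)) * fst (rel c (dst p j)))
   = dup c p + ddn c p j - 6)%Z.
Proof.
  destruct c as [[x y] t], p as [i k], t; destruct j as [|[|j]]; unfold src, dst, fv; lat_unfold; ring.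
Qed.

Lemma cross_rel c p j :
  (fst (rel c (src p j)) * snd (rel c (dst p j)) - snd (rel c (src p j)) * fst (rel c (dst p j))
   = ddn c p j - dup c p)%Z.
Proof.
  destruct c as [[x y] t], p as [i k], t; destruct j as [|[|j]]; unfold src, dst, fv; lat_unfold; ring.
Qed.

(** A bond and its dual are orthogonal, so the differences of squared distances across and along the
    bond are two components of one vector. The square of the second one is the defect, up to
    constants. *)
Lemma diff_sq c p j :
  ((ddn c p j - dup c p) * (ddn c p j - dup c p) <= 6 * (dup c p + ddn c p j))%Z.
Proof.
  assert (H : (3 * (6 * (dup c p + ddn c p j) - 9 - (ddn c p j - dup c p) * (ddn c p j - dup c p)) =
     (qz (rel c (dst p j)) - qz (rel c (src p j))) * (qz (rel c (dst p j)) - qz (rel c (src p j))))%Z).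
  { destruct c as [[x y] t], p as [i k], t; destruct j as [|[|j]]; unfold src, dst, fv; lat_unfold; ring. }
  assert (h := Z.square_nonneg (qz (rel c (dst p j)) - qz (rel c (src p j)))).
  rewrite <- H in h. lia.
Qed.

Lemma qz_ge v : (3 * supn v * supn v <= 4 * qz v)%Z.
Proof.
  destruct v as [x y]. lat_unfold.
  assert (hx := Z.square_nonneg (2 * y + x)). assert (hy := Z.square_nonneg (2 * x + y)).
  assert (ex := Z.abs_square x). assert (ey := Z.abs_square y).
  destruct (Z.max_spec (Z.abs x) (Z.abs y)) as [[_ e]|[_ e]]; rewrite e; lia.
Qed.

Lemma qz_le v : (qz v <= 3 * supn v * supn v)%Z.
Proof.
  destruct v as [x y]. lat_unfold. set (m := Z.max (Z.abs x) (Z.abs y)).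
  assert (h1 : (Z.abs x <= m)%Z) by apply Z.le_max_l.
  assert (h2 : (Z.abs y <= m)%Z) by apply Z.le_max_r.
  assert (x * x <= m * m)%Z by nia. assert (y * y <= m * m)%Z by nia. assert (x * y <= m * m)%Z by nia. lia.
Qed.

Lemma dist2_nonneg c c' : (0 <= dist2 c c')%Z.
Proof. assert (h := qz_ge (psub (bary c') (bary c))). unfold dist2. nia. Qed.

Lemma dist2_sym c c' : dist2 c c' = dist2 c' c.
Proof. destruct c as [[x y] t], c' as [[x' y'] t']. lat_unfold. ring. Qed.

Lemma dist2_refl c : dist2 c c = 0%Z.
Proof. destruct c as [[x y] t]. lat_unfold. ring. Qed.

Lemma dist2_zero c c' : dist2 c c' = 0%Z -> c' = c.
Proof.
  intros H. assert (h := qz_ge (psub (bary c') (bary c))). unfold dist2 in H. rewrite H in h.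
  assert (hs : supn (psub (bary c') (bary c)) = 0%Z).
  { assert (0 <= supn (psub (bary c') (bary c)))%Z by (unfold supn; lia). nia. }
  destruct c as [[x y] t], c' as [[x' y'] t']. lat_unfold.
  destruct t, t'; repeat (apply (f_equal2 pair)); auto; lia.
Qed.

(** Barycentres of cells of equal orientation differ, at scale 3, by three times a lattice vector,
    which makes [dist2] divisible by 9; opposite orientations give the residue 3. *)
Lemma dist2_mod c p j : exists m m', (0 <= m)%Z /\ (0 <= m')%Z /\
  ((dup c p = 9 * m /\ ddn c p j = 9 * m' + 3) \/ (dup c p = 9 * m + 3 /\ ddn c p j = 9 * m'))%Z.
Proof.
  assert (H1 := dist2_nonneg c (p, true)). assert (H2 := dist2_nonneg c (psub p (fv j), false)).
  fold (dup c p) in H1. fold (ddn c p j) in H2.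
  assert (H : exists m m', ((dup c p = 9 * m /\ ddn c p j = 9 * m' + 3) \/ (dup c p = 9 * m + 3 /\ ddn c p j = 9 * m'))%Z).
  { destruct c as [[x y] t], p as [i k]. set (f := fv j).
    assert (Ef : exists f1 f2, fv j = (f1, f2)) by (destruct (fv j); eauto). destruct Ef as [f1 [f2 Ef]].
    destruct t.
    - exists (qz (i - x, k - y)%Z).
      exists (qz (i - f1 - x, k - f2 - y)%Z + (i - f1 - x) + (k - f2 - y))%Z. left.
      lat_unfold. rewrite Ef. cbn [fst snd]. split; ring.
    - exists (qz (i - x, k - y)%Z - (i - x) - (k - y))%Z.
      exists (qz (i - f1 - x, k - f2 - y)%Z)%Z. right.
      lat_unfold. rewrite Ef. cbn [fst snd]. split; ring. }
  destruct H as [m [m' H]]. exists m, m'. split; [|split; [|exact H]]; lia.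
Qed.

(** By the residues modulo 9 the sum of the two distances is 3 on the sides of [c] and at least 12
    elsewhere. This justifies the threshold 6 in [ang] and keeps its denominator positive. *)
Lemma core_or_far c p j :
  (dup c p = 0 /\ ddn c p j = 3 \/ dup c p = 3 /\ ddn c p j = 0 \/
   3 <= dup c p /\ 3 <= ddn c p j /\ 12 <= dup c p + ddn c p j)%Z.
Proof.
  destruct (dist2_mod c p j) as [m [m' [h1 [h2 [[e1 e2]|[e1 e2]]]]]].
  - destruct (Z.eq_dec m 0); [|lia]. destruct (Z.eq_dec m' 0); [lia|].
    exfalso. assert (E : c = (p, true)) by (symmetry; apply dist2_zero; fold (dup c p); lia).
    subst c. revert e2. destruct p as [i k]; destruct j as [|[|j]]; unfold fv; lat_unfold; lia.
  - destruct (Z.eq_dec m' 0); [|lia]. destruct (Z.eq_dec m 0); [lia|].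
    exfalso. assert (E : c = (psub p (fv j), false)) by (symmetry; apply dist2_zero; fold (ddn c p j); lia).
    subst c. revert e1. destruct p as [i k]; destruct j as [|[|j]]; unfold fv; lat_unfold; lia.
Qed.

Lemma dist2_large c p j :
  let N := (1 + supn (psub p (fst c)))%Z in
  (12 <= dup c p + ddn c p j)%Z -> (3 * (N * N) <= 2 * (dup c p + ddn c p j))%Z.
Proof.
  intros N H.
  assert (Hk : (N <= 2 \/ 3 <= N)%Z) by lia. destruct Hk as [Hk|Hk].
  - assert (1 <= N)%Z by (unfold N, supn; lia). nia.
  - set (k := supn (psub p (fst c))) in *.
    assert (A1 : (3 * k - 1 <= supn (psub (bary (p, true)) (bary c)))%Z).
    { unfold k. destruct c as [[x y] t], p as [i l], t; lat_unfold; lia. }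
    assert (A2 : (3 * k - 3 <= supn (psub (bary (psub p (fv j), false)) (bary c)))%Z).
    { unfold k. destruct c as [[x y] t], p as [i l], t; destruct j as [|[|j]]; unfold fv; lat_unfold; lia. }
    assert (B1 := qz_ge (psub (bary (p, true)) (bary c))).
    assert (B2 := qz_ge (psub (bary (psub p (fv j), false)) (bary c))).
    fold (dist2 c (p, true)) in B1. fold (dup c p) in B1.
    fold (dist2 c (psub p (fv j), false)) in B2. fold (ddn c p j) in B2.
    set (s1 := supn (psub (bary (p, true)) (bary c))) in *.
    set (s2 := supn (psub (bary (psub p (fv j), false)) (bary c))) in *.
    assert ((3 * k - 1) * (3 * k - 1) <= s1 * s1)%Z by nia.
    assert ((3 * k - 3) * (3 * k - 3) <= s2 * s2)%Z by nia.
    unfold N. nia.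
Qed.

Lemma dist2_upper c p j :
  let N := (1 + supn (psub p (fst c)))%Z in
  (dup c p <= 48 * (N * N))%Z /\ (ddn c p j <= 48 * (N * N))%Z.
Proof.
  intros N. set (k := supn (psub p (fst c))) in *.
  assert (Hk : (0 <= k)%Z) by (unfold k, supn; lia).
  assert (A1 : (0 <= supn (psub (bary (p, true)) (bary c)) <= 3 * k + 4)%Z).
  { unfold k. destruct c as [[x y] t], p as [i l], t; lat_unfold; lia. }
  assert (A2 : (0 <= supn (psub (bary (psub p (fv j), false)) (bary c)) <= 3 * k + 4)%Z).
  { unfold k. destruct c as [[x y] t], p as [i l], t; destruct j as [|[|j]]; unfold fv; lat_unfold; lia. }
  assert (B1 := qz_le (psub (bary (p, true)) (bary c))).
  assert (B2 := qz_le (psub (bary (psub p (fv j), false)) (bary c))).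
  fold (dist2 c (p, true)) in B1. fold (dup c p) in B1.
  fold (dist2 c (psub p (fv j), false)) in B2. fold (ddn c p j) in B2.
  set (s1 := supn (psub (bary (p, true)) (bary c))) in *.
  set (s2 := supn (psub (bary (psub p (fv j), false)) (bary c))) in *.
  assert (s1 * s1 <= (3 * k + 4) * (3 * k + 4))%Z by nia.
  assert (s2 * s2 <= (3 * k + 4) * (3 * k + 4))%Z by nia.
  unfold N. split; nia.
Qed.

Lemma dist2_supn c c' :
  (supn (psub (fst c') (fst c)) * supn (psub (fst c') (fst c)) <= dist2 c c')%Z.
Proof.
  set (k := supn (psub (fst c') (fst c))).
  assert (Hk : (0 <= k)%Z) by (unfold k, supn; lia).
  destruct (Z.eq_dec k 0) as [e|n]; [rewrite e; assert (h := dist2_nonneg c c'); lia|].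
  assert (A1 : (3 * k - 1 <= supn (psub (bary c') (bary c)))%Z).
  { unfold k. destruct c as [[x y] t], c' as [[i l] t'], t, t'; lat_unfold; lia. }
  assert (B1 := qz_ge (psub (bary c') (bary c))). fold (dist2 c c') in B1.
  set (s1 := supn (psub (bary c') (bary c))) in *.
  assert ((3 * k - 1) * (3 * k - 1) <= s1 * s1)%Z by nia. nia.
Qed.

Lemma dist2_parallelogram c c' c'' : (dist2 c c'' <= 2 * (dist2 c c' + dist2 c' c''))%Z.
Proof.
  unfold dist2. destruct (bary c) as [x y], (bary c') as [x' y'], (bary c'') as [x'' y''].
  assert (h := qz_ge ((x'' - x') - (x' - x), (y'' - y') - (y' - y))%Z).
  assert (0 <= supn ((x'' - x') - (x' - x), (y'' - y') - (y' - y))%Z)%Z by (unfold supn; lia).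
  assert (h2 : (0 <= qz ((x'' - x') - (x' - x), (y'' - y') - (y' - y))%Z)%Z) by nia.
  clear h H. lat_unfold. nia.
Qed.

(** * The angle form of a vortex *)

Definition arg (X Y : R) : R := proj1_sig (constructive_indefinite_description _ (polar_exists X Y)).
Definition cx (v : pt) : R := IZR (fst v) + IZR (snd v) / 2.
Definition cy (v : pt) : R := sqrt 3 / 2 * IZR (snd v).
Definition yarg (c : cell) (q : pt) : R := arg (cx (rel c q)) (cy (rel c q)) / (2 * PI).

(* The angle, in turns, under which the bond is seen from the barycentre of [c]; the first
   case consists of the three sides of [c]. *)
Definition ang (c : cell) (p : pt) (j : nat) : R :=
  if Z_le_dec (dup c p + ddn c p j) 6 then (if Z_lt_dec (dup c p) (ddn c p j) then / 3 else - / 3)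
  else atan (sqrt 3 * IZR (ddn c p j - dup c p) / IZR (dup c p + ddn c p j - 6)) / (2 * PI).

(** Plays the role of the distance from [c] to a bond at [p]; the added 1 keeps its inverse bounded
    at the core. *)
Definition NN (c : cell) (p : pt) : R := 1 + IZR (supn (psub p (fst c))).

Lemma abs_le_of_sq (x b : R) : 0 <= b -> x ^ 2 <= b ^ 2 -> Rabs x <= b.
Proof.
  intros Hb H. rewrite <- (Rabs_pos_eq b Hb). apply Rsqr_le_abs_0. unfold Rsqr. nra.
Qed.

Lemma sqrt3_bounds : sqrt 3 * sqrt 3 = 3 /\ 1 < sqrt 3 < 2.
Proof.
  assert (H : sqrt 3 * sqrt 3 = 3) by (apply sqrt_sqrt; lra).
  assert (0 <= sqrt 3) by apply sqrt_pos. split; [exact H|nra].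
Qed.

Lemma PI_bounds : 3 < PI <= 4.
Proof. assert (h := PI2_3_2). assert (h' := PI_4). lra. Qed.

Lemma NN_ge1 c p : 1 <= NN c p.
Proof. unfold NN. assert (0 <= IZR (supn (psub p (fst c)))); [|lra]. apply IZR_le. unfold supn. lia. Qed.

Lemma arg_spec X Y : X = sqrt (X ^ 2 + Y ^ 2) * cos (arg X Y) /\ Y = sqrt (X ^ 2 + Y ^ 2) * sin (arg X Y).
Proof. unfold arg. destruct (constructive_indefinite_description _ (polar_exists X Y)) as [th H]. exact H. Qed.

(** So [ang c] lifts the differences of the displacement [yarg c]; the branch of the argument only
    affects the integer. *)
Lemma ang_int c p j : exists k : Z, yarg c (dst p j) - yarg c (src p j) - ang c p j = IZR k.
Proof.
  destruct sqrt3_bounds as [S3 S3b]. assert (HPI := PI_bounds).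
  set (v := rel c (src p j)). set (v' := rel c (dst p j)).
  destruct (arg_spec (cx v) (cy v)) as [h1 h2]. destruct (arg_spec (cx v') (cy v')) as [h3 h4].
  assert (Ed : cx v * cx v' + cy v * cy v' = IZR (dup c p + ddn c p j - 6) / 2).
  { rewrite <- dot_rel. fold v v'. unfold cx, cy. rewrite !plus_IZR, !mult_IZR, !plus_IZR, !mult_IZR.
    replace (sqrt 3 / 2 * IZR (snd v) * (sqrt 3 / 2 * IZR (snd v'))) with (sqrt 3 * sqrt 3 / 4 * (IZR (snd v) * IZR (snd v'))) by field.
    rewrite S3. field. }
  assert (Ec : cx v * cy v' - cy v * cx v' = sqrt 3 / 2 * IZR (ddn c p j - dup c p)).
  { rewrite <- (cross_rel c p j). fold v v'. unfold cx, cy. rewrite minus_IZR, !mult_IZR. field. }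
  unfold ang. destruct (Z_le_dec (dup c p + ddn c p j) 6) as [h|h].
  - assert (K : exists sg, sg ^ 2 = 1 /\ (if Z_lt_dec (dup c p) (ddn c p j) then / 3 else - / 3) = sg / 3 /\
       cx v * cy v' - cy v * cx v' = - sg * sqrt 3 * (cx v * cx v' + cy v * cy v') /\
       cx v * cx v' + cy v * cy v' < 0).
    { rewrite Ed, Ec. destruct (core_or_far c p j) as [[e1 e2]|[[e1 e2]|k]]; [| |exfalso; lia].
      - exists 1. rewrite e1, e2. destruct (Z_lt_dec 0 3); [|exfalso; lia].
        replace (3 - 0)%Z with 3%Z by ring. replace (0 + 3 - 6)%Z with (-3)%Z by ring.
        repeat split; try lra.
      - exists (-1). rewrite e1, e2. destruct (Z_lt_dec 3 0); [exfalso; lia|].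
        replace (0 - 3)%Z with (-3)%Z by ring. replace (3 + 0 - 6)%Z with (-3)%Z by ring.
        repeat split; try lra. }
    destruct K as [sg [k1 [k2 [k3 k4]]]].
    destruct (angle_diff_120 _ _ _ _ _ _ sg h1 h2 h3 h4 k4 k1 k3) as [k Hk].
    exists k. rewrite k2. unfold yarg. fold v v'.
    replace (arg (cx v') (cy v')) with (arg (cx v) (cy v) + sg * (2 * PI / 3) + 2 * PI * IZR k) by lra.
    field. lra.
  - assert (k4 : 0 < cx v * cx v' + cy v * cy v').
    { rewrite Ed. assert (0 < IZR (dup c p + ddn c p j - 6)); [apply IZR_lt; lia|lra]. }
    destruct (angle_diff _ _ _ _ _ _ h1 h2 h3 h4 k4) as [k Hk].
    exists k. unfold yarg. fold v v'. rewrite Ec, Ed in Hk.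
    replace (sqrt 3 / 2 * IZR (ddn c p j - dup c p) / (IZR (dup c p + ddn c p j - 6) / 2))
      with (sqrt 3 * IZR (ddn c p j - dup c p) / IZR (dup c p + ddn c p j - 6)) in Hk.
    + replace (arg (cx v') (cy v')) with (arg (cx v) (cy v) +
        atan (sqrt 3 * IZR (ddn c p j - dup c p) / IZR (dup c p + ddn c p j - 6)) + 2 * PI * IZR k) by lra.
      field. lra.
    + field. rewrite Ed in k4. lra.
Qed.

Lemma ang_abs c p j : Rabs (ang c p j) <= / 3 /\
  ((6 < dup c p + ddn c p j)%Z -> Rabs (ang c p j) < / 4).
Proof.
  assert (HPI := PI_bounds). unfold ang. destruct (Z_le_dec (dup c p + ddn c p j) 6) as [h|h].
  - split; [|lia]. destruct (Z_lt_dec _ _); [|rewrite Rabs_Ropp]; rewrite Rabs_pos_eq; lra.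
  - set (y := _ / IZR (dup c p + ddn c p j - 6)). assert (k := atan_bound y).
    assert (Rabs (atan y / (2 * PI)) < / 4); [|split; lra].
    apply Rabs_def1; apply Rmult_lt_reg_r with (2 * PI); try lra;
      unfold Rdiv; rewrite Rmult_assoc, Rinv_l by lra; lra.
Qed.

Lemma div_int (y : pt -> R) (a : flow) :
  (forall p j, (j < 3)%nat -> exists k : Z, y (dst p j) - y (src p j) - a p j = IZR k) ->
  forall x, exists k : Z, divf a x = IZR k.
Proof.
  intros H x. destruct x as [p []]; unfold divf, sum3; cbn [fst snd].
  - destruct (H p 0%nat ltac:(lia)) as [k0 h0], (H p 1%nat ltac:(lia)) as [k1 h1], (H p 2%nat ltac:(lia)) as [k2 h2].
    exists (- (k0 + k1 + k2))%Z. rewrite opp_IZR, !plus_IZR, <- h0, <- h1, <- h2.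
    cbn [src dst]. ring.
  - destruct (H (padd p (fv 0)) 0%nat ltac:(lia)) as [k0 h0], (H (padd p (fv 1)) 1%nat ltac:(lia)) as [k1 h1],
      (H (padd p (fv 2)) 2%nat ltac:(lia)) as [k2 h2].
    exists (k0 + k1 + k2)%Z. rewrite !plus_IZR, <- h0, <- h1, <- h2. cbn [src dst fv].
    destruct p as [x y']. unfold padd; cbn [fst snd].
    replace (x + 1 + 0)%Z with (x + 0 + 1)%Z by ring. replace (y' + 0 + 1)%Z with (y' + 1 + 0)%Z by ring.
    rewrite !Z.add_0_r. ring.
Qed.

Definition far (c : cell) (b : pt * nat) : Prop := (6 < dup c (fst b) + ddn c (fst b) (snd b))%Z.

Lemma side_core c x i : (i < 3)%nat -> x <> c -> ~ far c (side x i) -> nbr x i = c.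
Proof.
  intros Hi Hx Hf. unfold far in Hf.
  destruct (core_or_far c (fst (side x i)) (snd (side x i))) as [[e1 e2]|[[e1 e2]|k]]; [| |exfalso; lia].
  - apply dist2_zero in e1. destruct x as [p []]; unfold side, nbr in *; cbn [fst snd] in *.
    + contradiction.
    + exact e1.
  - apply dist2_zero in e2. destruct x as [p []]; unfold side, nbr in *; cbn [fst snd] in *.
    + exact e2.
    + rewrite psub_padd in e2. contradiction.
Qed.

(** At [c] the three sides carry 1/3 each. Any other cell has at most one side in common with [c],
    so its outflow is below [1/3 + 1/4 + 1/4 < 1], and it is an integer. *)
Lemma div_ang c x : divf (ang c) x = delta c x.
Proof.
  unfold delta. destruct (cell_dec c x) as [e|n].
  - subst x. destruct c as [p []]; unfold divf, sum3; cbn [fst snd].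
    + assert (E : forall j, (j < 3)%nat -> ang (p, true) p j = / 3).
      { intros j hj. assert (E1 : dup (p, true) p = 0%Z) by apply dist2_refl.
        assert (E2 : ddn (p, true) p j = 3%Z).
        { destruct p as [x y]; destruct j as [|[|[|j]]]; [| | |lia]; lat_unfold; ring. }
        unfold ang. rewrite E1, E2. destruct (Z_le_dec (0 + 3) 6); [|lia].
        destruct (Z_lt_dec 0 3); [reflexivity|lia]. }
      rewrite !E by lia. lra.
    + assert (E : forall j, (j < 3)%nat -> ang (p, false) (padd p (fv j)) j = - / 3).
      { intros j hj. assert (E1 : ddn (p, false) (padd p (fv j)) j = 0%Z)
          by (unfold ddn; rewrite psub_padd; apply dist2_refl).
        assert (E2 : dup (p, false) (padd p (fv j)) = 3%Z).
        { destruct p as [x y]; destruct j as [|[|[|j]]]; [| | |lia]; lat_unfold; ring. }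
        unfold ang. rewrite E1, E2. destruct (Z_le_dec (3 + 0) 6); [|lia].
        destruct (Z_lt_dec 3 0); [lia|reflexivity]. }
      rewrite !E by lia. lra.
  - destruct (div_int (yarg c) (ang c) (fun p j _ => ang_int c p j) x) as [k Hk]. rewrite Hk.
    assert (B : Rabs (divf (ang c) x) < 1).
    { assert (T : forall i, Rabs (ang c (fst (side x i)) i) <= / 3 /\
        (far c (side x i) -> Rabs (ang c (fst (side x i)) i) < / 4)) by (intros i; apply ang_abs).
      assert (E : Rabs (divf (ang c) x) <= Rabs (ang c (fst (side x 0)) 0) +
         Rabs (ang c (fst (side x 1)) 1) + Rabs (ang c (fst (side x 2)) 2)).
      { assert (E3 : forall a b d, Rabs (a + b + d) <= Rabs a + Rabs b + Rabs d).
        { intros a b d. eapply Rle_trans; [apply Rabs_triang|]. assert (h := Rabs_triang a b). lra. }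
        destruct x as [p []]; unfold divf, sum3, side; cbn [fst snd]; [apply E3|].
        rewrite Rabs_Ropp. apply E3. }
      assert (M : forall i i', (i < i' < 3)%nat -> far c (side x i) \/ far c (side x i')).
      { intros i i' hi. destruct (classic (far c (side x i))) as [h|h]; [left; exact h|right].
        apply NNPP. intros h'.
        assert (e1 := side_core c x i ltac:(lia) (not_eq_sym n) h).
        assert (e2 := side_core c x i' ltac:(lia) (not_eq_sym n) h').
        assert (e3 : fv i = fv i').
        { rewrite <- e2 in e1. destruct x as [[x y] []]; unfold nbr, psub, padd in e1; cbn [fst snd] in e1;
            injection e1; intros; destruct (fv i), (fv i'); cbn [fst snd] in *; f_equal; lia. }
        destruct i as [|[|i]]; destruct i' as [|[|[|i']]]; try lia; discriminate e3. }
      destruct (T 0%nat) as [a0 b0], (T 1%nat) as [a1 b1], (T 2%nat) as [a2 b2].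
      destruct (M 0%nat 1%nat ltac:(lia)) as [m|m]; destruct (M 0%nat 2%nat ltac:(lia)) as [m'|m'];
        destruct (M 1%nat 2%nat ltac:(lia)) as [m''|m''];
        try specialize (b0 ltac:(assumption)); try specialize (b1 ltac:(assumption));
        try specialize (b2 ltac:(assumption)); lra. }
    rewrite Hk in B. rewrite Rabs_Zabs in B. apply (lt_IZR _ 1) in B.
    assert (k = 0%Z) by lia. subst; reflexivity.
Qed.

(** Fixed by matching first orders: with [t = (ddn - dup) / (ddn + dup)], far from [c] the angle in
    turns is about [sqrt 3 * t / (2 * PI)], while the logarithms of the two squared distances differ
    by about [2 * t]. *)
Definition k0 : R := sqrt 3 / (2 * PI).
(* At the source itself [ln 0 = 0], so [hlog c c = 0]. *)
Definition hlog (c c' : cell) : R := k0 / 2 * ln (IZR (dist2 c c')).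
Definition dh (c : cell) : flow := fun p j => hlog c (psub p (fv j), false) - hlog c (p, true).

Lemma ln_nonpos (x : R) : x <= 0 -> ln x = 0.
Proof. intros H. unfold ln. destruct (Rlt_dec 0 x) as [h|h]; [exfalso; lra|reflexivity]. Qed.

Lemma k0_bounds : 0 < k0 <= 1.
Proof.
  destruct sqrt3_bounds as [_ h]. assert (h' := PI_bounds). unfold k0. split.
  - apply Rdiv_lt_0_compat; lra.
  - apply Rmult_le_reg_r with (2 * PI); [lra|]. unfold Rdiv. rewrite Rmult_assoc, Rinv_l by lra. lra.
Qed.

Lemma core_NN c p j : (dup c p + ddn c p j <= 6)%Z -> NN c p <= 2.
Proof.
  intros H. assert (h := dist2_supn c (p, true)). assert (h' := dist2_nonneg c (psub p (fv j), false)).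
  fold (dup c p) in h. fold (ddn c p j) in h'. cbn [fst] in h.
  assert (supn (psub p (fst c)) <= 1)%Z.
  { destruct (core_or_far c p j) as [[e1 e2]|[[e1 e2]|k]]; nia. }
  unfold NN. apply IZR_le in H0. lra.
Qed.

Lemma far_estimates c p j : (6 < dup c p + ddn c p j)%Z ->
  let a := IZR (dup c p) in let a' := IZR (ddn c p j) in let N := NN c p in
  3 <= a /\ 3 <= a' /\ 12 <= a + a' /\ 3 * N ^ 2 <= 2 * (a + a') /\ (a' - a) ^ 2 <= 6 * (a + a').
Proof.
  intros H a a' N. destruct (core_or_far c p j) as [[e1 e2]|[[e1 e2]|[k1 [k2 k3]]]]; [exfalso; lia|exfalso; lia|].
  assert (h1 := dist2_large c p j k3). cbv zeta in h1. assert (h2 := diff_sq c p j).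
  apply IZR_le in k1, k2, k3, h1, h2. rewrite plus_IZR in k3.
  rewrite !mult_IZR, !plus_IZR in h1. rewrite !mult_IZR, !minus_IZR, plus_IZR in h2.
  unfold a, a', N, NN. repeat split; try lra.
Qed.

Lemma inv_NN c p : 0 < / NN c p <= 1.
Proof.
  assert (h := NN_ge1 c p). split; [apply Rinv_0_lt_compat; lra|].
  rewrite <- Rinv_1. apply Rinv_le_contravar; lra.
Qed.

Lemma Rabs_div_sq_le (x s k z : R) : 0 < s -> 0 <= k -> 0 <= z -> x ^ 2 <= k ^ 2 * z ^ 2 * s ^ 2 -> Rabs (x / s) <= k * z.
Proof.
  intros Hs Hk Hz H. apply abs_le_of_sq; [nra|].
  apply Rmult_le_reg_r with (s ^ 2); [nra|].
  replace ((x / s) ^ 2 * s ^ 2) with (x ^ 2) by (field; lra). nra.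
Qed.

Lemma far_small c p j : (6 < dup c p + ddn c p j)%Z ->
  let a := IZR (dup c p) in let a' := IZR (ddn c p j) in let z := / NN c p in
  Rabs ((a' - a) / (a' + a)) <= 2 * z /\
  Rabs (sqrt 3 * (a' - a) / (a + a' - 6)) <= 7 * z /\
  / (a + a') <= z ^ 2 /\ 2 * ((a' - a) / (a' + a)) ^ 2 <= 1.
Proof.
  intros H a a' z. destruct (far_estimates c p j H) as [h1 [h2 [h3 [h4 h5]]]].
  fold a in h1, h3, h4, h5. fold a' in h2, h3, h4, h5.
  assert (hN := NN_ge1 c p). assert (hz := inv_NN c p). fold z in hz.
  set (N := NN c p) in *. set (S := a + a') in *.
  assert (zN : z * N = 1) by (unfold z; field; lra).
  assert (zS : 3 <= 2 * S * z ^ 2).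
  { assert (z ^ 2 * (3 * N ^ 2) <= z ^ 2 * (2 * S)) by (apply Rmult_le_compat_l; nra).
    replace (z ^ 2 * (3 * N ^ 2)) with (3 * (z * N) ^ 2) in H0 by ring. rewrite zN in H0. lra. }
  destruct sqrt3_bounds as [S3 S3b].
  split; [|split; [|split]].
  - apply Rabs_div_sq_le; try lra. replace (a' + a) with S by (unfold S; ring).
    assert (6 * S <= 4 * z ^ 2 * S ^ 2).
    { replace (4 * z ^ 2 * S ^ 2) with ((2 * S * z ^ 2) * (2 * S)) by ring. nra. }
    replace (2 ^ 2) with 4 by ring. lra.
  - apply Rabs_div_sq_le; try lra.
    replace ((sqrt 3 * (a' - a)) ^ 2) with ((sqrt 3 * sqrt 3) * (a' - a) ^ 2) by ring. rewrite S3.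
    assert (hs : S ^ 2 <= 4 * (S - 6) ^ 2) by nra.
    assert (72 * S <= 49 * z ^ 2 * S ^ 2).
    { replace (49 * z ^ 2 * S ^ 2) with ((2 * S * z ^ 2) * (49 / 2 * S)) by field. nra. }
    assert (z ^ 2 * S ^ 2 <= z ^ 2 * (4 * (S - 6) ^ 2)) by (apply Rmult_le_compat_l; nra).
    replace (7 ^ 2) with 49 by ring. nra.
  - apply Rmult_le_reg_r with S; [lra|]. rewrite Rinv_l by lra. lra.
  - replace (a' + a) with S by (unfold S; ring).
    apply Rmult_le_reg_r with (S ^ 2); [nra|].
    replace (2 * ((a' - a) / S) ^ 2 * S ^ 2) with (2 * (a' - a) ^ 2) by (field; lra). nra.
Qed.

Lemma ang_bound c p j : Rabs (ang c p j) <= 2 * / NN c p.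
Proof.
  assert (hz := inv_NN c p). assert (hN := NN_ge1 c p).
  destruct (Z_le_dec (dup c p + ddn c p j) 6) as [h|h].
  - assert (k := core_NN c p j h). destruct (ang_abs c p j) as [k' _].
    assert (/ 2 <= / NN c p) by (apply Rinv_le_contravar; lra). lra.
  - destruct (far_small c p j ltac:(lia)) as [_ [k [_ _]]].
    unfold ang. destruct (Z_le_dec _ _); [contradiction|].
    rewrite minus_IZR, minus_IZR, plus_IZR.
    set (y := _ / _) in *. set (z := / NN c p) in *.
    assert (HPI := PI_bounds).
    assert (ha : Rabs (atan y) <= Rabs y).
    { assert (E : forall x, 0 <= x -> 0 <= atan x <= x).
      { intros x hx. destruct (MVT_gen atan 0 x (fun t => / (1 + t²))) as [c1 [hc e]].
        - intros t _. apply is_derive_atan.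
        - intros t _. apply derivable_continuous_pt, derivable_pt_atan.
        - rewrite atan_0, !Rminus_0_r in e. rewrite e.
          assert (0 < / (1 + c1²) <= 1).
          { assert (0 <= c1²) by apply Rle_0_sqr. split; [apply Rinv_0_lt_compat; lra|].
            rewrite <- Rinv_1. apply Rinv_le_contravar; lra. }
          nra. }
      destruct (Rle_dec 0 y) as [h1|h1].
      - destruct (E y h1). rewrite !Rabs_pos_eq; lra.
      - destruct (E (- y) ltac:(lra)). rewrite atan_opp in *. rewrite !Rabs_left1; lra. }
    unfold Rdiv. rewrite Rabs_mult, (Rabs_pos_eq (/ (2 * PI))) by (left; apply Rinv_0_lt_compat; lra).
    apply Rmult_le_reg_r with (2 * PI); [lra|]. rewrite Rmult_assoc, Rinv_l by lra. nra.
Qed.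

(** A discrete Cauchy-Riemann relation. Both expansions have the same linear term in [t] and no
    quadratic one, and [t] is of order inverse distance; the cubic error is square summable on the
    lattice, unlike [ang] itself. *)
Lemma ang_dh c p j : Rabs (ang c p j - dh c p j) <= 100 * (/ NN c p) ^ 3.
Proof.
  assert (hz := inv_NN c p). assert (hN := NN_ge1 c p). assert (hk := k0_bounds).
  assert (HPI := PI_bounds). destruct sqrt3_bounds as [S3 S3b].
  unfold dh, hlog. fold (ddn c p j). fold (dup c p).
  destruct (Z_le_dec (dup c p + ddn c p j) 6) as [h|h].
  - assert (k := core_NN c p j h). destruct (ang_abs c p j) as [k' _].
    assert (h2 : / 2 <= / NN c p) by (apply Rinv_le_contravar; lra).
    assert (h3 : / 8 <= (/ NN c p) ^ 3).
    { replace (/ 8) with ((/ 2) ^ 3) by field. apply pow_incr. lra. }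
    assert (L0 : ln 0 = 0) by (apply ln_nonpos; lra).
    assert (L3 : 0 <= ln 3 <= 2).
    { split; [rewrite <- ln_1; apply ln_le; lra|].
      replace 2 with (ln (exp 2)) by apply ln_exp. apply ln_le; [lra|].
      assert (q := exp_ineq1 2 ltac:(lra)). lra. }
    assert (q1 : 0 <= k0 * ln 3 <= 1 * 2).
    { split; [apply Rmult_le_pos; lra|apply Rmult_le_compat; lra]. }
    assert (Rabs (k0 / 2 * ln (IZR (ddn c p j)) - k0 / 2 * ln (IZR (dup c p))) <= 1).
    { destruct (core_or_far c p j) as [[e1 e2]|[[e1 e2]|q]]; [| |exfalso; lia]; rewrite e1, e2, L0;
        apply Rabs_le; lra. }
    eapply Rle_trans; [apply Rabs_triang|]. rewrite Rabs_Ropp. lra.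
  - destruct (far_small c p j ltac:(lia)) as [k1 [k2 [k3 k4]]].
    destruct (far_estimates c p j ltac:(lia)) as [e1 [e2 [e3 _]]].
    unfold ang. destruct (Z_le_dec _ _); [contradiction|].
    rewrite minus_IZR, minus_IZR, plus_IZR.
    set (a := IZR (dup c p)) in *. set (a' := IZR (ddn c p j)) in *.
    assert (k5 := log_ratio_cubic a a' ltac:(lra) ltac:(lra)). cbv zeta in k5. specialize (k5 k4).
    set (t := (a' - a) / (a' + a)) in *. set (y := sqrt 3 * (a' - a) / (a + a' - 6)) in *.
    set (z := / NN c p) in *. assert (k6 := atan_cubic y).
    assert (E1 : y - sqrt 3 * t = sqrt 3 * t * (6 / (a + a' - 6))) by (unfold y, t; field; lra).
    assert (B1 : Rabs (y - sqrt 3 * t) <= 48 * z ^ 3).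
    { rewrite E1, !Rabs_mult, (Rabs_pos_eq (sqrt 3)) by lra.
      assert (q : 0 <= 6 / (a + a' - 6) <= 12 * z ^ 2).
      { split; [left; apply Rdiv_lt_0_compat; lra|].
        apply Rle_trans with (12 * / (a + a')); [|lra].
        apply Rmult_le_reg_r with ((a + a' - 6) * (a + a')); [nra|].
        replace (6 / (a + a' - 6) * ((a + a' - 6) * (a + a'))) with (6 * (a + a')) by (field; lra).
        replace (12 * / (a + a') * ((a + a' - 6) * (a + a'))) with (12 * (a + a' - 6)) by (field; lra). lra. }
      rewrite (Rabs_pos_eq (6 / (a + a' - 6))) by lra.
      assert (0 <= Rabs t) by apply Rabs_pos.
      apply Rle_trans with (2 * (2 * z) * (12 * z ^ 2)); [|right; ring].
      apply Rmult_le_compat; try lra; [apply Rmult_le_pos; lra|apply Rmult_le_compat; lra]. }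
    assert (B2 : Rabs (atan y - y) <= 343 * z ^ 3).
    { eapply Rle_trans; [exact k6|]. replace (343 * z ^ 3) with ((7 * z) ^ 3) by ring.
      apply pow_incr. split; [apply Rabs_pos|exact k2]. }
    assert (B3 : Rabs (ln a' - ln a - 2 * t) <= 32 * z ^ 3).
    { eapply Rle_trans; [exact k5|]. replace (32 * z ^ 3) with (4 * (2 * z) ^ 3) by ring.
      apply Rmult_le_compat_l; [lra|]. apply pow_incr. split; [apply Rabs_pos|exact k1]. }
    assert (E : atan y / (2 * PI) - (k0 / 2 * ln a' - k0 / 2 * ln a) =
       ((atan y - y) + (y - sqrt 3 * t) - sqrt 3 / 2 * (ln a' - ln a - 2 * t)) / (2 * PI)).
    { unfold k0. field. lra. }
    rewrite E. unfold Rdiv at 1. rewrite Rabs_mult, (Rabs_pos_eq (/ (2 * PI))) by (left; apply Rinv_0_lt_compat; lra).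
    apply Rmult_le_reg_r with (2 * PI); [lra|]. rewrite Rmult_assoc, Rinv_l, Rmult_1_r by lra.
    assert (Z3 : 0 < z ^ 3) by (apply pow_lt; lra).
    assert (Rabs (atan y - y + (y - sqrt 3 * t) - sqrt 3 / 2 * (ln a' - ln a - 2 * t)) <=
      343 * z ^ 3 + 48 * z ^ 3 + 32 * z ^ 3).
    { unfold Rminus at 1. eapply Rle_trans; [apply Rabs_triang|]. rewrite Rabs_Ropp, Rabs_mult.
      rewrite (Rabs_pos_eq (sqrt 3 / 2)) by lra.
      apply Rplus_le_compat; [eapply Rle_trans; [apply Rabs_triang|]; lra|].
      assert (0 <= Rabs (ln a' - ln a - 2 * t)) by apply Rabs_pos. nra. }
    nra.
Qed.

Lemma dh_bound c p j : Rabs (dh c p j) <= 102 * / NN c p.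
Proof.
  assert (h1 := ang_bound c p j). assert (h2 := ang_dh c p j). assert (hz := inv_NN c p).
  set (z := / NN c p) in *.
  replace (dh c p j) with (ang c p j - (ang c p j - dh c p j)) by ring.
  unfold Rminus at 1. eapply Rle_trans; [apply Rabs_triang|]. rewrite Rabs_Ropp.
  assert (z ^ 3 <= z) by (replace (z ^ 3) with (z * (z * z)) by ring; nra). lra.
Qed.

(** The logarithmic potential of a unit source cut off at radius [rho]: a compactly supported test
    function whose gradient approximates [ang c]. *)
Definition pot (c : cell) (rho : R) (x : cell) : R := Rmax 0 (k0 * ln rho - hlog c x).

Lemma pot_supp c rho x : 1 <= rho -> rho <= IZR (supn (psub (fst x) (fst c))) -> pot c rho x = 0.
Proof.
  intros Hr H. assert (hk := k0_bounds). unfold pot. apply Rmax_left.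
  assert (h := dist2_supn c x). apply IZR_le in h. rewrite mult_IZR in h.
  assert (rho * rho <= IZR (dist2 c x)) by nra.
  assert (ln (rho * rho) <= ln (IZR (dist2 c x))) by (apply ln_le; nra).
  rewrite ln_mult in H1 by lra. unfold hlog. nra.
Qed.

Lemma pot_val c rho x : 1 <= rho -> (IZR (dist2 c x) <= rho * rho) ->
  pot c rho x = k0 * ln rho - hlog c x.
Proof.
  intros Hr H. assert (hk := k0_bounds). unfold pot. apply Rmax_right.
  assert (Hl : ln (IZR (dist2 c x)) <= 2 * ln rho).
  { replace (2 * ln rho) with (ln (rho * rho)) by (rewrite ln_mult; lra).
    destruct (Rle_lt_dec (IZR (dist2 c x)) 0) as [h|h].
    - assert (E : ln (IZR (dist2 c x)) = 0) by (apply ln_nonpos; exact h).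
      rewrite E, <- ln_1. apply ln_le; nra.
    - apply ln_le; assumption. }
  unfold hlog. nra.
Qed.

Lemma Rmax0_lipschitz (x y : R) : Rabs (Rmax 0 x - Rmax 0 y) <= Rabs (x - y).
Proof.
  unfold Rmax. destruct (Rle_dec 0 x), (Rle_dec 0 y); unfold Rabs;
    repeat match goal with |- context [Rcase_abs ?a] => destruct (Rcase_abs a) end; lra.
Qed.

Lemma grad_pot_bound c rho p j : Rabs (grad (pot c rho) p j) <= 102 * / NN c p.
Proof.
  unfold grad, pot. eapply Rle_trans; [apply Rmax0_lipschitz|].
  replace (k0 * ln rho - hlog c (p, true) - (k0 * ln rho - hlog c (psub p (fv j), false))) with (dh c p j)
    by (unfold dh; ring).
  apply dh_bound.
Qed.

(** Either both cells of the bond lie within the cutoff and [ang_dh] applies, or the bond is at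
    distance at least [rho / 7], as [48 < 7^2] in [dist2_upper], and both terms are of order inverse
    distance. *)
Lemma ang_pot c rho p j : 1 <= rho ->
  Rabs (ang c p j - grad (pot c rho) p j) <= 100 * (/ NN c p) ^ 3 \/
  (rho <= 7 * NN c p /\ Rabs (ang c p j - grad (pot c rho) p j) <= 104 * / NN c p).
Proof.
  intros Hr. assert (hN := NN_ge1 c p).
  destruct (Rle_dec (IZR (dup c p)) (rho * rho)) as [h1|h1]; [destruct (Rle_dec (IZR (ddn c p j)) (rho * rho)) as [h2|h2]|].
  - left. unfold grad. rewrite !pot_val by assumption.
    replace (k0 * ln rho - hlog c (p, true) - (k0 * ln rho - hlog c (psub p (fv j), false))) with (dh c p j)
      by (unfold dh; ring).
    apply ang_dh.
  - right. split.
    + assert (k := dist2_upper c p j). cbv zeta in k. destruct k as [_ k].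
      apply IZR_le in k. rewrite !mult_IZR, !plus_IZR in k. fold (NN c p) in k. nra.
    + assert (a1 := ang_bound c p j). assert (a2 := grad_pot_bound c rho p j).
      unfold Rminus. eapply Rle_trans; [apply Rabs_triang|]. rewrite Rabs_Ropp. lra.
  - right. split.
    + assert (k := dist2_upper c p j). cbv zeta in k. destruct k as [k _].
      apply IZR_le in k. rewrite !mult_IZR, !plus_IZR in k. fold (NN c p) in k. nra.
    + assert (a1 := ang_bound c p j). assert (a2 := grad_pot_bound c rho p j).
      unfold Rminus. eapply Rle_trans; [apply Rabs_triang|]. rewrite Rabs_Ropp. lra.
Qed.

(** * Energy estimates *)

Definition zw (i : Z) : R := / (1 + IZR (Z.abs i)).

Lemma zw_pos i : 0 < zw i <= 1.
Proof.
  assert (0 <= IZR (Z.abs i)) by (apply IZR_le; lia). unfold zw. split.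
  - apply Rinv_0_lt_compat; lra.
  - rewrite <- Rinv_1. apply Rinv_le_contravar; lra.
Qed.

Lemma NoDup_zrange n : NoDup (zrange n).
Proof. apply NoDup_map_inj; [intros; lia|apply seq_NoDup]. Qed.

Lemma sumR_zrange_S (f : Z -> R) n :
  sumR f (zrange (S n)) = sumR f (zrange n) + f (Z.of_nat (S n)) + f (- Z.of_nat (S n))%Z.
Proof.
  transitivity (sumR f (Z.of_nat (S n) :: (- Z.of_nat (S n))%Z :: zrange n)).
  - apply sumR_perm, NoDup_Permutation.
    + apply NoDup_zrange.
    + constructor; [intros [h|h]; [lia|apply In_zrange in h; lia]|].
      constructor; [rewrite In_zrange; lia|apply NoDup_zrange].
    + intros x. cbn [In]. rewrite !In_zrange. lia.
  - cbn [sumR]. ring.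
Qed.

Lemma zw_nat n : zw (Z.of_nat n) = / (1 + INR n) /\ zw (- Z.of_nat n)%Z = / (1 + INR n).
Proof. unfold zw. rewrite Z.abs_opp, !Z.abs_eq, <- INR_IZR_INZ by lia. auto. Qed.

Lemma sumR_zrange_0 f : sumR f (zrange 0) = f 0%Z.
Proof. unfold zrange. simpl. ring. Qed.

Lemma sum_zw2_range n : sumR (fun i => zw i ^ 2) (zrange n) <= 3 - 2 * / (1 + INR n).
Proof.
  induction n as [|n IH].
  - rewrite sumR_zrange_0. unfold zw. simpl. lra.
  - rewrite sumR_zrange_S. destruct (zw_nat (S n)) as [e1 e2]. rewrite e1, e2, S_INR.
    assert (0 <= INR n) by apply pos_INR. set (x := INR n) in *.
    assert (h : (/ (1 + (x + 1))) ^ 2 <= / (1 + x) - / (1 + (x + 1))).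
    { replace (/ (1 + x) - / (1 + (x + 1))) with (/ (1 + x) * / (1 + (x + 1))) by (field; lra).
      replace ((/ (1 + (x + 1))) ^ 2) with (/ (1 + (x + 1)) * / (1 + (x + 1))) by ring.
      apply Rmult_le_compat_r; [left; apply Rinv_0_lt_compat; lra|]. apply Rinv_le_contravar; lra. }
    lra.
Qed.

Lemma list_Z_bounded (l : list Z) : exists M, forall i, In i l -> (Z.abs i <= Z.of_nat M)%Z.
Proof.
  induction l as [|a l [M HM]]; [exists 0%nat; intros i []|].
  exists (Z.to_nat (Z.abs a) + M)%nat. intros i [e|h]; [subst; lia|specialize (HM i h); lia].
Qed.

Lemma sum_zw2 (l : list Z) (x : Z) : NoDup l -> sumR (fun i => zw (i - x) ^ 2) l <= 3.
Proof.
  intros N. rewrite <- (sumR_map (fun i => zw i ^ 2) (fun i => (i - x)%Z)).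
  destruct (list_Z_bounded (map (fun i => (i - x)%Z) l)) as [M HM].
  apply Rle_trans with (sumR (fun i => zw i ^ 2) (zrange M)).
  - apply sumR_incl.
    + apply NoDup_map_inj; [intros; lia|exact N].
    + apply NoDup_zrange.
    + intros i hi. apply In_zrange. apply HM; exact hi.
    + intros; apply pow2_ge_0.
  - assert (h := sum_zw2_range M). assert (0 <= INR M) by apply pos_INR.
    assert (0 < / (1 + INR M)) by (apply Rinv_0_lt_compat; lra). lra.
Qed.

Lemma inv_NN_le_zw c p :
  / NN c p <= zw (fst p - fst (fst c)) /\ / NN c p <= zw (snd p - snd (fst c)).
Proof.
  unfold NN, zw, supn, psub. cbn [fst snd].
  split; apply Rinv_le_contravar; try (apply Rplus_le_compat_l, IZR_le; lia);
    apply Rplus_lt_le_0_compat; try lra; apply IZR_le; lia.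
Qed.

Lemma sumR_incl_prod (f : Z -> Z -> R) (l : list pt) :
  NoDup l -> (forall i j, 0 <= f i j) ->
  sumR (fun p => f (fst p) (snd p)) l <=
  sumR (fun i => sumR (fun j => f i j) (nodup Z.eq_dec (map snd l))) (nodup Z.eq_dec (map fst l)).
Proof.
  intros N Hf.
  rewrite <- (sumR_list_prod (fun p => f (fst p) (snd p))).
  apply sumR_incl.
  - exact N.
  - apply NoDup_list_prod; apply NoDup_nodup.
  - intros [i j] h. apply in_prod_iff. rewrite !nodup_In. split.
    + apply in_map_iff. exists (i, j). auto.
    + apply in_map_iff. exists (i, j). auto.
  - intros; apply Hf.
Qed.

(** The summand is dominated by a product of two one-dimensional weights, each of total at most
    3. *)
Lemma sum_NN4_pts c (l : list pt) : NoDup l -> sumR (fun p => (/ NN c p) ^ 4) l <= 9.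
Proof.
  intros N.
  set (f := fun i j => zw (i - fst (fst c)) ^ 2 * zw (j - snd (fst c)) ^ 2).
  apply Rle_trans with (sumR (fun p => f (fst p) (snd p)) l).
  - apply sumR_le. intros p _. destruct (inv_NN_le_zw c p) as [h1 h2]. assert (hz := inv_NN c p).
    unfold f. replace ((/ NN c p) ^ 4) with ((/ NN c p) ^ 2 * (/ NN c p) ^ 2) by ring.
    apply Rmult_le_compat; try apply pow2_ge_0; apply pow_incr; lra.
  - eapply Rle_trans; [apply sumR_incl_prod; [exact N|]|].
    + intros i j. unfold f. apply Rmult_le_pos; apply pow2_ge_0.
    + unfold f.
      apply Rle_trans with (sumR (fun i => 3 * zw (i - fst (fst c)) ^ 2) (nodup Z.eq_dec (map fst l))).
      * apply sumR_le. intros i _. rewrite sumR_scal, Rmult_comm.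
        apply Rmult_le_compat_r; [apply pow2_ge_0|]. apply sum_zw2, NoDup_nodup.
      * rewrite sumR_scal. assert (h := sum_zw2 (nodup Z.eq_dec (map fst l)) (fst (fst c)) (NoDup_nodup _ _)). lra.
Qed.

Lemma bsum_le m f g : (forall p j, In p (bx m) -> (j < 3)%nat -> f p j <= g p j) -> bsum m f <= bsum m g.
Proof. intros H. apply sumR_le. intros [p j] h. apply In_bonds in h. apply H; apply h. Qed.

Lemma bsum_ext m f g : (forall p j, In p (bx m) -> (j < 3)%nat -> f p j = g p j) -> bsum m f = bsum m g.
Proof. intros H. apply sumR_ext. intros [p j] h. apply In_bonds in h. apply H; apply h. Qed.

Lemma bsum_NN4 c m : bsum m (fun p _ => (/ NN c p) ^ 4) <= 27.
Proof.
  rewrite bsum_unfold. unfold sum3.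
  rewrite (sumR_ext _ (fun p => 3 * (/ NN c p) ^ 4)) by (intros; ring).
  rewrite sumR_scal. assert (h := sum_NN4_pts c (bx m) (NoDup_bx m)). lra.
Qed.

Lemma bsum_const m k : bsum m (fun _ _ => k) = 3 * (2 * INR m + 1) ^ 2 * k.
Proof.
  rewrite bsum_unfold. unfold sum3. rewrite sumR_const.
  assert (L : length (bx m) = ((2 * m + 1) * (2 * m + 1))%nat).
  { assert (Lz : length (zrange m) = (2 * m + 1)%nat) by (unfold zrange; rewrite length_map, length_seq; reflexivity).
    rewrite <- Lz. apply (length_prod (zrange m) (zrange m)). }
  rewrite L, mult_INR, plus_INR, mult_INR. simpl. ring.
Qed.

Lemma sum_zw_range n : sumR zw (zrange n) <= 1 + 2 * ln (1 + INR n).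
Proof.
  induction n as [|n IH].
  - rewrite sumR_zrange_0. unfold zw. simpl. rewrite !Rplus_0_r, ln_1. lra.
  - rewrite sumR_zrange_S. destruct (zw_nat (S n)) as [e1 e2]. rewrite e1, e2, S_INR.
    assert (0 <= INR n) by apply pos_INR. set (x := INR n) in *.
    assert (h : / (1 + (x + 1)) <= ln (1 + (x + 1)) - ln (1 + x)); [|lra].
    assert (Hp : 0 < (1 + x) / (1 + (x + 1))) by (apply Rdiv_lt_0_compat; lra).
    assert (k := exp_ineq1_le (ln ((1 + x) / (1 + (x + 1))))). rewrite exp_ln in k by exact Hp.
    unfold Rdiv in k at 1. rewrite ln_mult in k by (try lra; apply Rinv_0_lt_compat; lra).
    rewrite ln_Rinv in k by lra.
    replace ((1 + x) / (1 + (x + 1))) with (1 - / (1 + (x + 1))) in k by (field; lra). lra.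
Qed.

Lemma ln_le_sqrt_sqrt (x : R) : 0 < x -> ln x <= 4 * sqrt (sqrt x).
Proof.
  intros Hx. set (y := sqrt (sqrt x)).
  assert (Hs : 0 < sqrt x) by (apply sqrt_lt_R0; exact Hx).
  assert (Hy : 0 < y) by (apply sqrt_lt_R0; exact Hs).
  assert (E : x = y * y * (y * y)).
  { unfold y. rewrite !sqrt_sqrt by lra. reflexivity. }
  rewrite E, !ln_mult by nra.
  assert (k := exp_ineq1_le (ln y)). rewrite exp_ln in k by exact Hy. lra.
Qed.

(** A deliberately crude bound: all that is used later is that the energy of a vortex grows more
    slowly than linearly in the size of the box. *)
Lemma bsum_NN2 m : bsum m (fun p _ => (/ NN c0 p) ^ 2) <= 1000 * (1 + sqrt (INR m)).
Proof.
  rewrite bsum_unfold. unfold sum3.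
  rewrite (sumR_ext _ (fun p => 3 * (/ NN c0 p) ^ 2)) by (intros; ring).
  rewrite sumR_scal.
  assert (H : sumR (fun p => (/ NN c0 p) ^ 2) (bx m) <= (1 + 2 * ln (1 + INR m)) ^ 2).
  { apply Rle_trans with (sumR (fun p => zw (fst p) * zw (snd p)) (bx m)).
    - apply sumR_le. intros p _. destruct (inv_NN_le_zw c0 p) as [h1 h2]. assert (hz := inv_NN c0 p).
      change (fst (fst c0)) with 0%Z in h1. change (snd (fst c0)) with 0%Z in h2.
      rewrite Z.sub_0_r in h1, h2.
      replace ((/ NN c0 p) ^ 2) with (/ NN c0 p * / NN c0 p) by ring.
      apply Rmult_le_compat; lra.
    - unfold bx. rewrite (sumR_list_prod (fun p => zw (fst p) * zw (snd p))). cbn [fst snd].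
      rewrite (sumR_ext _ (fun i => sumR zw (zrange m) * zw i)).
      + rewrite sumR_scal. replace ((1 + 2 * ln (1 + INR m)) ^ 2) with ((1 + 2 * ln (1 + INR m)) * (1 + 2 * ln (1 + INR m))) by ring.
        assert (0 <= sumR zw (zrange m)) by (apply sumR_nonneg; intros i _; assert (q := zw_pos i); lra).
        assert (k := sum_zw_range m). apply Rmult_le_compat; assumption.
      + intros i _. rewrite sumR_scal. ring. }
  assert (Hm : 0 <= INR m) by apply pos_INR.
  assert (L := ln_le_sqrt_sqrt (1 + INR m) ltac:(lra)).
  assert (L0 : 0 <= ln (1 + INR m)) by (rewrite <- ln_1; apply ln_le; lra).
  set (y := sqrt (sqrt (1 + INR m))) in *.
  assert (Ey : y * y = sqrt (1 + INR m)) by (apply sqrt_sqrt, sqrt_pos).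
  assert (Hy : 0 <= y) by apply sqrt_pos.
  assert (Hs : sqrt (1 + INR m) <= 1 + sqrt (INR m)).
  { assert (q := sqrt_pos (INR m)). apply Rsqr_incr_0_var; [|lra].
    unfold Rsqr. rewrite sqrt_sqrt by lra. assert (q' := sqrt_sqrt (INR m) Hm). nra. }
  assert ((1 + 2 * ln (1 + INR m)) ^ 2 <= (1 + 8 * y) ^ 2) by (apply pow_incr; lra).
  assert ((1 + 8 * y) ^ 2 <= 2 + 128 * (y * y)) by (assert (q := pow2_ge_0 (1 - 8 * y)); lra).
  rewrite Ey in H1. assert (q := sqrt_pos (INR m)). lra.
Qed.

(** Within the cutoff the error is cubic and its squares are summable. Near and beyond it, about
    [n^2] bonds contribute order [n^-2] each. The constants are [529984 = 104^2 * 7^2] and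
    [10000 * 27 + 75 * 529984 < 45000000]. *)
Lemma pot_error_sum c n m : (3 <= n)%nat -> (m <= 2 * n + 1)%nat ->
  bsum m (fun p j => (ang c p j - grad (pot c (INR n)) p j) ^ 2) <= 45000000.
Proof.
  intros Hn Hm.
  assert (Hn' : 3 <= INR n) by (replace 3 with (INR 3) by (simpl; ring); apply le_INR; exact Hn).
  assert (Hm' : INR m <= 2 * INR n + 1).
  { replace (2 * INR n + 1) with (INR (2 * n + 1)) by (rewrite plus_INR, mult_INR; simpl; ring).
    apply le_INR; exact Hm. }
  apply Rle_trans with (bsum m (fun p j => 10000 * (/ NN c p) ^ 4 + 529984 * / (INR n ^ 2))).
  - apply bsum_le. intros p j _ _. assert (hz := inv_NN c p). assert (hN := NN_ge1 c p).
    assert (P2 : 0 < / INR n ^ 2) by (apply Rinv_0_lt_compat; nra).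
    set (z := / NN c p) in *. set (e := ang c p j - grad (pot c (INR n)) p j).
    rewrite <- (pow2_abs e). assert (He := Rabs_pos e).
    destruct (ang_pot c (INR n) p j ltac:(lra)) as [h|[h1 h2]].
    + fold z e in h. assert (Rabs e ^ 2 <= (100 * z ^ 3) ^ 2) by (apply pow_incr; lra).
      assert (z ^ 6 <= z ^ 4).
      { replace (z ^ 6) with (z ^ 4 * (z * z)) by ring. assert (0 <= z ^ 4) by (apply pow_le; lra).
        assert (z * z <= 1 * 1) by (apply Rmult_le_compat; lra).
        rewrite <- (Rmult_1_r (z ^ 4)) at 2. apply Rmult_le_compat_l; lra. }
      replace ((100 * z ^ 3) ^ 2) with (10000 * z ^ 6) in H by ring. lra.
    + fold z e in h2. assert (Rabs e ^ 2 <= (104 * z) ^ 2) by (apply pow_incr; lra).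
      assert (hz2 : z <= 7 * / INR n).
      { unfold z. apply Rmult_le_reg_r with (NN c p); [lra|]. rewrite Rinv_l by lra.
        apply Rmult_le_reg_l with (INR n); [lra|].
        replace (INR n * (7 * / INR n * NN c p)) with (7 * NN c p) by (field; lra). lra. }
      assert (z ^ 2 <= (7 * / INR n) ^ 2) by (apply pow_incr; lra).
      replace ((7 * / INR n) ^ 2) with (49 * / INR n ^ 2) in H0 by (field; lra).
      assert (0 <= z ^ 4) by (apply pow_le; lra).
      replace ((104 * z) ^ 2) with (10816 * z ^ 2) in H by ring. lra.
  - unfold bsum. rewrite sumR_plus, sumR_scal.
    change (sumR (fun b : pt * nat => (/ NN c (fst b)) ^ 4) (bonds m)) with (bsum m (fun p _ => (/ NN c p) ^ 4)).
    change (sumR (fun _ : pt * nat => 529984 * / INR n ^ 2) (bonds m)) with (bsum m (fun _ _ => 529984 * / INR n ^ 2)).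
    rewrite bsum_const. assert (h := bsum_NN4 c m).
    assert (hm0 : 0 <= INR m) by apply pos_INR.
    assert (k : 3 * (2 * INR m + 1) ^ 2 * (529984 * / INR n ^ 2) <= 3 * (25 * INR n ^ 2) * (529984 * / INR n ^ 2)).
    { apply Rmult_le_compat_r; [apply Rmult_le_pos; [lra|left; apply Rinv_0_lt_compat; nra]|].
      apply Rmult_le_compat_l; [lra|].
      replace (25 * INR n ^ 2) with ((5 * INR n) ^ 2) by ring. apply pow_incr. lra. }
    replace (3 * (25 * INR n ^ 2) * (529984 * / INR n ^ 2)) with (75 * 529984) in k by (field; lra).
    lra.
Qed.

(** * Flows that agree far away, and the count of cores *)

Definition same_far (m : nat) (a b : flow) : Prop :=
  forall p j, (j < 3)%nat -> ~ In p (bx m) -> a p j = b p j.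

Lemma bsum_extend m n f : (m <= n)%nat ->
  (forall p j, (j < 3)%nat -> ~ In p (bx m) -> f p j = 0) -> bsum n f = bsum m f.
Proof.
  intros Hmn H. apply sumR_support; try apply NoDup_bonds.
  intros [p j] h. rewrite !In_bonds. cbn [fst snd] in *. split; intros [h1 h2]; split; auto.
  - apply NNPP. intros k. apply h. apply H; assumption.
  - apply (bx_mono m n Hmn); exact h1.
Qed.

Lemma divf_minus a b c : divf (fun p j => a p j - b p j) c = divf a c - divf b c.
Proof. unfold divf, sum3. destruct (snd c); ring. Qed.

Lemma divf_far m a b c : same_far m a b -> ~ In (fst c) (bx (S m)) -> divf a c = divf b c.
Proof.
  intros H hc. destruct c as [p []]; unfold divf, sum3; cbn [fst snd] in *.
  - rewrite !H; auto; intros k; apply hc; apply (bx_mono m); auto.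
  - assert (K : forall j, ~ In (padd p (fv j)) (bx m)).
    { intros j k. apply hc. rewrite <- (psub_padd p (fv j)). apply bx_fv; exact k. }
    rewrite !H; auto.
Qed.

(** The total outflow is fixed by the flow far away: summation by parts against the indicator of the
    box, whose gradient lives where the two flows coincide. *)
Lemma total_div m n a b : same_far m a b -> (m < n)%nat ->
  sumR (divf a) (cells n) = sumR (divf b) (cells n).
Proof.
  intros H Hn.
  set (d := fun p j => a p j - b p j).
  set (u := fun c : cell => if in_dec pt_dec (fst c) (bx n) then 1 else 0).
  assert (Hu : csupp n u) by (intros c hc; unfold u; destruct (in_dec _ _ _); [contradiction|reflexivity]).
  assert (E := sum_by_parts n (S n) d u Hu ltac:(lia)).
  assert (E0 : bsum (S n) (fun p j => d p j * grad u p j) = 0).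
  { apply sumR_0. intros [p j] h. apply In_bonds in h. cbn [fst snd] in *. destruct h as [_ hj].
    destruct (in_dec pt_dec p (bx m)) as [i|i].
    - unfold grad, u. cbn [fst].
      assert (k1 : In p (bx n)) by (apply (bx_mono m); [lia|exact i]).
      assert (k2 : In (psub p (fv j)) (bx n)) by (apply (bx_mono (S m)); [lia|apply bx_fv; exact i]).
      destruct (in_dec pt_dec p (bx n)); [|contradiction].
      destruct (in_dec pt_dec (psub p (fv j)) (bx n)); [ring|contradiction].
    - unfold d. rewrite H by assumption. ring. }
  rewrite E0 in E. apply Rminus_diag_uniq. rewrite <- sumR_minus.
  rewrite E. transitivity (sumR (fun c => u c * divf d c) (cells n)).
  - apply sumR_ext. intros c hc. apply In_cells in hc. unfold d. rewrite divf_minus. unfold u.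
    destruct (in_dec pt_dec (fst c) (bx n)); [ring|contradiction].
  - apply sumR_support; try apply NoDup_cells. intros c hc. rewrite !In_cells. split.
    + apply bx_mono; lia.
    + intros _. apply NNPP. intros k. apply hc. rewrite Hu by exact k. ring.
Qed.

Lemma sum_delta_cells c n : In c (cells n) -> sumR (delta c) (cells n) = 1.
Proof.
  intros h. apply (sumR_delta cell_dec c (fun _ => 1)); [apply NoDup_cells|exact h].
Qed.

(** Increments above [del] over all windows of width [w] would force linear growth. It matters that
    [n1] does not depend on [g]: in the application [g] depends on the leak [eps], which is chosen
    after [n1]. *)
Lemma slow_growth_step (K : R) (w n0 : nat) (del : R) : 0 < del -> 0 <= K ->
  exists n1, forall g : nat -> R,
    (forall n, (n0 <= n)%nat -> 0 <= g n <= K * (1 + sqrt (INR n))) ->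
    exists n, (n0 <= n <= n1)%nat /\ g (n + w)%nat - g n <= del.
Proof.
  intros Hd HK.
  assert (HL : exists L : nat, K / del * (1 + sqrt (INR n0) + sqrt (INR w)) + 1 <= INR L).
  { destruct (INR_unbounded (K / del * (1 + sqrt (INR n0) + sqrt (INR w)) + 1)) as [L hL].
    exists L; lra. }
  destruct HL as [L HL].
  set (M := (L * L)%nat).
  assert (Q1 := sqrt_pos (INR n0)). assert (Q2 := sqrt_pos (INR w)).
  assert (HKd : 0 <= K / del) by (apply Rmult_le_pos; [lra|left; apply Rinv_0_lt_compat; lra]).
  assert (HL1 : 1 <= INR L) by nra.
  assert (HM : K * (1 + sqrt (INR (n0 + M * w))) < INR M * del).
  { assert (Hs : sqrt (INR (n0 + M * w)) <= sqrt (INR n0) + INR L * sqrt (INR w)).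
    { apply Rsqr_incr_0_var; [|nra].
      unfold Rsqr. rewrite sqrt_sqrt by apply pos_INR. unfold M. rewrite plus_INR, !mult_INR.
      assert (k1 := sqrt_sqrt (INR n0) (pos_INR _)). assert (k2 := sqrt_sqrt (INR w) (pos_INR _)).
      replace ((sqrt (INR n0) + INR L * sqrt (INR w)) * (sqrt (INR n0) + INR L * sqrt (INR w)))
        with (sqrt (INR n0) * sqrt (INR n0) + INR L * INR L * (sqrt (INR w) * sqrt (INR w))
              + 2 * (INR L * (sqrt (INR n0) * sqrt (INR w)))) by ring.
      rewrite k1, k2. assert (0 <= INR L * (sqrt (INR n0) * sqrt (INR w))); [|lra].
      apply Rmult_le_pos; [lra|apply Rmult_le_pos; assumption]. }
    assert (Hdel : K * (1 + sqrt (INR n0) + sqrt (INR w)) + del <= INR L * del).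
    { apply Rmult_le_compat_r with (r := del) in HL; [|lra].
      replace ((K / del * (1 + sqrt (INR n0) + sqrt (INR w)) + 1) * del) with
        (K * (1 + sqrt (INR n0) + sqrt (INR w)) + del) in HL by (field; lra). exact HL. }
    apply Rle_lt_trans with (INR L * (K * (1 + sqrt (INR n0) + sqrt (INR w)))).
    - replace (INR L * (K * (1 + sqrt (INR n0) + sqrt (INR w))))
        with (K * (INR L * (1 + sqrt (INR n0)) + INR L * sqrt (INR w))) by ring.
      apply Rmult_le_compat_l; [lra|]. nra.
    - unfold M. rewrite mult_INR, Rmult_assoc. apply Rmult_lt_compat_l; lra. }
  exists (n0 + M * w)%nat. intros g Hg. apply NNPP. intros Hno.
  assert (Hstep : forall k, (k < M)%nat -> del < g (n0 + S k * w)%nat - g (n0 + k * w)%nat).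
  { intros k hk. apply Rnot_le_lt. intros hle. apply Hno. exists (n0 + k * w)%nat. split; [nia|].
    replace (n0 + k * w + w)%nat with (n0 + S k * w)%nat by lia. exact hle. }
  assert (Hsum : forall k, (k <= M)%nat -> INR k * del <= g (n0 + k * w)%nat).
  { induction k as [|k IH]; intros hk.
    - simpl. rewrite Rmult_0_l. destruct (Hg (n0 + 0)%nat ltac:(lia)). lra.
    - rewrite S_INR. specialize (IH ltac:(lia)). specialize (Hstep k ltac:(lia)). lra. }
  specialize (Hsum M (le_n M)). destruct (Hg (n0 + M * w)%nat ltac:(lia)). lra.
Qed.

(** The energy of a unit charge at [c0] in box [n]. A value is supplied by [box_gap] with an empty
    set of stars as soon as [n >= 3]. *)
Definition gval (eps : R) (n : nat) : R :=
  epsilon (inhabits 0) (fun q => box_max n eps (delta c0) q).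

Lemma spread_nil n b e1 e2 : spread n b e1 e2 [].
Proof. split; [constructor|intros q []]. Qed.

Lemma gval_spec eps n : 0 < eps <= 1 -> (3 <= n)%nat -> box_max n eps (delta c0) (gval eps n).
Proof.
  intros He Hn. unfold gval. apply epsilon_spec.
  destruct (box_gap n 0 eps true true true [] (spread_nil _ _ _ _) ltac:(lia) He) as [Q [H _]].
  exists (Q (delta c0)). apply H.
Qed.

Lemma pot_csupp n : (1 <= n)%nat -> csupp n (pot c0 (INR n)).
Proof.
  intros Hn c hc. apply pot_supp.
  - replace 1 with (INR 1) by reflexivity. apply le_INR; exact Hn.
  - rewrite INR_IZR_INZ. apply IZR_le. rewrite In_bx in hc. unfold supn, psub, c0. cbn [fst snd]. lia.
Qed.

Lemma pot_nonneg c rho x : 0 <= pot c rho x.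
Proof. unfold pot. apply Rmax_l. Qed.

Lemma pot_mono c r r' x : 1 <= r <= r' -> pot c r x <= pot c r' x.
Proof.
  intros H. unfold pot. apply Rle_max_compat_l. assert (hk := k0_bounds).
  assert (ln r <= ln r') by (apply ln_le; lra). nra.
Qed.

(** The cutoff potential [U] is a trial function for [gval]. Both the source term and the product of
    [ang c0] with its gradient equal [U c0], so the energy of [ang c0] exceeds the dual value by the
    approximation error and the leak term only. *)
Lemma ang_energy_le_gval eps n : 0 < eps <= 1 -> (3 <= n)%nat ->
  eps * sumR (fun c => pot c0 (INR n) c ^ 2) (cells n) <= 1 ->
  bsum (S n) (fun p j => ang c0 p j ^ 2) <= gval eps n + 45000001.
Proof.
  intros He Hn Hsm. destruct (gval_spec eps n He Hn) as [h _].
  assert (Hs := pot_csupp n ltac:(lia)).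
  specialize (h _ Hs). unfold box_dual in h.
  set (U := pot c0 (INR n)) in *.
  assert (E1 : sumR (fun c => delta c0 c * U c) (cells n) = U c0).
  { rewrite (sumR_ext _ (fun c => if cell_dec c0 c then U c else 0)).
    - apply (sumR_delta cell_dec c0 U); [apply NoDup_cells|]. apply In_cells. rewrite In_bx. unfold c0; cbn [fst snd]. lia.
    - intros c _. unfold delta. destruct (cell_dec c0 c); ring. }
  assert (E2 : bsum (S n) (fun p j => ang c0 p j * grad U p j) = U c0).
  { rewrite (sum_by_parts n (S n) _ _ Hs) by lia.
    rewrite (sumR_ext _ (fun c => if cell_dec c0 c then U c else 0)).
    - apply (sumR_delta cell_dec c0 U); [apply NoDup_cells|]. apply In_cells. rewrite In_bx. unfold c0; cbn [fst snd]. lia.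
    - intros c _. rewrite div_ang. unfold delta. destruct (cell_dec c0 c); ring. }
  assert (E3 := pot_error_sum c0 n (S n) Hn ltac:(lia)). fold U in E3.
  rewrite E1 in h.
  assert (E4 : bsum (S n) (fun p j => (ang c0 p j - grad U p j) ^ 2) =
     bsum (S n) (fun p j => ang c0 p j ^ 2) - 2 * bsum (S n) (fun p j => ang c0 p j * grad U p j)
     + bsum (S n) (fun p j => grad U p j ^ 2)).
  { unfold bsum. rewrite <- sumR_scal, <- sumR_minus, <- sumR_plus. apply sumR_ext. intros; ring. }
  rewrite E4, E2 in E3. lra.
Qed.

Lemma gval_growth eps n : 0 < eps <= 1 -> (3 <= n)%nat ->
  0 <= gval eps n <= 12000 * (1 + sqrt (INR n)).
Proof.
  intros He Hn. assert (H := gval_spec eps n He Hn). split.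
  - destruct H as [h _]. eapply Rle_trans; [|apply (h (fun _ => 0)); intros c _; reflexivity].
    unfold box_dual. rewrite (sumR_0 (fun c => delta c0 c * 0)) by (intros; ring).
    rewrite (sumR_0 (fun _ : cell => 0 ^ 2)) by (intros; ring).
    unfold bsum. rewrite sumR_0; [lra|]. intros; unfold grad; ring.
  - eapply Rle_trans; [apply (box_max_le_energy n eps _ _ (ang c0) ltac:(lra) H); intros c _; apply div_ang|].
    apply Rle_trans with (bsum (S n) (fun p j => 4 * (/ NN c0 p) ^ 2)).
    + apply bsum_le. intros p j _ _. rewrite <- pow2_abs. assert (k := ang_bound c0 p j).
      assert (k' := Rabs_pos (ang c0 p j)).
      replace (4 * (/ NN c0 p) ^ 2) with ((2 * / NN c0 p) ^ 2) by ring. apply pow_incr. lra.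
    + unfold bsum. rewrite sumR_scal.
      change (sumR (fun b : pt * nat => (/ NN c0 (fst b)) ^ 2) (bonds (S n))) with (bsum (S n) (fun p _ => (/ NN c0 p) ^ 2)).
      assert (k := bsum_NN2 (S n)).
      assert (sqrt (INR (S n)) <= 1 + sqrt (INR n)).
      { rewrite S_INR. assert (q := sqrt_pos (INR n)). assert (qn := pos_INR n). apply Rsqr_incr_0_var; [|lra].
        unfold Rsqr. rewrite sqrt_sqrt by lra. assert (q' := sqrt_sqrt (INR n) qn). nra. }
      assert (q := sqrt_pos (INR n)). lra.
Qed.

(** The energy of [a] is at least the minimal one for its charges [s]; by integrality this is at
    least the sum of [s c] times unit energies plus the gain on [D]. As [s] has total 1, the sum is
    nearly the unit energy at [c0], which is that of [ang c0] up to a constant. The constants do not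
    depend on [a]; only the box does. *)
Lemma core_count a m b e1 e2 D :
  same_far m a (ang c0) -> (forall c, exists k : Z, divf a c = IZR k) ->
  spread (S m) b e1 e2 D -> (forall q, In q D -> divf a q = -1) ->
  / 54 * INR (length D) <= bsum m (fun p j => a p j ^ 2 - ang c0 p j ^ 2) + 45000003.
Proof.
  intros Hfar Hint HD Hneg. set (s := divf a). set (l := S m).
  assert (Hs0 : forall c, ~ In (fst c) (bx l) -> s c = 0).
  { intros c hc. unfold s. rewrite (divf_far m a (ang c0) c Hfar hc), div_ang. unfold delta.
    destruct (cell_dec c0 c) as [e|n]; [|reflexivity]. exfalso. apply hc. rewrite <- e, In_bx. unfold c0; cbn [fst snd]; lia. }
  set (T := sumR (fun c => Rabs (s c)) (cells l)).
  assert (HT : 0 <= T) by (apply sumR_nonneg; intros; apply Rabs_pos).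
  (* The total mass [T] of the charges is not bounded beforehand, so the unit energies must agree up
     to [/ (T + 1)] in the box used. *)
  set (del := / (T + 1)). assert (Hdel : 0 < del) by (apply Rinv_0_lt_compat; lra).
  destruct (slow_growth_step 12000 (2 * l) (l + 4) del Hdel ltac:(lra)) as [n1 Hn1].
  set (nm := (n1 + l + l)%nat).
  set (W := sumR (fun c => pot c0 (INR nm) c ^ 2) (cells nm)).
  assert (HW : 0 <= W) by (apply sumR_nonneg; intros; apply pow2_ge_0).
  (* The leak is small compared with the test potential of the largest admissible box, whatever box
     is selected below. *)
  set (eps := / (W + 1)).
  assert (He : 0 < eps <= 1).
  { unfold eps. split; [apply Rinv_0_lt_compat; lra|]. rewrite <- Rinv_1. apply Rinv_le_contravar; lra. }
  destruct (Hn1 (gval eps)) as [n' [[h1 h2] h3]].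
  { intros n hn. apply gval_growth; [exact He|lia]. }
  set (n := (n' + l)%nat).
  assert (Hsm : eps * sumR (fun c => pot c0 (INR n) c ^ 2) (cells n) <= 1).
  { assert (sumR (fun c => pot c0 (INR n) c ^ 2) (cells n) <= W).
    { apply Rle_trans with (sumR (fun c => pot c0 (INR nm) c ^ 2) (cells n)).
      - apply sumR_le. intros c _. apply pow_incr. split; [apply pot_nonneg|].
        apply pot_mono. split.
        + replace 1 with (INR 1) by reflexivity. apply le_INR. unfold n; lia.
        + apply le_INR. unfold n, nm; lia.
      - apply sumR_incl; try apply NoDup_cells; [|intros; apply pow2_ge_0].
        intros c. rewrite !In_cells. apply bx_mono. unfold n, nm; lia. }
    apply Rle_trans with (eps * (W + 1)); [apply Rmult_le_compat_l; lra|]. unfold eps. right. field. lra. }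
  assert (Hang := ang_energy_le_gval eps n He ltac:(unfold n; lia) Hsm).
  destruct (box_gap n l eps b e1 e2 D HD ltac:(unfold n; lia) He) as [Q [HQ Hgap]].
  specialize (Hgap s Hint).
  assert (HE := box_max_le_energy n eps s (Q s) a ltac:(lra) (HQ s) ltac:(reflexivity)).
  assert (Hc0 : In c0 (cells n)) by (apply In_cells; rewrite In_bx; unfold c0; cbn [fst snd]; lia).
  (* Both energies lie between the values of [gval] at [n - l] and [n + l], and [n] was chosen so
     that these differ by at most [del]. *)
  assert (Hosc : forall c, In (fst c) (bx l) -> Rabs (Q (delta c) - gval eps n) <= del).
  { intros c hc.
    assert (S1 := box_max_sandwich n l eps c _ _ _ hc ltac:(unfold n; lia)
       (gval_spec eps (n - l) He ltac:(unfold n; lia)) (HQ (delta c)) (gval_spec eps (n + l) He ltac:(unfold n; lia))).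
    assert (S2 := box_max_sandwich n l eps c0 _ _ _ ltac:(rewrite In_bx; unfold c0; cbn [fst snd]; lia) ltac:(unfold n; lia)
       (gval_spec eps (n - l) He ltac:(unfold n; lia)) (gval_spec eps n He ltac:(unfold n; lia)) (gval_spec eps (n + l) He ltac:(unfold n; lia))).
    replace (n - l)%nat with n' in S1, S2 by (unfold n; lia).
    replace (n + l)%nat with (n' + 2 * l)%nat in S1, S2 by (unfold n; lia).
    apply Rabs_le. lra. }
  assert (Htot : sumR s (cells n) = 1).
  { unfold s. rewrite (total_div m n a (ang c0) Hfar ltac:(unfold n, l; lia)).
    rewrite (sumR_ext _ (delta c0)) by (intros; apply div_ang). apply sum_delta_cells; exact Hc0. }
  assert (Hlow : gval eps n - 1 <= sumR (fun c => s c * Q (delta c)) (cells n)).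
  { assert (E : sumR (fun c => s c * Q (delta c)) (cells n) =
       gval eps n * sumR s (cells n) + sumR (fun c => s c * (Q (delta c) - gval eps n)) (cells n)).
    { rewrite <- sumR_scal, <- sumR_plus. apply sumR_ext; intros; ring. }
    rewrite E, Htot.
    assert (B : - (del * T) <= sumR (fun c => s c * (Q (delta c) - gval eps n)) (cells n)).
    { assert (B1 : Rabs (sumR (fun c => s c * (Q (delta c) - gval eps n)) (cells n)) <= del * T).
      { eapply Rle_trans; [apply sumR_abs|]. unfold T. rewrite <- sumR_scal.
        rewrite (sumR_support (fun x => Rabs (s x * _)) (cells n) (cells l)).
        - apply sumR_le. intros c hc. apply In_cells in hc. rewrite Rabs_mult, Rmult_comm.
          apply Rmult_le_compat_r; [apply Rabs_pos|]. apply Hosc; exact hc.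
        - apply NoDup_cells.
        - apply NoDup_cells.
        - intros c hc. rewrite !In_cells. split.
          + intros _. apply NNPP. intros k. apply hc. rewrite Hs0 by exact k. rewrite Rmult_0_l, Rabs_R0. reflexivity.
          + apply bx_mono. unfold n; lia. }
      assert (B2 := Rle_abs (- sumR (fun c => s c * (Q (delta c) - gval eps n)) (cells n))).
      rewrite Rabs_Ropp in B2. lra. }
    assert (del * T <= 1).
    { apply Rle_trans with (del * (T + 1)); [apply Rmult_le_compat_l; lra|]. unfold del. right. field. lra. }
    lra. }
  assert (HDs : sumR (fun q => s q * (s q - 1)) D = 2 * INR (length D)).
  { rewrite (sumR_ext _ (fun _ => 2)) by (intros q hq; unfold s; rewrite Hneg by exact hq; ring).
    rewrite sumR_const. ring. }
  rewrite HDs in Hgap.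
  assert (Hb : bsum (S n) (fun p j => a p j ^ 2) - bsum (S n) (fun p j => ang c0 p j ^ 2) =
     bsum m (fun p j => a p j ^ 2 - ang c0 p j ^ 2)).
  { unfold bsum. rewrite <- sumR_minus.
    change (bsum (S n) (fun p j => a p j ^ 2 - ang c0 p j ^ 2) = bsum m (fun p j => a p j ^ 2 - ang c0 p j ^ 2)).
    apply bsum_extend; [unfold n, l; lia|]. intros p j hj hp. rewrite Hfar by assumption. ring. }
  fold s in HE. lra.
Qed.

Lemma div_support m a c : same_far m a (ang c0) -> divf a c <> 0 -> In (fst c) (bx (S m)).
Proof.
  intros Hfar h. apply NNPP. intros hc. apply h.
  rewrite (divf_far m a (ang c0) c Hfar hc), div_ang. unfold delta.
  destruct (cell_dec c0 c) as [e|n]; [|reflexivity]. exfalso. apply hc. rewrite <- e, In_bx.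
  unfold c0; cbn [fst snd]; lia.
Qed.

Definition in_class (b e1 e2 : bool) (q : cell) : bool :=
  andb (Bool.eqb (snd q) b) (andb (Bool.eqb (Z.even (fst (fst q))) e1) (Bool.eqb (Z.even (snd (fst q))) e2)).

Lemma length_classes (l : list cell) :
  length l = (length (filter (in_class true true true) l) + length (filter (in_class true true false) l)
    + length (filter (in_class true false true) l) + length (filter (in_class true false false) l)
    + length (filter (in_class false true true) l) + length (filter (in_class false true false) l)
    + length (filter (in_class false false true) l) + length (filter (in_class false false false) l))%nat.
Proof.
  induction l as [|q l IH]; [reflexivity|]. simpl. unfold in_class in *.
  destruct (snd q), (Z.even (fst (fst q))), (Z.even (snd (fst q))); simpl; lia.
Qed.

(** The cores are split into eight classes, by orientation and the two parities, to meet the spacing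
    of [core_count]; [432 = 8 * 54]. *)
Lemma negative_core_count a m l :
  same_far m a (ang c0) -> (forall c, exists k : Z, divf a c = IZR k) ->
  NoDup l -> (forall q, In q l -> divf a q = -1) ->
  INR (length l) <= 432 * (bsum m (fun p j => a p j ^ 2 - ang c0 p j ^ 2) + 45000003).
Proof.
  intros Hfar Hint N Hneg.
  assert (K : forall b e1 e2, / 54 * INR (length (filter (in_class b e1 e2) l)) <=
     bsum m (fun p j => a p j ^ 2 - ang c0 p j ^ 2) + 45000003).
  { intros b e1 e2. apply (core_count a m b e1 e2); auto.
    - split; [apply NoDup_filter; exact N|]. intros q hq. apply filter_In in hq. destruct hq as [hq hc].
      unfold in_class in hc. apply andb_prop in hc. destruct hc as [h1 hc]. apply andb_prop in hc. destruct hc as [h2 h3].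
      apply Bool.eqb_prop in h1, h2, h3. repeat split; auto.
      apply (div_support m a q Hfar). rewrite Hneg by exact hq. lra.
    - intros q hq. apply filter_In in hq. apply Hneg, hq. }
  rewrite (length_classes l), !plus_INR.
  assert (K1 := K true true true). assert (K2 := K true true false). assert (K3 := K true false true).
  assert (K4 := K true false false). assert (K5 := K false true true). assert (K6 := K false true false).
  assert (K7 := K false false true). assert (K8 := K false false false). lra.
Qed.

(** * The logarithmic interaction of vortices *)

Lemma NN_triangle c c' p l : In (fst c) (bx l) -> In (fst c') (bx l) ->
  NN c' p <= NN c p + 2 * INR l.
Proof.
  intros h h'. rewrite In_bx in h, h'.
  assert (k : (supn (psub p (fst c')) <= supn (psub p (fst c)) + 2 * Z.of_nat l)%Z)
    by (unfold supn, psub; cbn [fst snd]; lia).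
  apply IZR_le in k. rewrite plus_IZR, mult_IZR, <- INR_IZR_INZ in k. unfold NN. lra.
Qed.

Lemma pot_csupp_at c l n : In (fst c) (bx l) -> (1 <= n)%nat -> csupp (n + l) (pot c (INR n)).
Proof.
  intros hc Hn x hx. apply pot_supp.
  - replace 1 with (INR 1) by reflexivity. apply le_INR; exact Hn.
  - rewrite INR_IZR_INZ. apply IZR_le. rewrite In_bx in hx, hc. unfold supn, psub. cbn [fst snd]. lia.
Qed.

Lemma mul_cube_le (x y : R) : 0 <= x -> 0 <= y -> x * y ^ 3 <= x ^ 4 + y ^ 4.
Proof.
  intros Hx Hy. destruct (Rle_dec x y) as [h|h].
  - assert (0 <= y ^ 3) by (apply pow_le; lra). assert (0 <= x ^ 4) by (apply pow_le; lra).
    replace (y ^ 4) with (y * y ^ 3) by ring. nra.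
  - assert (y ^ 3 <= x ^ 3) by (apply pow_incr; lra). assert (0 <= y ^ 4) by (apply pow_le; lra).
    replace (x ^ 4) with (x * x ^ 3) by ring. nra.
Qed.

Lemma bsum_plus m f g : bsum m (fun p j => f p j + g p j) = bsum m f + bsum m g.
Proof. apply sumR_plus. Qed.
Lemma bsum_minus m f g : bsum m (fun p j => f p j - g p j) = bsum m f - bsum m g.
Proof. apply sumR_minus. Qed.
Lemma bsum_scal m k f : bsum m (fun p j => k * f p j) = k * bsum m f.
Proof. apply (sumR_scal k (fun b => f (fst b) (snd b))). Qed.
Lemma bsum_sumR {A : Type} m (f : A -> flow) (l : list A) :
  bsum m (fun p j => sumR (fun x => f x p j) l) = sumR (fun x => bsum m (f x)) l.
Proof. unfold bsum. rewrite (sumR_exchange (fun b x => f x (fst b) (snd b))). reflexivity. Qed.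

Lemma parts_ang c a u n m : csupp n u -> (n < m)%nat -> In c (cells m) ->
  (forall x, divf a x = delta c x) -> bsum m (fun p j => a p j * grad u p j) = u c.
Proof.
  intros Hu Hm Hc Ha. rewrite (sum_by_parts n m _ _ Hu Hm).
  rewrite (sumR_ext _ (fun x => if cell_dec c x then u x else 0)).
  - apply (sumR_delta cell_dec c u); [apply NoDup_cells|exact Hc].
  - intros x _. rewrite Ha. unfold delta. destruct (cell_dec c x); ring.
Qed.

(** With [ang c'] replaced by the gradient of its cutoff potential, summation by parts yields the
    potential at [c]. The condition [28 * l <= n] makes bonds at the cutoff of [c'] equally far from
    [c], so their [n^2] terms are of order [n^-2]. *)
Lemma ang_interaction c c' l n : In (fst c) (bx l) -> In (fst c') (bx l) ->
  (3 <= n)%nat -> (28 * l <= n)%nat ->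
  Rabs (bsum (2 * n + 1) (fun p j => ang c p j * ang c' p j) - pot c' (INR n) c) <= 2000000.
Proof.
  intros hc hc' Hn Hl. set (M := (2 * n + 1)%nat). set (U := pot c' (INR n)).
  assert (Hn' : 3 <= INR n) by (replace 3 with (INR 3) by (simpl; ring); apply le_INR; exact Hn).
  assert (Hl' : 28 * INR l <= INR n).
  { replace 28 with (INR 28) by (simpl; ring). rewrite <- mult_INR. apply le_INR; exact Hl. }
  assert (HU : csupp (n + l) U) by (apply pot_csupp_at; [exact hc'|lia]).
  assert (E : U c = bsum M (fun p j => ang c p j * grad U p j)).
  { symmetry. apply (parts_ang c (ang c) U (n + l) M HU); [unfold M; lia| |apply div_ang].
    apply In_cells. apply (bx_mono l); [unfold M; lia|exact hc]. }
  rewrite E, <- bsum_minus. unfold bsum. eapply Rle_trans; [apply sumR_abs|].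
  apply Rle_trans with (bsum M (fun p j => 200 * ((/ NN c p) ^ 4 + (/ NN c' p) ^ 4) + 20384 * / INR n ^ 2)).
  - apply (bsum_le M (fun p j => Rabs (ang c p j * ang c' p j - ang c p j * grad U p j))). intros p j _ _.
    assert (P2 : 0 < / INR n ^ 2) by (apply Rinv_0_lt_compat; nra).
    rewrite <- Rmult_minus_distr_l, Rabs_mult.
    assert (h0 := ang_bound c p j). assert (hz := inv_NN c p). assert (hz' := inv_NN c' p).
    assert (hN := NN_ge1 c p). assert (hN' := NN_ge1 c' p).
    set (e := ang c' p j - grad U p j). assert (he := Rabs_pos e). assert (ha := Rabs_pos (ang c p j)).
    destruct (ang_pot c' (INR n) p j ltac:(lra)) as [h|[h1 h2]].
    + fold U e in h.
      apply Rle_trans with ((2 * / NN c p) * (100 * (/ NN c' p) ^ 3)).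
      * apply Rmult_le_compat; assumption.
      * assert (k := mul_cube_le (/ NN c p) (/ NN c' p) ltac:(lra) ltac:(lra)). lra.
    + fold U e in h2. assert (k := NN_triangle c c' p l hc hc').
      assert (k1 : INR n <= 14 * NN c p) by lra.
      assert (z1 : / NN c p <= 14 * / INR n).
      { apply Rmult_le_reg_r with (NN c p); [lra|]. rewrite Rinv_l by lra.
        apply Rmult_le_reg_l with (INR n); [lra|].
        replace (INR n * (14 * / INR n * NN c p)) with (14 * NN c p) by (field; lra). lra. }
      assert (z2 : / NN c' p <= 7 * / INR n).
      { apply Rmult_le_reg_r with (NN c' p); [lra|]. rewrite Rinv_l by lra.
        apply Rmult_le_reg_l with (INR n); [lra|].
        replace (INR n * (7 * / INR n * NN c' p)) with (7 * NN c' p) by (field; lra). lra. }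
      apply Rle_trans with ((28 * / INR n) * (728 * / INR n)).
      * apply Rmult_le_compat; lra.
      * replace (28 * / INR n * (728 * / INR n)) with (20384 * / INR n ^ 2) by (field; lra).
        assert (0 <= (/ NN c p) ^ 4) by (apply pow_le; lra). assert (0 <= (/ NN c' p) ^ 4) by (apply pow_le; lra). lra.
  - rewrite bsum_plus, bsum_scal, bsum_plus, bsum_const.
    assert (k1 := bsum_NN4 c M). assert (k2 := bsum_NN4 c' M).
    assert (hM : INR M = 2 * INR n + 1) by (unfold M; rewrite plus_INR, mult_INR; simpl; ring).
    assert (k : 3 * (2 * INR M + 1) ^ 2 * (20384 * / INR n ^ 2) <= 3 * (25 * INR n ^ 2) * (20384 * / INR n ^ 2)).
    { apply Rmult_le_compat_r; [apply Rmult_le_pos; [lra|left; apply Rinv_0_lt_compat; nra]|].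
      apply Rmult_le_compat_l; [lra|].
      replace (25 * INR n ^ 2) with ((5 * INR n) ^ 2) by ring. apply pow_incr. lra. }
    replace (3 * (25 * INR n ^ 2) * (20384 * / INR n ^ 2)) with (75 * 20384) in k by (field; lra). lra.
Qed.

Lemma young_neg (X C K L : R) : 0 < L -> 0 <= K -> 0 <= C -> X ^ 2 <= C * K ->
  - (2 * L * C + K / (2 * L)) <= 2 * X.
Proof.
  intros HL HK HC H. set (A := 2 * L * C + K / (2 * L)).
  assert (HA : 0 <= A).
  { unfold A. apply Rplus_le_le_0_compat; [apply Rmult_le_pos; lra|].
    apply Rmult_le_pos; [lra|]. left; apply Rinv_0_lt_compat; lra. }
  assert (E : A ^ 2 = (2 * L * C - K / (2 * L)) ^ 2 + 4 * (C * K)) by (unfold A; field; lra).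
  assert (q := pow2_ge_0 (2 * L * C - K / (2 * L))).
  assert (h : Rabs (2 * X) <= A) by (apply abs_le_of_sq; [exact HA|]; rewrite E; replace ((2 * X) ^ 2) with (4 * X ^ 2) by ring; lra).
  assert (h' := Rle_abs (- (2 * X))). rewrite Rabs_Ropp in h'. lra.
Qed.

Definition vortex_sum (s : cell -> R) (l : list cell) : flow :=
  fun p j => sumR (fun c => s c * ang c p j) l.

(** The diagonal is harmless, since [ln 0] is 0. *)
Definition log_interaction (s : cell -> R) (l : list cell) : R :=
  sumR (fun c => sumR (fun c' => s c * s c' * ln (IZR (dist2 c c'))) l) l.

Lemma divf_vortex_sum s l c : divf (vortex_sum s l) c = sumR (fun x => s x * delta x c) l.
Proof.
  rewrite (sumR_ext _ (fun x => s x * divf (ang x) c)) by (intros; rewrite div_ang; reflexivity).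
  unfold divf, vortex_sum, sum3. destruct (snd c).
  - rewrite <- !sumR_plus. apply sumR_ext; intros; ring.
  - rewrite <- !sumR_plus.
    replace (- sumR (fun x => s x * ang x (padd (fst c) (fv 0)) 0 + s x * ang x (padd (fst c) (fv 1)) 1
       + s x * ang x (padd (fst c) (fv 2)) 2) l) with
      ((-1) * sumR (fun x => s x * ang x (padd (fst c) (fv 0)) 0 + s x * ang x (padd (fst c) (fv 1)) 1
       + s x * ang x (padd (fst c) (fv 2)) 2) l) by ring.
    rewrite <- sumR_scal. apply sumR_ext; intros; ring.
Qed.

Lemma list_cells_bounded (l : list cell) : exists M, forall c, In c l -> In (fst c) (bx M).
Proof.
  induction l as [|c l [M HM]]; [exists 0%nat; intros c []|].
  exists (Z.to_nat (supn (fst c)) + M)%nat. intros c' [e|h].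
  - subst c'. rewrite In_bx. unfold supn. lia.
  - apply (bx_mono M); [lia|]. apply HM; exact h.
Qed.

(** The flow is a superposition of vortices plus a divergence-free remainder. Because the total
    charge is 1, the diverging [k0 * ln n] of the superposition is that of [ang c0] and cancels; the
    remainder keeps half of its square norm after the mixed terms are absorbed. *)
Lemma log_energy a m l :
  same_far m a (ang c0) -> NoDup l -> l <> [] ->
  (forall c, Rabs (divf a c) <= 1) -> (forall c, divf a c <> 0 -> In c l) ->
  sumR (divf a) l = 1 /\
  forall k, - (k0 / 2) * log_interaction (divf a) l - 100000000 * (1 + INR (length l) ^ 2)
    + / 2 * bsum k (fun p j => (a p j - vortex_sum (divf a) l p j) ^ 2)
  <= bsum m (fun p j => a p j ^ 2 - ang c0 p j ^ 2).
Proof.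
  intros Hfar N Hne Habs Hsup. set (s := divf a) in *.
  destruct (list_cells_bounded l) as [b Hb].
  assert (Hsum : sumR s l = 1).
  { set (n := (b + m + 2)%nat).
    transitivity (sumR s (cells n)).
    - apply sumR_support; [exact N|apply NoDup_cells|]. intros c hc. rewrite In_cells. split.
      + intros h. apply (bx_mono b); [unfold n; lia|]. apply Hb; exact h.
      + intros _. apply Hsup; exact hc.
    - unfold s. rewrite (total_div m n a (ang c0) Hfar ltac:(unfold n; lia)).
      rewrite (sumR_ext _ (delta c0)) by (intros; apply div_ang). apply sum_delta_cells.
      apply In_cells. rewrite In_bx; unfold c0; cbn [fst snd]; lia. }
  split; [exact Hsum|]. intros k.
  set (L := INR (length l)).
  assert (HL : 1 <= L).
  { unfold L. replace 1 with (INR 1) by reflexivity. apply le_INR. destruct l; [congruence|simpl; lia]. }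
  assert (Hdm : exists dm : nat, forall c c', In c l -> In c' l -> (dist2 c c' <= Z.of_nat dm * Z.of_nat dm)%Z).
  { exists (12 * b + 6)%nat. intros c c' h h'. assert (q := qz_le (psub (bary c') (bary c))). fold (dist2 c c') in q.
    assert (q' : (0 <= supn (psub (bary c') (bary c)) <= Z.of_nat (6 * b + 2))%Z).
    { apply Hb in h, h'. rewrite In_bx in h, h'.
      destruct c as [[x y] t], c' as [[x' y'] t']. unfold bary, psub, supn. cbn [fst snd] in *. destruct t, t'; lia. }
    nia. }
  destruct Hdm as [dm Hdm].
  set (n := (3 + 28 * b + dm + k + m)%nat). set (M := (2 * n + 1)%nat).
  assert (Hn3 : (3 <= n)%nat) by (unfold n; lia).
  assert (Hn28 : (28 * b <= n)%nat) by (unfold n; lia).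
  assert (Hn' : 3 <= INR n) by (replace 3 with (INR 3) by (simpl; ring); apply le_INR; exact Hn3).
  assert (Hpot : forall c c', In c l -> In c' l -> pot c' (INR n) c = k0 * ln (INR n) - hlog c c').
  { intros c c' h h'. rewrite pot_val; [|lra|].
    - unfold hlog. rewrite dist2_sym. reflexivity.
    - rewrite INR_IZR_INZ, <- mult_IZR. apply IZR_le. specialize (Hdm c' c h' h). unfold n. nia. }
  set (B := vortex_sum s l). set (ka := fun p j => a p j - B p j).
  set (K := bsum M (fun p j => ka p j ^ 2)).
  assert (HK : 0 <= K) by (apply sumR_nonneg; intros; apply pow2_ge_0).
  assert (Hdiv : forall c, divf ka c = 0).
  { intros c. unfold ka. rewrite divf_minus. unfold B. rewrite divf_vortex_sum. fold s.
    destruct (in_dec cell_dec c l) as [i|i].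
    - rewrite (sumR_ext _ (fun x => if cell_dec c x then s x else 0)).
      + rewrite (sumR_delta cell_dec c s) by assumption. ring.
      + intros x _. unfold delta. destruct (cell_dec x c), (cell_dec c x); subst; try congruence; ring.
    - rewrite sumR_0.
      + destruct (Req_dec (s c) 0) as [e|ne]; [rewrite e; ring|]. exfalso. apply i, Hsup, ne.
      + intros x hx. unfold delta. destruct (cell_dec x c); [congruence|ring]. }
  (* A divergence-free flow is orthogonal to gradients, so it only meets the part of [ang c] that is
     not the gradient of the cutoff potential, of bounded energy. *)
  assert (HX : forall c, In c l -> (bsum M (fun p j => ang c p j * ka p j)) ^ 2 <= 45000000 * K).
  { intros c hc. set (U := pot c (INR n)).
    assert (HU : csupp (n + b) U) by (apply pot_csupp_at; [apply Hb; exact hc|lia]).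
    assert (E0 : bsum M (fun p j => ka p j * grad U p j) = 0).
    { rewrite (sum_by_parts (n + b) M _ _ HU) by (unfold M; lia). apply sumR_0. intros x _. rewrite Hdiv. ring. }
    assert (E1 : bsum M (fun p j => ang c p j * ka p j) = bsum M (fun p j => (ang c p j - grad U p j) * ka p j)).
    { rewrite (bsum_ext M (fun p j => (ang c p j - grad U p j) * ka p j)
        (fun p j => ang c p j * ka p j - ka p j * grad U p j)) by (intros; ring).
      rewrite bsum_minus, E0. ring. }
    rewrite E1. unfold bsum at 1.
    eapply Rle_trans; [apply (sumR_CS (fun x => ang c (fst x) (snd x) - grad U (fst x) (snd x)) (fun x => ka (fst x) (snd x)))|].
    apply Rmult_le_compat_r; [exact HK|].
    apply (pot_error_sum c n M Hn3). unfold M; lia. }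
  assert (EB : bsum M (fun p j => a p j ^ 2) =
     bsum M (fun p j => B p j * B p j) + sumR (fun c => 2 * (s c * bsum M (fun p j => ang c p j * ka p j))) l + K).
  { rewrite sumR_scal.
    assert (E2 : sumR (fun c => s c * bsum M (fun p j => ang c p j * ka p j)) l = bsum M (fun p j => B p j * ka p j)).
    { rewrite (bsum_ext M (fun p j => B p j * ka p j) (fun p j => sumR (fun c => s c * (ang c p j * ka p j)) l)).
      - rewrite (bsum_sumR M (fun c p j => s c * (ang c p j * ka p j))). apply sumR_ext. intros c _. symmetry. apply bsum_scal.
      - intros p j _ _. unfold B, vortex_sum. rewrite Rmult_comm, <- sumR_scal. apply sumR_ext; intros; ring. }
    rewrite E2. unfold K. rewrite <- bsum_scal, <- !bsum_plus. apply bsum_ext. intros p j _ _. unfold ka. ring. }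
  assert (HB2 : k0 * ln (INR n) - k0 / 2 * log_interaction s l - 2000000 * L ^ 2 <= bsum M (fun p j => B p j * B p j)).
  { assert (E3 : bsum M (fun p j => B p j * B p j) =
       sumR (fun c => sumR (fun c' => s c * s c' * bsum M (fun p j => ang c p j * ang c' p j)) l) l).
    { rewrite (bsum_ext M _ (fun p j => sumR (fun c => sumR (fun c' => s c * s c' * (ang c p j * ang c' p j)) l) l)).
      - rewrite (bsum_sumR M (fun c p j => sumR (fun c' => s c * s c' * (ang c p j * ang c' p j)) l)). apply sumR_ext. intros c _.
        rewrite (bsum_sumR M (fun c' p j => s c * s c' * (ang c p j * ang c' p j))). apply sumR_ext. intros c' _.
        apply bsum_scal.
      - intros p j _ _. unfold B, vortex_sum. rewrite <- sumR_scal. apply sumR_ext. intros c _.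
        rewrite Rmult_comm, <- sumR_scal. apply sumR_ext. intros c' _. ring. }
    rewrite E3.
    assert (E4 : k0 * ln (INR n) - k0 / 2 * log_interaction s l - 2000000 * L ^ 2 =
       sumR (fun c => sumR (fun c' => s c * s c' * (k0 * ln (INR n) - hlog c c') - 2000000) l) l).
    { rewrite (sumR_ext (fun c => sumR (fun c' => s c * s c' * (k0 * ln (INR n) - hlog c c') - 2000000) l)
         (fun c => k0 * ln (INR n) * s c - k0 / 2 * sumR (fun c' => s c * s c' * ln (IZR (dist2 c c'))) l - L * 2000000)).
      - rewrite !sumR_minus, !sumR_scal, Hsum, sumR_const. fold L. unfold log_interaction. ring.
      - intros c _. rewrite sumR_minus, sumR_const. fold L. f_equal. rewrite <- sumR_scal.
        replace (k0 * ln (INR n) * s c) with (k0 * ln (INR n) * s c * sumR s l) by (rewrite Hsum; ring).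
        rewrite <- sumR_scal, <- sumR_minus. apply sumR_ext. intros c' _. unfold hlog. ring. }
    rewrite E4. apply sumR_le. intros c hc. apply sumR_le. intros c' hc'.
    assert (q := ang_interaction c c' b n (Hb c hc) (Hb c' hc') Hn3 Hn28). fold M in q. rewrite Hpot in q by assumption.
    set (x := bsum M (fun p j => ang c p j * ang c' p j)) in *. set (y := k0 * ln (INR n) - hlog c c') in *.
    assert (q1 : Rabs (s c * s c') <= 1).
    { rewrite Rabs_mult. assert (t1 := Habs c). assert (t2 := Habs c'). assert (t3 := Rabs_pos (s c)). assert (t4 := Rabs_pos (s c')). nra. }
    assert (q2 : Rabs (s c * s c' * (x - y)) <= 2000000).
    { rewrite Rabs_mult. assert (t1 := Rabs_pos (s c * s c')). assert (t2 := Rabs_pos (x - y)). nra. }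
    assert (q3 := Rle_abs (- (s c * s c' * (x - y)))). rewrite Rabs_Ropp in q3. lra. }
  assert (HA : bsum M (fun p j => ang c0 p j ^ 2) <= k0 * ln (INR n) + 2000000).
  { assert (q := ang_interaction c0 c0 b n). fold M in q.
    assert (hc0 : In (fst c0) (bx b)) by (rewrite In_bx; unfold c0; cbn [fst snd]; lia).
    specialize (q hc0 hc0 Hn3 Hn28). rewrite pot_val in q; [|lra|rewrite dist2_refl; nra].
    unfold hlog in q. rewrite dist2_refl, (ln_nonpos 0) in q by lra.
    rewrite (bsum_ext M _ (fun p j => ang c0 p j * ang c0 p j)) by (intros; ring).
    assert (q3 := Rle_abs (bsum M (fun p j => ang c0 p j * ang c0 p j) - (k0 * ln (INR n) - k0 / 2 * 0))). lra. }
  (* The Young parameter is the number of cores [L]: each term uses [K / (2 * L)], all of them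
     together [K / 2]. *)
  assert (HY : - (90000000 * L ^ 2 + K / 2) <= sumR (fun c => 2 * (s c * bsum M (fun p j => ang c p j * ka p j))) l).
  { replace (- (90000000 * L ^ 2 + K / 2)) with (sumR (fun _ : cell => - (2 * L * 45000000 + K / (2 * L))) l).
    - apply sumR_le. intros c hc. apply young_neg; try lra.
      specialize (HX c hc). set (X := bsum M (fun p j => ang c p j * ka p j)) in *.
      assert (q1 : s c ^ 2 <= 1).
      { rewrite <- pow2_abs. assert (t1 := Habs c). assert (t3 := Rabs_pos (s c)). nra. }
      replace ((s c * X) ^ 2) with (s c ^ 2 * X ^ 2) by ring. assert (q2 : 0 <= X ^ 2) by apply pow2_ge_0.
      apply Rle_trans with (1 * X ^ 2); [apply Rmult_le_compat_r; assumption|lra].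
    - rewrite sumR_const. fold L. field. lra. }
  assert (EM : bsum m (fun p j => a p j ^ 2 - ang c0 p j ^ 2) =
     bsum M (fun p j => a p j ^ 2) - bsum M (fun p j => ang c0 p j ^ 2)).
  { rewrite <- bsum_minus. symmetry. apply bsum_extend; [unfold M, n; lia|].
    intros p j hj hp. rewrite Hfar by assumption. ring. }
  assert (EK : bsum k (fun p j => ka p j ^ 2) <= K).
  { apply sumR_incl; try apply NoDup_bonds; [|intros; apply pow2_ge_0].
    intros [p j]. rewrite !In_bonds. cbn [fst snd]. intros [h1 h2]. split; [|exact h2].
    apply (bx_mono k); [unfold M, n; lia|exact h1]. }
  rewrite EM, EB. unfold ka in EK. assert (hL2 := pow2_ge_0 L). lra.
Qed.

(** * The pair potential *)

Lemma psi_period_Z (psi : R -> R) : (forall x, psi (x + 1) = psi x) ->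
  forall (k : Z) x, psi (x + IZR k) = psi x.
Proof.
  intros H.
  assert (Hn : forall (n : nat) x, psi (x + INR n) = psi x).
  { induction n as [|n IH]; intros x.
    - simpl. rewrite Rplus_0_r. reflexivity.
    - rewrite S_INR, <- Rplus_assoc, H. apply IH. }
  intros k x. destruct (Z_le_dec 0 k) as [h|h].
  - replace (IZR k) with (INR (Z.to_nat k)); [apply Hn|]. rewrite INR_IZR_INZ, Z2Nat.id by lia. reflexivity.
  - rewrite <- (Hn (Z.to_nat (- k)) (x + IZR k)). f_equal.
    rewrite INR_IZR_INZ, Z2Nat.id by lia. rewrite opp_IZR. ring.
Qed.

Lemma psi_eq_mod (psi : R -> R) : (forall x, psi (x + 1) = psi x) ->
  forall x y, (exists k : Z, x - y = IZR k) -> psi x = psi y.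
Proof.
  intros H x y [k hk]. replace x with (y + IZR k) by lra. apply psi_period_Z; exact H.
Qed.

Lemma near_zero_not_half_int x : Rabs x < / 2 -> not_half_int x.
Proof.
  intros h k e. rewrite e in h. replace (IZR k + / 2) with (IZR (2 * k + 1) / 2) in h
    by (rewrite plus_IZR, mult_IZR; field).
  assert (h1 : Rabs (IZR (2 * k + 1)) < 1).
  { unfold Rdiv in h. rewrite Rabs_mult, (Rabs_pos_eq (/ 2)) in h by lra. lra. }
  rewrite Rabs_Zabs in h1. apply (lt_IZR _ 1) in h1. lia.
Qed.

(** Near 0 this is Taylor's formula: evenness removes the odd derivatives and the fourth is locally
    bounded. Away from 0 the quartic term dominates the maximum of [psi], which covers the points
    1/2 and -1/2, where [psi] need not be smooth. *)
Lemma psi_upper (psi : R -> R) : psi_assumptions psi ->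
  exists C, 0 <= C /\ forall x, Rabs x <= / 2 ->
    psi x <= / 2 * Derive_n psi 2 0 * x ^ 2 + C * x ^ 4.
Proof.
  intros [[Hc Hreg] [Hper [Hev [_ [Hz [Hmu _]]]]]].
  set (mu := Derive_n psi 2 0) in *.
  assert (Hloc : locally (- 0) (fun y => forall k, (k <= 3)%nat -> ex_derive_n psi k y)).
  { exists (mkposreal (/ 2) ltac:(lra)). intros y hy k hk.
    assert (A : forall z : R, Rabs (z + - - 0) < / 2 -> Rabs z < / 2).
    { intros z h. replace (z + - - 0) with z in h by ring. exact h. }
    assert (hy' : Rabs y < / 2) by (apply A; exact hy).
    apply (Hreg y (near_zero_not_half_int y hy')). lia. }
  assert (Hodd : forall n, (n <= 3)%nat -> Derive_n psi n 0 = (-1) ^ n * Derive_n psi n 0).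
  { intros n hn.
    transitivity (Derive_n (fun y => psi (- y)) n 0); [apply Derive_n_ext; intros t; symmetry; apply Hev|].
    rewrite Derive_n_comp_opp; [rewrite Ropp_0; reflexivity|].
    apply filter_imp with (2 := Hloc). intros y h k hk. apply h. lia. }
  assert (D1 : Derive_n psi 1 0 = 0) by (assert (h := Hodd 1%nat ltac:(lia)); lra).
  assert (D3 : Derive_n psi 3 0 = 0) by (assert (h := Hodd 3%nat ltac:(lia)); lra).
  assert (P0 : psi 0 = 0) by (apply Hz; exists 0%Z; reflexivity).
  assert (H4 : exists d, 0 < d < / 2 /\ forall x, 0 <= x < d -> Derive_n psi 4 x <= Rabs (Derive_n psi 4 0) + 1).
  { destruct (Hreg 0 (near_zero_not_half_int 0 ltac:(rewrite Rabs_R0; lra))) as [_ hc].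
    assert (hc' : continuity_pt (Derive_n psi 4) 0) by (apply continuity_pt_filterlim; exact hc).
    destruct (hc' 1 ltac:(lra)) as [d [hd h]].
    exists (Rmin d (/ 4)). split.
    - split; [apply Rmin_glb_lt; lra|]. eapply Rle_lt_trans; [apply Rmin_r|lra].
    - intros x hx. destruct (Req_dec x 0) as [e|ne].
      + rewrite e. assert (k := Rle_abs (Derive_n psi 4 0)). lra.
      + assert (k : Rabs (Derive_n psi 4 x - Derive_n psi 4 0) < 1).
        { apply h. split; [split; [exact I|lra]|]. simpl. unfold R_dist. rewrite Rminus_0_r, Rabs_pos_eq by lra.
          eapply Rlt_le_trans; [apply hx|apply Rmin_l]. }
        apply Rabs_def2 in k. assert (k' := Rle_abs (Derive_n psi 4 0)). lra. }
  destruct H4 as [d [hd H4]].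
  destruct (continuity_ab_maj psi 0 (/ 2) ltac:(lra)) as [xm [Hmax _]].
  { intros c _. apply continuity_pt_filterlim. apply Hc. }
  set (M := Rabs (psi xm)). set (C1 := Rabs (Derive_n psi 4 0) + 1).
  assert (HM : 0 <= M) by apply Rabs_pos.
  assert (HC1 : 0 <= C1) by (unfold C1; assert (q := Rabs_pos (Derive_n psi 4 0)); lra).
  assert (d4 : 0 < d ^ 4) by (apply pow_lt; lra).
  exists (C1 + M / d ^ 4). assert (HMd : 0 <= M / d ^ 4) by (apply Rmult_le_pos; [lra|left; apply Rinv_0_lt_compat; lra]).
  split; [lra|].
  assert (Main : forall x, 0 <= x <= / 2 -> psi x <= / 2 * mu * x ^ 2 + (C1 + M / d ^ 4) * x ^ 4).
  { intros x hx. assert (x4 : 0 <= x ^ 4) by (apply pow_le; lra). assert (x2 : 0 <= x ^ 2) by (apply pow_le; lra).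
    destruct (Rle_lt_dec d x) as [hdx|hdx].
    - assert (psi x <= M) by (unfold M; eapply Rle_trans; [apply Hmax; lra|apply Rle_abs]).
      assert (M <= M / d ^ 4 * x ^ 4).
      { replace M with (M / d ^ 4 * d ^ 4) at 1 by (field; lra). apply Rmult_le_compat_l; [exact HMd|].
        apply pow_incr. lra. }
      assert (0 <= / 2 * mu * x ^ 2) by (apply Rmult_le_pos; lra).
      assert (0 <= C1 * x ^ 4) by (apply Rmult_le_pos; lra). lra.
    - destruct (Rle_lt_or_eq_dec 0 x ltac:(lra)) as [h|h].
      + destruct (Taylor_Lagrange psi 3 0 x h) as [zeta [hz e]].
        { intros t ht k hk. apply (Hreg t); [|lia]. apply near_zero_not_half_int. rewrite Rabs_pos_eq; lra. }
        rewrite e. cbn [sum_f_R0]. rewrite Rminus_0_r, D1, D3.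
        change (Derive_n psi 0 0) with (psi 0). rewrite P0. fold mu.
        assert (hz4 := H4 zeta ltac:(lra)). fold C1 in hz4.
        replace (INR (Factorial.fact 2)) with 2 by (simpl; ring).
        replace (INR (Factorial.fact 4)) with 24 by (simpl; ring).
        assert (x ^ 4 / 24 * Derive_n psi 4 zeta <= x ^ 4 / 24 * C1) by (apply Rmult_le_compat_l; [lra|exact hz4]).
        assert (0 <= C1 * x ^ 4) by (apply Rmult_le_pos; lra).
        assert (0 <= M / d ^ 4 * x ^ 4) by (apply Rmult_le_pos; lra). lra.
      + rewrite <- h, P0. lra. }
  intros x hx. destruct (Rle_dec 0 x) as [h|h].
  - rewrite Rabs_pos_eq in hx by exact h. apply Main. lra.
  - rewrite Rabs_left in hx by lra. rewrite <- Hev.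
    replace (x ^ 2) with ((- x) ^ 2) by ring. replace (x ^ 4) with ((- x) ^ 4) by ring. apply Main. lra.
Qed.

(** * Lifts and comparison with the quadratic energy *)

Definition nearest (x : R) : R := x - IZR (up (x - / 2)).

Lemma nearest_spec x : Rabs (nearest x) <= / 2 /\ exists k : Z, x - nearest x = IZR k.
Proof.
  unfold nearest. destruct (archimed (x - / 2)) as [h1 h2]. split.
  - apply Rabs_le. lra.
  - exists (up (x - / 2)). ring.
Qed.

Definition dlat (y : pt -> R) : flow := fun p j => y (dst p j) - y (src p j).
Definition yhat : pt -> R := yarg c0.

(* Each unordered bond is counted once. *)
Definition energy (psi : R -> R) (m : nat) (u : pt -> R) : R :=
  bsum m (fun p j => psi (dlat yhat p j + dlat u p j) - psi (dlat yhat p j)).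

Definition fin_grad (m : nat) (u : pt -> R) : Prop := same_far m (dlat u) (fun _ _ => 0).

Definition lift_of (y : pt -> R) (a : flow) : Prop :=
  forall p j, (j < 3)%nat -> Rabs (a p j) <= / 2 /\ exists k : Z, dlat y p j - a p j = IZR k.

Lemma lift_div_int y a : lift_of y a -> forall c, exists k : Z, divf a c = IZR k.
Proof. intros H. apply (div_int y). intros p j hj. apply H; exact hj. Qed.

Lemma lift_div_abs y a : lift_of y a -> forall c, Rabs (divf a c) <= 1.
Proof.
  intros H c. destruct (lift_div_int y a H c) as [k hk].
  assert (B : Rabs (divf a c) < 2).
  { assert (E3 : forall x y z, Rabs x <= / 2 -> Rabs y <= / 2 -> Rabs z <= / 2 -> Rabs (x + y + z) < 2).
    { intros x y0 z h1 h2 h3. eapply Rle_lt_trans; [apply Rabs_triang|]. assert (q := Rabs_triang x y0). lra. }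
    destruct c as [p []]; unfold divf, sum3; cbn [fst snd]; [|rewrite Rabs_Ropp]; apply E3; apply H; lia. }
  rewrite hk, Rabs_Zabs in B |- *. apply (lt_IZR _ 2) in B. apply (IZR_le _ 1). lia.
Qed.

(** The parabola bounds [psi] from below at the lift [a]; at the vortex [psi] exceeds it by a
    quartic term, summable since [ang] is at most [2 / NN]. Here [432 = 16 * 27]. *)
Lemma energy_lower (psi : R -> R) : psi_assumptions psi ->
  exists C, 0 <= C /\ forall m u, fin_grad m u -> exists a,
    same_far m a (ang c0) /\ lift_of (fun q => yhat q + u q) a /\
    Derive_n psi 2 0 / 2 * bsum m (fun p j => a p j ^ 2 - ang c0 p j ^ 2) <= energy psi m u + C.
Proof.
  intros Hpsi. destruct (psi_upper psi Hpsi) as [C [HC Hup]].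
  destruct Hpsi as [_ [Hper [_ [_ [_ [Hmu Hlow]]]]]]. set (mu := Derive_n psi 2 0) in *.
  exists (C * 432). split; [lra|]. intros m u Hu.
  (* Where [u] does not vary the lift of the vortex is kept, so that [a] agrees with [ang c0] far
     away; rounding alone could choose the other sign at a half-integer. *)
  set (a := fun p j => if Req_EM_T (dlat u p j) 0 then ang c0 p j else nearest (dlat yhat p j + dlat u p j)).
  assert (Hl : forall p j, Rabs (a p j) <= / 2 /\ exists k : Z, dlat yhat p j + dlat u p j - a p j = IZR k).
  { intros p j. unfold a. destruct (Req_EM_T (dlat u p j) 0) as [e|n].
    - destruct (ang_abs c0 p j) as [h _]. split; [lra|]. rewrite e, Rplus_0_r. apply ang_int.
    - apply nearest_spec. }
  exists a. split; [|split].
  - intros p j hj hp. unfold a. destruct (Req_EM_T (dlat u p j) 0) as [e|n]; [reflexivity|].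
    exfalso. apply n. apply Hu; assumption.
  - intros p j hj. destruct (Hl p j) as [h1 [k hk]]. split; [exact h1|]. exists k. rewrite <- hk. unfold dlat. ring.
  - assert (K : mu / 2 * bsum m (fun p j => a p j ^ 2 - ang c0 p j ^ 2) - bsum m (fun p j => C * (16 * (/ NN c0 p) ^ 4))
       <= energy psi m u).
    { rewrite <- bsum_scal, <- bsum_minus. unfold energy. apply bsum_le. intros p j _ _.
      destruct (Hl p j) as [h1 h2].
      rewrite (psi_eq_mod psi Hper _ _ h2).
      rewrite (psi_eq_mod psi Hper (dlat yhat p j) (ang c0 p j) (ang_int c0 p j)).
      assert (q1 : psi (a p j) >= / 2 * mu * a p j ^ 2) by (apply Hlow; apply Rabs_le_between in h1; lra).
      destruct (ang_abs c0 p j) as [h3 _]. assert (q2 := Hup (ang c0 p j) ltac:(lra)).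
      assert (q3 : ang c0 p j ^ 4 <= 16 * (/ NN c0 p) ^ 4).
      { replace (ang c0 p j ^ 4) with (Rabs (ang c0 p j) ^ 4)
          by (replace (Rabs (ang c0 p j) ^ 4) with ((Rabs (ang c0 p j) ^ 2) ^ 2) by ring; rewrite pow2_abs; ring).
        replace (16 * (/ NN c0 p) ^ 4) with ((2 * / NN c0 p) ^ 4) by ring.
        apply pow_incr. split; [apply Rabs_pos|apply ang_bound]. }
      assert (C * ang c0 p j ^ 4 <= C * (16 * (/ NN c0 p) ^ 4)) by (apply Rmult_le_compat_l; assumption).
      lra. }
    rewrite !bsum_scal in K. assert (q := bsum_NN4 c0 m).
    assert (C * (16 * bsum m (fun p _ => (/ NN c0 p) ^ 4)) <= C * 432) by (apply Rmult_le_compat_l; lra). lra.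
Qed.

(** * Clusters of charges *)

Notation item := (R * cell)%type (only parsing).
(** Positions may repeat, because clusters are formed by moving charges onto each other. With the
    kernel [delta] this is the sum over positions of the squared total charge. *)
Definition dsum (g : cell -> cell -> R) (l : list item) : R :=
  sumR (fun x => sumR (fun y => fst x * fst y * g (snd x) (snd y)) l) l.
Definition lg (c c' : cell) : R := ln (IZR (dist2 c c')).
Definition total (l : list item) : R := sumR fst l.
Definition charge_at (l : list item) (c : cell) : R := sumR (fun x : item => fst x * delta c (snd x)) l.
Definition integral (l : list item) : Prop := forall x, In x l -> exists k : Z, fst x = IZR k.
Definition mass (l : list item) : R := sumR (fun x : item => Rabs (fst x)) l.

Lemma delta_sym c c' : delta c c' = delta c' c.
Proof. unfold delta. destruct (cell_dec c c'), (cell_dec c' c); congruence. Qed.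

Lemma lg_sym c c' : lg c c' = lg c' c.
Proof. unfold lg. rewrite dist2_sym. reflexivity. Qed.

Lemma lg_refl c : lg c c = 0.
Proof. unfold lg. rewrite dist2_refl. apply ln_nonpos. lra. Qed.

Lemma dist2_pos c c' : c <> c' -> (1 <= dist2 c c')%Z.
Proof.
  intros H. assert (h := dist2_nonneg c c'). destruct (Z.eq_dec (dist2 c c') 0) as [e|n]; [|lia].
  apply dist2_zero in e. congruence.
Qed.

Lemma dsum_cons g x l : (forall c c', g c c' = g c' c) ->
  dsum g (x :: l) = fst x ^ 2 * g (snd x) (snd x)
    + 2 * fst x * sumR (fun y => fst y * g (snd x) (snd y)) l + dsum g l.
Proof.
  intros Hg. unfold dsum. cbn [sumR].
  rewrite (sumR_ext (fun x0 => fst x0 * fst x * g (snd x0) (snd x) + sumR (fun y => fst x0 * fst y * g (snd x0) (snd y)) l)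
    (fun x0 => fst x * (fst x0 * g (snd x) (snd x0)) + sumR (fun y => fst x0 * fst y * g (snd x0) (snd y)) l))
    by (intros y _; rewrite (Hg (snd y) (snd x)); ring).
  rewrite sumR_plus, sumR_scal.
  rewrite (sumR_ext (fun y => fst x * fst y * g (snd x) (snd y)) (fun y => fst x * (fst y * g (snd x) (snd y)))) by (intros; ring).
  rewrite sumR_scal. ring.
Qed.

Lemma dsum_perm g l l' : Permutation l l' -> dsum g l = dsum g l'.
Proof.
  intros H. unfold dsum. rewrite (sumR_perm _ _ _ H). apply sumR_ext. intros x _. apply sumR_perm; exact H.
Qed.

Lemma argmin_Z {A : Type} (f : A -> Z) (l : list A) : l <> [] ->
  exists a, In a l /\ forall b, In b l -> (f a <= f b)%Z.
Proof.
  induction l as [|a l IH]; [congruence|]. intros _. destruct l as [|b l].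
  - exists a. split; [left; reflexivity|]. intros b [e|[]]; subst; lia.
  - destruct IH as [c [hc h]]; [discriminate|]. destruct (Z_le_dec (f a) (f c)) as [k|k].
    + exists a. split; [left; reflexivity|]. intros d [e|hd]; [subst; lia|]. specialize (h d hd). lia.
    + exists c. split; [right; exact hc|]. intros d [e|hd]; [subst; lia|]. apply h; exact hd.
Qed.

Lemma perm_two {A : Type} (l : list A) (x y : A) : In x l -> In y l -> x <> y ->
  exists l', Permutation l (x :: y :: l').
Proof.
  intros hx hy n. apply in_split in hx. destruct hx as [l1 [l2 e]]. subst l.
  assert (hy' : In y (l1 ++ l2)).
  { apply in_app_or in hy. apply in_or_app. destruct hy as [h|[h|h]]; [left; exact h|congruence|right; exact h]. }
  apply in_split in hy'. destruct hy' as [l3 [l4 e]].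
  exists (l3 ++ l4). transitivity (x :: l1 ++ l2); [symmetry; apply Permutation_middle|].
  constructor. rewrite e. symmetry. apply Permutation_middle.
Qed.

Lemma not_NoDup_map {A B : Type} (f : A -> B) (l : list A) : ~ NoDup (map f l) ->
  exists x y l', Permutation l (x :: y :: l') /\ f x = f y.
Proof.
  induction l as [|a l IH]; intros H.
  - exfalso. apply H. constructor.
  - destruct (classic (In (f a) (map f l))) as [h|h].
    + apply in_map_iff in h. destruct h as [y [e hy]]. apply in_split in hy. destruct hy as [l1 [l2 e']]. subst l.
      exists a, y, (l1 ++ l2). split; [|congruence]. constructor. symmetry. apply Permutation_middle.
    + destruct IH as [x [y [l' [hp e]]]].
      { intros k. apply H. simpl. constructor; assumption. }
      exists x, y, (a :: l'). split; [|exact e].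
      transitivity (a :: x :: y :: l'); [constructor; exact hp|].
      transitivity (x :: a :: y :: l'); constructor. constructor.
Qed.

Lemma closest_pair (l : list item) : NoDup (map snd l) -> (2 <= length l)%nat ->
  exists x y l', Permutation l (x :: y :: l') /\ snd x <> snd y /\
    forall u v, In u l -> In v l -> snd u <> snd v -> (dist2 (snd x) (snd y) <= dist2 (snd u) (snd v))%Z.
Proof.
  intros N Hl.
  set (P := filter (fun z : item * item => if cell_dec (snd (fst z)) (snd (snd z)) then false else true) (list_prod l l)).
  assert (HP : forall u v, In (u, v) P <-> In u l /\ In v l /\ snd u <> snd v).
  { intros u v. unfold P. rewrite filter_In, in_prod_iff. cbn [fst snd].
    destruct (cell_dec (snd u) (snd v)); intuition congruence. }
  assert (Pne : P <> []).
  { destruct l as [|a [|b l]]; simpl in Hl; try lia. intros e.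
    assert (h : In (a, b) P); [|rewrite e in h; destruct h].
    apply HP. split; [left; reflexivity|split; [right; left; reflexivity|]].
    inversion_clear N as [|? ? h _]. intros k. apply h. left. symmetry; exact k. }
  destruct (argmin_Z (fun z : item * item => dist2 (snd (fst z)) (snd (snd z))) P Pne) as [[x y] [hxy hmin]].
  apply HP in hxy. destruct hxy as [hx [hy n]].
  destruct (perm_two l x y hx hy ltac:(congruence)) as [l' hp].
  exists x, y, l'. split; [exact hp|split; [exact n|]]. intros u v hu hv huv.
  apply (hmin (u, v)). apply HP. auto.
Qed.

Lemma mass_nonneg l : 0 <= mass l.
Proof. apply sumR_nonneg. intros; apply Rabs_pos. Qed.

Lemma lg_nonneg c c' : 0 <= lg c c'.
Proof.
  destruct (cell_dec c c') as [e|n]; [subst; rewrite lg_refl; lra|].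
  unfold lg. rewrite <- ln_1. apply ln_le; [lra|]. apply IZR_le, dist2_pos, n.
Qed.

(* Merging the closest pair changes the other distances by a bounded factor only, so the
   logarithms are ultrametric up to a constant; with unit total charge the merged
   configuration may be compared at the larger scale. *)
Lemma cluster_energy (M : R) (n : nat) : 0 <= M ->
  exists C, 0 <= C /\ forall l, (length l <= n)%nat -> integral l -> total l = 1 -> mass l <= M ->
    forall T, 0 <= T -> (forall x y, In x l -> In y l -> snd x <> snd y -> T <= lg (snd x) (snd y)) ->
    T / 2 * (dsum delta l - 1) - C <= - / 2 * dsum lg l.
Proof.
  intros HM. induction n as [|n [C [HC IH]]].
  - exists 0. split; [lra|]. intros l hl _ ht. destruct l; simpl in hl; [|lia]. unfold total in ht. simpl in ht. lra.
  - assert (L4 : 0 <= ln 4) by (rewrite <- ln_1; apply ln_le; lra).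
    exists (C + M * M * ln 4). split; [nra|].
    intros l hl hint ht hm T hT hsep.
    destruct (classic (NoDup (map snd l))) as [hN|hN].
    + destruct (le_lt_dec 2 (length l)) as [h2|h2].
      * destruct (closest_pair l hN h2) as [x [y [l' [hp [hxy hmin]]]]].
        rewrite !(dsum_perm _ _ _ hp).
        assert (Hin : forall z, In z l <-> In z (x :: y :: l')) by (intros z; split; apply Permutation_in; [exact hp|symmetry; exact hp]).
        assert (hN' : NoDup (map snd (x :: y :: l'))) by (apply (Permutation_NoDup (Permutation_map snd hp)); exact hN).
        simpl in hN'. inversion_clear hN' as [|? ? hx hN1]. inversion_clear hN1 as [|? ? hy hN2].
        set (z := (fst x + fst y, snd x) : item). set (t := lg (snd x) (snd y)).
        assert (htT : T <= t) by (apply hsep; [apply Hin; left; reflexivity|apply Hin; right; left; reflexivity|exact hxy]).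
        assert (IHz := IH (z :: l')).
        assert (Elen : length l = S (S (length l'))) by (rewrite (Permutation_length hp); reflexivity).
        assert (Et : total l = fst x + fst y + total l').
        { unfold total. rewrite (sumR_perm _ _ _ hp). cbn [sumR]. ring. }
        assert (Em : mass l = Rabs (fst x) + Rabs (fst y) + mass l').
        { unfold mass. rewrite (sumR_perm _ _ _ hp). cbn [sumR]. ring. }
        assert (hml := mass_nonneg l').
        specialize (IHz ltac:(simpl; lia)).
        destruct (hint x ltac:(apply Hin; left; reflexivity)) as [kx ekx].
        destruct (hint y ltac:(apply Hin; right; left; reflexivity)) as [ky eky].
        specialize (IHz ltac:(intros w [e|h]; [subst w; exists (kx + ky)%Z; cbn [fst z]; rewrite plus_IZR, <- ekx, <- eky; reflexivity|apply hint, Hin; right; right; exact h])).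
        specialize (IHz ltac:(unfold total; cbn [sumR]; cbn [fst z]; unfold total in Et, ht; lra)).
        specialize (IHz ltac:(unfold mass; cbn [sumR]; cbn [fst z]; fold (mass l'); assert (q := Rabs_triang (fst x) (fst y)); lra)).
        assert (Hxl' : forall w, In w l' -> snd w <> snd x) by (intros w hw e; apply hx; right; apply in_map_iff; exists w; auto).
        assert (Hyl' : forall w, In w l' -> snd w <> snd y) by (intros w hw e; apply hy; apply in_map_iff; exists w; auto).
        assert (Hlmono : forall c1 c2 c3 c4, (1 <= dist2 c1 c2)%Z -> (dist2 c1 c2 <= dist2 c3 c4)%Z -> lg c1 c2 <= lg c3 c4).
        { intros c1 c2 c3 c4 k1 k2. unfold lg. apply ln_le; [apply IZR_lt; lia|apply IZR_le; exact k2]. }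
        assert (hd1 := dist2_pos _ _ hxy).
        (* The induction hypothesis is used at the scale [t] of the merged pair, which still
           separates the remaining positions. Merging raises the squared charges by twice the
           product of the pair, and half of this times [t] cancels the interaction of the pair. *)
        specialize (IHz t ltac:(lra)).
        specialize (IHz ltac:(
          assert (K : forall w, In w l' -> t <= lg (snd x) (snd w)) by
            (intros w hw; apply Hlmono; [exact hd1|]; apply hmin;
              [apply Hin; left; reflexivity|apply Hin; right; right; exact hw|apply not_eq_sym, Hxl'; exact hw]);
          intros u v [eu|hu] [ev|hv] huv;
            [subst; exfalso; apply huv; reflexivity
            |subst u; cbn [snd z]; apply K; exact hv
            |subst v; cbn [snd z]; rewrite lg_sym; apply K; exact hu
            |apply Hlmono; [exact hd1|]; apply hmin; [apply Hin; right; right; exact hu|apply Hin; right; right; exact hv|exact huv]])).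
        rewrite !(dsum_cons delta) in * by apply delta_sym. rewrite !(dsum_cons lg) in * by apply lg_sym.
        cbn [sumR] in *. cbn [fst snd z] in IHz. rewrite !lg_refl in *.
        assert (Dd : forall c, delta c c = 1) by (intros c; unfold delta; destruct (cell_dec c c); congruence).
        rewrite !Dd in *.
        assert (D0 : forall c, (forall w, In w l' -> snd w <> c) -> sumR (fun w => fst w * delta c (snd w)) l' = 0).
        { intros c hc. apply sumR_0. intros w hw. unfold delta. destruct (cell_dec c (snd w)) as [e|ne]; [exfalso; apply (hc w hw); congruence|ring]. }
        rewrite !(D0 (snd x)) in * by exact Hxl'. rewrite !(D0 (snd y)) in * by exact Hyl'.
        assert (Dxy : delta (snd x) (snd y) = 0) by (unfold delta; destruct (cell_dec (snd x) (snd y)); [contradiction|reflexivity]).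
        rewrite Dxy. fold t.
        set (Sx := sumR (fun w => fst w * lg (snd x) (snd w)) l') in *.
        set (Sy := sumR (fun w => fst w * lg (snd y) (snd w)) l') in *.
        set (D' := dsum delta l') in *. set (F' := dsum lg l') in *.
        (* As the pair is closest, the parallelogram inequality bounds by 4 the factor by which
           [dist2] to a third point changes when [y] moves onto [x]. *)
        assert (HS : Rabs (Sy - Sx) <= M * ln 4).
        { unfold Sy, Sx. rewrite <- sumR_minus. eapply Rle_trans; [apply sumR_abs|].
          apply Rle_trans with (sumR (fun w : item => ln 4 * Rabs (fst w)) l').
          - apply sumR_le. intros w hw. rewrite <- Rmult_minus_distr_l, Rabs_mult, Rmult_comm.
            apply Rmult_le_compat_r; [apply Rabs_pos|].
            assert (hdx : (dist2 (snd x) (snd y) <= dist2 (snd x) (snd w))%Z)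
              by (apply hmin; [apply Hin; left; reflexivity|apply Hin; right; right; exact hw|apply not_eq_sym, Hxl'; exact hw]).
            assert (hdy : (dist2 (snd x) (snd y) <= dist2 (snd y) (snd w))%Z)
              by (apply hmin; [apply Hin; right; left; reflexivity|apply Hin; right; right; exact hw|apply not_eq_sym, Hyl'; exact hw]).
            assert (p1 := dist2_parallelogram (snd y) (snd x) (snd w)). assert (p2 := dist2_parallelogram (snd x) (snd y) (snd w)).
            rewrite (dist2_sym (snd y) (snd x)) in p1.
            assert (G : forall c1 c2 c3 c4, (1 <= dist2 c1 c2)%Z -> (1 <= dist2 c3 c4)%Z -> (dist2 c1 c2 <= 4 * dist2 c3 c4)%Z ->
              lg c1 c2 <= ln 4 + lg c3 c4).
            { intros c1 c2 c3 c4 k1 k2 k3. unfold lg. rewrite <- ln_mult by (try lra; apply IZR_lt; lia).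
              apply ln_le; [apply IZR_lt; lia|]. rewrite <- mult_IZR. apply IZR_le. exact k3. }
            assert (g1 := G (snd y) (snd w) (snd x) (snd w) ltac:(lia) ltac:(lia) ltac:(lia)).
            assert (g2 := G (snd x) (snd w) (snd y) (snd w) ltac:(lia) ltac:(lia) ltac:(lia)).
            apply Rabs_le. lra.
          - rewrite sumR_scal, Rmult_comm. apply Rmult_le_compat_r; [exact L4|]. fold (mass l').
            assert (q1 := Rabs_pos (fst x)). assert (q2 := Rabs_pos (fst y)). lra. }
        assert (HyS : Rabs (fst y * (Sy - Sx)) <= M * M * ln 4).
        { rewrite Rabs_mult, Rmult_assoc. apply Rmult_le_compat; try apply Rabs_pos; [|exact HS].
          assert (q1 := Rabs_pos (fst x)). lra. }
        assert (HyS' := Rle_abs (fst y * (Sy - Sx))).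
        (* Squares of integers of total 1 sum to at least 1; hence the coefficient of the scale is
           nonnegative and [t] may be lowered to [T]. *)
        assert (HP1 : 1 <= fst x ^ 2 + fst y ^ 2 + D').
        { assert (Hsq : forall l0 : list item, NoDup (map snd l0) -> integral l0 -> total l0 <= dsum delta l0).
          { induction l0 as [|w l0 IHl0]; intros n0 i0.
            - unfold total, dsum. simpl. lra.
            - simpl in n0. inversion_clear n0 as [|? ? a1 a2]. rewrite (dsum_cons delta) by apply delta_sym. rewrite Dd.
              rewrite sumR_0.
              + unfold total. cbn [sumR]. fold (total l0).
                assert (IHl := IHl0 a2 (fun v hv => i0 v (or_intror hv))).
                destruct (i0 w (or_introl eq_refl)) as [k ek]. rewrite ek.
                assert (IZR k <= IZR k ^ 2); [|lra]. replace (IZR k ^ 2) with (IZR (k * k)) by (rewrite mult_IZR; ring).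
                apply IZR_le. nia.
              + intros v hv. unfold delta. destruct (cell_dec (snd w) (snd v)) as [e|ne]; [|ring].
                exfalso. apply a1. apply in_map_iff. exists v. auto. }
          assert (q := Hsq l hN hint). rewrite (dsum_perm _ _ _ hp), !(dsum_cons delta) in q by apply delta_sym.
          cbn [sumR] in q. rewrite !Dd, (D0 (snd x) Hxl'), (D0 (snd y) Hyl'), Dxy in q. fold D' in q. lra. }
        assert (Hfin : T / 2 * (fst x ^ 2 + fst y ^ 2 + D' - 1) <= t / 2 * (fst x ^ 2 + fst y ^ 2 + D' - 1))
          by (apply Rmult_le_compat_r; lra).
        lra.
      * destruct l as [|x [|y l]]; simpl in h2; [unfold total in ht; simpl in ht; lra| |lia].
        unfold total in ht. simpl in ht. unfold dsum. cbn [sumR]. rewrite lg_refl.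
        unfold delta. destruct (cell_dec (snd x) (snd x)); [|congruence].
        replace (fst x) with 1 by lra. nra.
    + destruct (not_NoDup_map snd l hN) as [x [y [l' [hp e]]]].
      rewrite !(dsum_perm _ _ _ hp).
      set (z := (fst x + fst y, snd x) : item).
      assert (Hin : forall z, In z l <-> In z (x :: y :: l')) by (intros z0; split; apply Permutation_in; [exact hp|symmetry; exact hp]).
      assert (Elen : length l = S (S (length l'))) by (rewrite (Permutation_length hp); reflexivity).
      assert (Edel : forall g, (forall c c', g c c' = g c' c) -> dsum g (x :: y :: l') = dsum g (z :: l')).
      { intros g hg. rewrite !(dsum_cons g) by exact hg. cbn [sumR]. cbn [fst snd z]. rewrite e. ring. }
      rewrite (Edel delta delta_sym), (Edel lg lg_sym).
      assert (K : T / 2 * (dsum delta (z :: l') - 1) - C <= - / 2 * dsum lg (z :: l')).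
      { apply IH; auto.
        - simpl; lia.
        - intros w [ew|h]; [|apply hint, Hin; right; right; exact h]. subst w.
          destruct (hint x ltac:(apply Hin; left; reflexivity)) as [kx ekx].
          destruct (hint y ltac:(apply Hin; right; left; reflexivity)) as [ky eky].
          exists (kx + ky)%Z. cbn [fst z]. rewrite plus_IZR, <- ekx, <- eky. reflexivity.
        - rewrite <- ht. unfold total. rewrite (sumR_perm _ _ _ hp). cbn [sumR]. cbn [fst z]. ring.
        - eapply Rle_trans; [|exact hm]. unfold mass. rewrite (sumR_perm _ _ _ hp). cbn [sumR]. cbn [fst z].
          assert (q := Rabs_triang (fst x) (fst y)). lra.
        - assert (K : forall w, In w (z :: l') -> exists w', In w' l /\ snd w' = snd w).
          { intros w [ew|h].
            - subst w. exists x. split; [apply Hin; left; reflexivity|reflexivity].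
            - exists w. split; [apply Hin; right; right; exact h|reflexivity]. }
          intros u v hu hv huv. destruct (K u hu) as [u' [hu' eu]], (K v hv) as [v' [hv' ev]].
          rewrite <- eu, <- ev in *. apply hsep; auto. }
      nra.
Qed.

(** Total 1 forces a positive charge at some position, and a positive integer whose square is below
    2 is 1. Items at a common position are added up beforehand. *)
Lemma unit_cluster (n : nat) (l : list item) : (length l <= n)%nat -> integral l -> total l = 1 ->
  dsum delta l < 2 -> exists x, In x l /\ charge_at l (snd x) = 1.
Proof.
  revert l. induction n as [|n IH]; intros l hl hint ht hd.
  - destruct l; simpl in hl; [|lia]. unfold total in ht. simpl in ht. lra.
  - assert (Dd : forall c, delta c c = 1) by (intros c; unfold delta; destruct (cell_dec c c); congruence).
    destruct (classic (NoDup (map snd l))) as [hN|hN].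
    + assert (Hpos : exists x, In x l /\ 0 < fst x).
      { apply NNPP. intros k. assert (total l <= 0); [|lra].
        unfold total. rewrite <- (sumR_0 (fun _ : item => 0) l) by reflexivity. apply sumR_le.
        intros x hx. apply Rnot_lt_le. intros h. apply k. exists x. auto. }
      destruct Hpos as [x [hx hp]]. exists x. split; [exact hx|].
      apply in_split in hx. destruct hx as [l1 [l2 e]].
      assert (hperm : Permutation l (x :: l1 ++ l2)) by (rewrite e; symmetry; apply Permutation_middle).
      assert (hN' : NoDup (map snd (x :: l1 ++ l2))) by (apply (Permutation_NoDup (Permutation_map snd hperm)); exact hN).
      simpl in hN'. inversion_clear hN' as [|? ? a1 a2].
      assert (Z0 : sumR (fun y : item => fst y * delta (snd x) (snd y)) (l1 ++ l2) = 0).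
      { apply sumR_0. intros w hw. unfold delta. destruct (cell_dec (snd x) (snd w)) as [e'|ne]; [|ring].
        exfalso. apply a1. apply in_map_iff. exists w. auto. }
      rewrite (dsum_perm _ _ _ hperm), (dsum_cons delta) in hd by apply delta_sym. rewrite Dd, Z0 in hd.
      unfold charge_at. rewrite (sumR_perm _ _ _ hperm). cbn [sumR]. rewrite Dd, Z0.
      assert (Hnn : forall l0 : list item, NoDup (map snd l0) -> 0 <= dsum delta l0).
      { induction l0 as [|w l0 IHl0]; intros n0.
        - unfold dsum. simpl. lra.
        - simpl in n0. inversion_clear n0 as [|? ? b1 b2]. rewrite (dsum_cons delta) by apply delta_sym. rewrite Dd.
          rewrite sumR_0; [assert (q := IHl0 b2); assert (q' := pow2_ge_0 (fst w)); lra|].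
          intros v hv. unfold delta. destruct (cell_dec (snd w) (snd v)) as [e'|ne]; [|ring].
          exfalso. apply b1. apply in_map_iff. exists v. auto. }
      assert (q := Hnn _ a2).
      destruct (hint x) as [k ek]; [rewrite e; apply in_or_app; right; left; reflexivity|]. rewrite ek in *.
      assert (h1 : (0 < k)%Z) by (apply lt_IZR; exact hp).
      assert (h2 : IZR (k * k) < 2) by (rewrite mult_IZR; lra). apply (lt_IZR _ 2) in h2.
      assert (k = 1%Z) by nia. subst k. lra.
    + destruct (not_NoDup_map snd l hN) as [x [y [l' [hp e]]]].
      set (z := (fst x + fst y, snd x) : item).
      assert (Hin : forall z, In z l <-> In z (x :: y :: l')) by (intros z0; split; apply Permutation_in; [exact hp|symmetry; exact hp]).
      assert (Elen : length l = S (S (length l'))) by (rewrite (Permutation_length hp); reflexivity).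
      destruct (IH (z :: l')) as [w [hw ew]].
      * simpl; lia.
      * intros w [ew|h]; [|apply hint, Hin; right; right; exact h]. subst w.
        destruct (hint x ltac:(apply Hin; left; reflexivity)) as [kx ekx].
        destruct (hint y ltac:(apply Hin; right; left; reflexivity)) as [ky eky].
        exists (kx + ky)%Z. cbn [fst z]. rewrite plus_IZR, <- ekx, <- eky. reflexivity.
      * rewrite <- ht. unfold total. rewrite (sumR_perm _ _ _ hp). cbn [sumR]. cbn [fst z]. ring.
      * rewrite (dsum_perm _ _ _ hp), !(dsum_cons delta) in hd by apply delta_sym. cbn [sumR] in hd.
        rewrite !(dsum_cons delta) by apply delta_sym. cbn [fst snd z]. rewrite <- e in hd. rewrite !Dd in *. lra.
      * assert (Ec : forall c, charge_at l c = charge_at (z :: l') c).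
        { intros c. unfold charge_at. rewrite (sumR_perm _ _ _ hp). cbn [sumR]. cbn [fst snd z]. rewrite <- e. ring. }
        destruct hw as [ez|hw].
        -- exists x. split; [apply Hin; left; reflexivity|]. rewrite Ec. subst w. exact ew.
        -- exists w. split; [apply Hin; right; right; exact hw|]. rewrite Ec. exact ew.
Qed.

(** If the squared charges summed to 2 or more, [cluster_energy] would give at least [T / 2 - C],
    which exceeds [F0] for the chosen separation [T]. *)
Lemma unit_cluster_of_energy (M F0 : R) (n : nat) : 0 <= M ->
  exists T, forall l, (length l <= n)%nat -> integral l -> total l = 1 -> mass l <= M ->
    (forall x y, In x l -> In y l -> snd x <> snd y -> T <= lg (snd x) (snd y)) ->
    - / 2 * dsum lg l <= F0 -> exists x, In x l /\ charge_at l (snd x) = 1.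
Proof.
  intros HM. destruct (cluster_energy M n HM) as [C [HC H]].
  set (T := 2 * (Rabs F0 + C) + 2).
  assert (hF := Rle_abs F0). assert (hF' := Rabs_pos F0).
  exists T. intros l hl hint ht hm hsep hF0.
  apply (unit_cluster n l hl hint ht). apply Rnot_le_lt. intros h2.
  specialize (H l hl hint ht hm T ltac:(unfold T; lra) hsep).
  assert (T / 2 * 1 <= T / 2 * (dsum delta l - 1)) by (apply Rmult_le_compat_l; unfold T; lra).
  unfold T in *. lra.
Qed.

(** * A minimising sequence *)

(** Only energy differences under finite perturbations are compared, the energy of a displacement
    with a vortex being infinite. *)
Definition near_minimal (psi : R -> R) (y : pt -> R) (e : R) : Prop :=
  forall m v, fin_grad m v ->
    - e <= bsum m (fun p j => psi (dlat y p j + dlat v p j) - psi (dlat y p j)).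

Definition charges (a : flow) (l : list cell) : list item := map (fun c => (divf a c, c)) l.

(** [N], [K] and [F] are uniform along the minimising sequence; only the defect [e] tends to 0. *)
Record config (psi : R -> R) (N : nat) (K F e : R) (y : pt -> R) (a : flow) (l : list cell) : Prop := {
  cf_lift : lift_of y a;
  cf_nodup : NoDup l;
  cf_cores : forall c, In c l <-> divf a c <> 0;
  cf_len : (length l <= N)%nat;
  cf_total : total (charges a l) = 1;
  cf_log : - / 2 * dsum lg (charges a l) <= F;
  cf_l2 : forall k, bsum k (fun p j => (a p j - vortex_sum (divf a) l p j) ^ 2) <= K;
  cf_min : near_minimal psi y e }.

Lemma dsum_charges a l : dsum lg (charges a l) = log_interaction (divf a) l.
Proof.
  unfold dsum, charges, log_interaction. rewrite sumR_map. apply sumR_ext. intros c _.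
  rewrite sumR_map. apply sumR_ext. intros c' _. reflexivity.
Qed.

Lemma total_charges a l : total (charges a l) = sumR (divf a) l.
Proof. unfold total, charges. rewrite sumR_map. reflexivity. Qed.

(** The outflow of a lift is an integer of modulus at most 1, so charges are 1 or -1. Total 1 leaves
    one more positive core than negative ones, and [864 = 2 * 432]. *)
Lemma cores_exist y a m : same_far m a (ang c0) -> lift_of y a ->
  exists l, NoDup l /\ l <> [] /\ (forall c, In c l <-> divf a c <> 0) /\ sumR (divf a) l = 1 /\
    INR (length l) <= 864 * (bsum m (fun p j => a p j ^ 2 - ang c0 p j ^ 2) + 45000003) + 1.
Proof.
  intros Hfar Hl.
  set (nz := fun c : cell => if Req_EM_T (divf a c) 0 then false else true).
  set (l := filter nz (cells (S m))).
  assert (Hin : forall c, In c l <-> divf a c <> 0).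
  { intros c. unfold l, nz. rewrite filter_In, In_cells. destruct (Req_EM_T (divf a c) 0) as [e|n].
    - split; [intros [_ h]; discriminate|intros h; congruence].
    - split; [auto|]. intros _. split; [|reflexivity]. apply (div_support m a c Hfar n). }
  assert (N : NoDup l) by (apply NoDup_filter, NoDup_cells).
  assert (Hsum : sumR (divf a) l = 1).
  { transitivity (sumR (divf a) (cells (S m))).
    - apply sumR_support; [exact N|apply NoDup_cells|]. intros c hc. rewrite Hin, In_cells. split; [|auto].
      intros _. apply (div_support m a c Hfar hc).
    - rewrite (total_div m (S m) a (ang c0) Hfar ltac:(lia)).
      rewrite (sumR_ext _ (delta c0)) by (intros; apply div_ang). apply sum_delta_cells.
      apply In_cells. rewrite In_bx; unfold c0; cbn [fst snd]; lia. }
  assert (Hne : l <> []) by (intros e; rewrite e in Hsum; simpl in Hsum; lra).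
  exists l. split; [exact N|split; [exact Hne|split; [exact Hin|split; [exact Hsum|]]]].
  set (ng := filter (fun c => if Req_EM_T (divf a c) (-1) then true else false) l).
  assert (Hng := negative_core_count a m ng Hfar (lift_div_int y a Hl) ltac:(apply NoDup_filter; exact N)).
  assert (Hval : forall c, In c l -> divf a c = 1 \/ divf a c = -1).
  { intros c hc. apply Hin in hc. destruct (lift_div_int y a Hl c) as [k hk].
    assert (hb := lift_div_abs y a Hl c). rewrite hk in *. rewrite Rabs_Zabs in hb. apply (le_IZR _ 1) in hb.
    assert (k <> 0%Z) by (intros e; subst; apply hc; reflexivity).
    assert (k = 1 \/ k = -1)%Z by lia. destruct H0; subst; [left|right]; reflexivity. }
  specialize (Hng ltac:(intros q hq; unfold ng in hq; apply filter_In in hq; destruct hq as [_ hq];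
     destruct (Req_EM_T (divf a q) (-1)); [assumption|discriminate])).
  assert (Hlen : INR (length l) = 2 * INR (length ng) + 1).
  { rewrite <- Hsum. rewrite <- (Rmult_1_r (INR (length l))), <- (Rmult_1_r (INR (length ng))).
    rewrite <- !sumR_const. unfold ng. rewrite sumR_filter, <- sumR_scal, <- sumR_plus.
    apply sumR_ext. intros c hc. destruct (Hval c hc) as [e|e]; rewrite e;
      destruct (Req_EM_T _ _); lra. }
  rewrite Hlen. lra.
Qed.

Lemma fin_grad_mono m n u : (m <= n)%nat -> fin_grad m u -> fin_grad n u.
Proof.
  intros H Hu p j hj hp. apply Hu; [exact hj|]. intros h. apply hp. apply (bx_mono m n H); exact h.
Qed.

Lemma dlat_plus u v p j : dlat (fun q => u q + v q) p j = dlat u p j + dlat v p j.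
Proof. unfold dlat. ring. Qed.

(** The infimum is finite by the count of cores applied to the empty list. In [log_energy] the
    interaction is bounded below by [cluster_energy] at scale 0, so an energy bound controls the
    distance to the superposition; since a square norm is nonnegative, it also bounds the
    interaction above. *)
Lemma minimising_sequence (psi : R -> R) : psi_assumptions psi ->
  exists N K F, forall k : nat, exists y a l, config psi N K F (/ (INR k + 1)) y a l.
Proof.
  intros Hpsi. destruct (energy_lower psi Hpsi) as [C [HC Hlow]].
  assert (Hmu : 0 < Derive_n psi 2 0) by apply Hpsi. set (mu := Derive_n psi 2 0) in *.
  assert (HJ : forall m u, fin_grad m u -> mu / 2 * (- 45000003) <= energy psi m u + C).
  { intros m u Hu. destruct (Hlow m u Hu) as [a [Hfar [Hl He]]]. eapply Rle_trans; [|exact He].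
    apply Rmult_le_compat_l; [lra|].
    assert (q := negative_core_count a m [] Hfar (lift_div_int _ a Hl) ltac:(constructor) ltac:(intros q [])). cbn [length INR] in q. lra. }
  set (E := fun r => exists m u, fin_grad m u /\ r = - energy psi m u).
  assert (Eb : bound E).
  { exists (C - mu / 2 * (- 45000003)). intros r [m [u [Hu e]]]. specialize (HJ m u Hu). lra. }
  assert (H0 : fin_grad 0 (fun _ => 0)) by (intros p j _ _; unfold dlat; ring).
  assert (E0 : E 0).
  { exists 0%nat, (fun _ => 0). split; [exact H0|]. unfold energy, bsum. rewrite (sumR_0 _ (bonds 0)); [ring|].
    intros b _. unfold dlat at 2. replace (dlat yhat (fst b) (snd b) + (0 - 0)) with (dlat yhat (fst b) (snd b)) by ring. ring. }
  destruct (completeness E Eb ltac:(exists 0; exact E0)) as [S [Hub Hlub]].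
  assert (HS : 0 <= S) by (apply Hub; exact E0).
  set (J0 := (1 + C) * (2 / mu)).
  assert (HJ0 : 0 <= J0) by (apply Rmult_le_pos; [lra|apply Rmult_le_pos; [lra|left; apply Rinv_0_lt_compat; lra]]).
  set (B := 864 * (J0 + 45000003) + 1).
  destruct (INR_unbounded B) as [N HN].
  set (LB := 100000000 * (1 + INR N ^ 2)).
  destruct (cluster_energy (INR N) N (pos_INR N)) as [Cc [HCc Hcl]].
  assert (hk0 := k0_bounds).
  exists N, (2 * (J0 + LB + k0 * Cc)), (/ k0 * (J0 + LB)). intros k.
  assert (Hk : 0 < / (INR k + 1)) by (apply Rinv_0_lt_compat; assert (q := pos_INR k); lra).
  assert (Hex : exists m u, fin_grad m u /\ energy psi m u <= - S + / (INR k + 1)).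
  { apply NNPP. intros hno. assert (S <= S - / (INR k + 1)); [|lra].
    apply Hlub. intros r [m [u [Hu e]]]. apply Rnot_lt_le. intros h. apply hno. exists m, u. split; [exact Hu|]. lra. }
  destruct Hex as [m [u [Hu He]]].
  destruct (Hlow m u Hu) as [a [Hfar [Hl HeJ]]].
  assert (HJb : bsum m (fun p j => a p j ^ 2 - ang c0 p j ^ 2) <= J0).
  { assert (h : / (INR k + 1) <= 1).
    { rewrite <- Rinv_1. apply Rinv_le_contravar; assert (q := pos_INR k); lra. }
    apply Rmult_le_reg_l with (mu / 2); [lra|]. unfold J0.
    replace (mu / 2 * ((1 + C) * (2 / mu))) with (1 + C) by (field; lra). lra. }
  destruct (cores_exist _ a m Hfar Hl) as [l [Nl [Hne [Hin [Hsum Hlen]]]]].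
  assert (Habs := lift_div_abs _ a Hl).
  assert (HlenN : (length l <= N)%nat) by (apply INR_le; unfold B in HN; lra).
  destruct (log_energy a m l Hfar Nl Hne Habs (fun c h => proj2 (Hin c) h)) as [_ Hlog].
  assert (HLB : 100000000 * (1 + INR (length l) ^ 2) <= LB).
  { unfold LB. apply Rmult_le_compat_l; [lra|]. apply Rplus_le_compat_l. apply pow_incr.
    split; [apply pos_INR|apply le_INR; exact HlenN]. }
  assert (Hci : integral (charges a l)).
  { intros x hx. apply in_map_iff in hx. destruct hx as [c [e _]]. subst x. cbn [fst]. apply (lift_div_int _ a Hl). }
  assert (Htot : total (charges a l) = 1) by (rewrite total_charges; exact Hsum).
  assert (Hmass : mass (charges a l) <= INR N).
  { unfold mass, charges. rewrite sumR_map. cbn [fst].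
    apply Rle_trans with (sumR (fun _ : cell => 1) l); [apply sumR_le; intros; apply Habs|].
    rewrite sumR_const, Rmult_1_r. apply le_INR; exact HlenN. }
  assert (Hlow2 : - Cc <= - / 2 * dsum lg (charges a l)).
  { assert (q := Hcl (charges a l) ltac:(unfold charges; rewrite length_map; exact HlenN) Hci Htot Hmass 0 ltac:(lra)
      ltac:(intros; apply lg_nonneg)). lra. }
  rewrite dsum_charges in Hlow2.
  set (y := fun q => yhat q + u q) in *.
  exists y, a, l. split.
  - exact Hl.
  - exact Nl.
  - exact Hin.
  - exact HlenN.
  - exact Htot.
  - rewrite dsum_charges. assert (q := Hlog 0%nat).
    assert (0 <= bsum 0 (fun p j => (a p j - vortex_sum (divf a) l p j) ^ 2)) by (apply sumR_nonneg; intros; apply pow2_ge_0).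
    apply Rmult_le_reg_l with k0; [lra|].
    replace (k0 * (/ k0 * (J0 + LB))) with (J0 + LB) by (field; lra). lra.
  - intros kk. assert (q := Hlog kk).
    assert (k0 * - Cc <= k0 * (- / 2 * log_interaction (divf a) l)) by (apply Rmult_le_compat_l; lra). lra.
  - intros m' v Hv. set (M := (m + m')%nat).
    assert (Huv : fin_grad M (fun q => u q + v q)).
    { intros p j hj hp. rewrite dlat_plus.
      rewrite (fin_grad_mono m M u ltac:(unfold M; lia) Hu p j hj hp).
      rewrite (fin_grad_mono m' M v ltac:(unfold M; lia) Hv p j hj hp). ring. }
    assert (q1 : - energy psi M (fun q => u q + v q) <= S) by (apply Hub; exists M, (fun q => u q + v q); auto).
    assert (q2 : energy psi M u = energy psi m u).
    { unfold energy. apply bsum_extend; [unfold M; lia|]. intros p j hj hp. rewrite Hu by assumption. rewrite Rplus_0_r. ring. }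
    assert (q3 : bsum m' (fun p j => psi (dlat y p j + dlat v p j) - psi (dlat y p j)) =
       energy psi M (fun q => u q + v q) - energy psi M u).
    { rewrite <- (bsum_extend m' M _ ltac:(unfold M; lia)).
      - unfold energy. rewrite <- bsum_minus. apply bsum_ext. intros p j _ _.
        rewrite dlat_plus. unfold y. rewrite dlat_plus.
        replace (dlat yhat p j + (dlat u p j + dlat v p j)) with (dlat yhat p j + dlat u p j + dlat v p j) by ring. ring.
      - intros p j hj hp. rewrite Hv by assumption. rewrite Rplus_0_r. ring. }
    rewrite q3, q2. lra.
Qed.

(** * Diagonal extraction *)

Lemma functional_choice_eps {A B : Type} (P : A -> B -> Prop) :
  (forall x, exists y, P x y) -> exists f, forall x, P x (f x).
Proof.
  intros H. exists (fun x => proj1_sig (constructive_indefinite_description _ (H x))).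
  intros x. apply proj2_sig.
Qed.

(** The first [m] coordinates of [l] are a joint accumulation point, so a further coordinate can be
    fixed without losing those already chosen. *)
Definition adherent (f : nat -> nat -> R) (m : nat) (l : nat -> R) : Prop :=
  forall e, 0 < e -> forall N : nat, exists k : nat, (N <= k)%nat /\ forall i, (i < m)%nat -> Rabs (f k i - l i) < e.

Definition upd (l : nat -> R) (m : nat) (x : R) (i : nat) : R := if Nat.eq_dec i m then x else l i.

Lemma adherent_step f (B : nat -> R) m l : (forall k i, Rabs (f k i) <= B i) -> adherent f m l ->
  exists x, adherent f (S m) (upd l m x).
Proof.
  intros HB H.
  assert (Hch : exists K : nat -> nat, forall n, (n <= K n)%nat /\ forall i, (i < m)%nat -> Rabs (f (K n) i - l i) < / (INR n + 1)).
  { apply (functional_choice_eps (fun n k => (n <= k)%nat /\ forall i, (i < m)%nat -> Rabs (f k i - l i) < / (INR n + 1))).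
    intros n. apply H. apply Rinv_0_lt_compat. assert (q := pos_INR n). lra. }
  destruct Hch as [K HK].
  destruct (Bolzano_Weierstrass (fun n => f (K n) m) (fun x => - B m <= x <= B m)) as [x Hx].
  - apply compact_P3.
  - intros n. apply Rabs_le_between. apply HB.
  - exists x. intros e He N.
    destruct (INR_unbounded (/ e)) as [N2 HN2].
    assert (Hnb : neighbourhood (fun z => Rabs (z - x) < e) x).
    { exists (mkposreal e He). intros z hz. exact hz. }
    destruct (Hx _ (Nat.max N N2) Hnb) as [n [hn hz]].
    exists (K n). destruct (HK n) as [h1 h2]. split; [lia|]. intros i hi. unfold upd.
    destruct (Nat.eq_dec i m) as [ei|ni]; [subst i; exact hz|].
    eapply Rlt_trans; [apply h2; lia|].
    rewrite <- (Rinv_inv e). apply Rinv_lt_contravar.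
    + apply Rmult_lt_0_compat; [apply Rinv_0_lt_compat; exact He|]. assert (q := pos_INR n). lra.
    + assert (INR N2 <= INR n) by (apply le_INR; lia). lra.
Qed.

(** Limits are chosen coordinate by coordinate and never revised. Strict monotonicity of [phi] is
    replaced by [n <= phi n], enough to carry over eventual properties. *)
Lemma diagonal (f : nat -> nat -> R) (B : nat -> R) : (forall k i, Rabs (f k i) <= B i) ->
  exists (phi : nat -> nat) (l : nat -> R), (forall n, (n <= phi n)%nat) /\
    forall i, is_lim_seq (fun n => f (phi n) i) (l i).
Proof.
  intros HB.
  set (next := fun m l => epsilon (inhabits 0) (fun x => adherent f (S m) (upd l m x))).
  set (L := fix L m := match m with 0%nat => (fun _ => 0) | S m' => upd (L m') m' (next m' (L m')) end).
  assert (HL : forall m, adherent f m (L m)).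
  { induction m as [|m IH].
    - intros e He N. exists N. split; [lia|]. intros i hi. lia.
    - simpl. unfold next. apply epsilon_spec. apply (adherent_step f B m (L m) HB IH). }
  set (l := fun i => L (S i) i).
  assert (Hstab : forall m i, (i < m)%nat -> L m i = l i).
  { induction m as [|m IH]; intros i hi; [lia|]. destruct (Nat.eq_dec i m) as [e|n].
    - subst i. reflexivity.
    - simpl. unfold upd at 1. destruct (Nat.eq_dec i m); [contradiction|]. apply IH. lia. }
  assert (Hch : exists phi : nat -> nat, forall n, (n <= phi n)%nat /\ forall i, (i < n)%nat -> Rabs (f (phi n) i - l i) < / (INR n + 1)).
  { apply (functional_choice_eps (fun n k => (n <= k)%nat /\ forall i, (i < n)%nat -> Rabs (f k i - l i) < / (INR n + 1))).
    intros n. assert (q := pos_INR n).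
    destruct (HL n (/ (INR n + 1)) ltac:(apply Rinv_0_lt_compat; lra) n) as [k [h1 h2]].
    exists k. split; [exact h1|]. intros i hi. rewrite <- (Hstab n i hi). apply h2; exact hi. }
  destruct Hch as [phi Hphi]. exists phi, l. split; [apply Hphi|].
  intros i. apply is_lim_seq_spec. intros e. destruct (INR_unbounded (/ e)) as [N HN].
  exists (S (Nat.max i N)). intros n hn. destruct (Hphi n) as [_ h].
  eapply Rlt_trans; [apply h; lia|].
  assert (He := cond_pos e).
  rewrite <- (Rinv_inv e). apply Rinv_lt_contravar.
  - apply Rmult_lt_0_compat; [apply Rinv_0_lt_compat; exact He|]. assert (q := pos_INR n). lra.
  - assert (INR N <= INR n) by (apply le_INR; lia). lra.
Qed.

(** * Eventual properties, limits of sums and enumerations *)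

Definition evt (P : nat -> Prop) : Prop := exists N : nat, forall n, (N <= n)%nat -> P n.

Lemma evt_and P Q : evt P -> evt Q -> evt (fun n => P n /\ Q n).
Proof.
  intros [N1 h1] [N2 h2]. exists (Nat.max N1 N2). intros n hn. split; [apply h1|apply h2]; lia.
Qed.

Lemma evt_imp (P Q : nat -> Prop) : (forall n, P n -> Q n) -> evt P -> evt Q.
Proof. intros H [N h]. exists N. intros n hn. apply H, h, hn. Qed.

Lemma evt_all (P : nat -> Prop) : (forall n, P n) -> evt P.
Proof. intros H. exists 0%nat. intros n _. apply H. Qed.

Lemma evt_list {A : Type} (P : A -> nat -> Prop) (l : list A) :
  (forall x, In x l -> evt (P x)) -> evt (fun n => forall x, In x l -> P x n).
Proof.
  induction l as [|a l IH]; intros H.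
  - apply evt_all. intros n x [].
  - apply evt_imp with (P := fun n => P a n /\ forall x, In x l -> P x n).
    + intros n [h1 h2] x [e|hx]; [subst; exact h1|apply h2; exact hx].
    + apply evt_and; [apply H; left; reflexivity|]. apply IH. intros x hx. apply H. right; exact hx.
Qed.

Lemma evt_ex P : evt P -> exists n, P n.
Proof. intros [N h]. exists N. apply h. lia. Qed.

Lemma evt_sub P phi : (forall n, (n <= phi n)%nat) -> evt P -> evt (fun n => P (phi n)).
Proof. intros Hphi [N h]. exists N. intros n hn. apply h. specialize (Hphi n). lia. Qed.

Lemma lim_int_const (f : nat -> R) (l : R) : (forall n, exists k : Z, f n = IZR k) -> is_lim_seq f l ->
  (exists k : Z, l = IZR k) /\ evt (fun n => f n = l).
Proof.
  intros Hint Hl. apply is_lim_seq_spec in Hl. destruct (Hl (mkposreal (/ 4) ltac:(lra))) as [N HN]. simpl in HN.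
  destruct (Hint N) as [k hk].
  assert (Hall : forall n, (N <= n)%nat -> f n = IZR k).
  { intros n hn. destruct (Hint n) as [k' hk']. assert (h1 := HN n hn). assert (h2 := HN N (le_n N)).
    rewrite hk, hk' in *. assert (h : Rabs (IZR (k' - k)) < 1).
    { rewrite minus_IZR. replace (IZR k' - IZR k) with ((IZR k' - l) - (IZR k - l)) by ring.
      unfold Rminus at 1. eapply Rle_lt_trans; [apply Rabs_triang|]. rewrite Rabs_Ropp. lra. }
    rewrite Rabs_Zabs in h. apply (lt_IZR _ 1) in h. f_equal. lia. }
  assert (El : l = IZR k).
  { destruct (Req_dec l (IZR k)) as [e|n]; [exact e|]. exfalso.
    assert (Hp : 0 < Rabs (IZR k - l)) by (apply Rabs_pos_lt; lra).
    destruct (Hl (mkposreal _ Hp)) as [N' HN']. simpl in HN'.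
    specialize (HN' (Nat.max N N') ltac:(lia)). rewrite (Hall (Nat.max N N') ltac:(lia)) in HN'. lra. }
  split; [exists k; exact El|]. exists N. intros n hn. rewrite El. apply Hall; exact hn.
Qed.

Lemma lim_sumR {A : Type} (f : nat -> A -> R) (g : A -> R) (l : list A) :
  (forall x, In x l -> is_lim_seq (fun n => f n x) (g x)) ->
  is_lim_seq (fun n => sumR (f n) l) (sumR g l).
Proof.
  induction l as [|a l IH]; intros H; simpl.
  - apply is_lim_seq_const.
  - apply (is_lim_seq_plus' (fun n => f n a) (fun n => sumR (f n) l)).
    + apply H. left; reflexivity.
    + apply IH. intros x hx. apply H. right; exact hx.
Qed.

Lemma lim_evt_const (f : nat -> R) (l : R) : evt (fun n => f n = l) -> is_lim_seq f l.
Proof.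
  intros [N h]. apply is_lim_seq_spec. intros e. exists N. intros n hn. rewrite h by exact hn.
  rewrite Rminus_diag, Rabs_R0. apply cond_pos.
Qed.

Lemma summable_tail (f : pt * nat -> R) (K : R) :
  (forall S, NoDup S -> (forall b, In b S -> (snd b < 3)%nat) -> sumR f S <= K) ->
  forall d, 0 < d -> exists M, forall p j, (j < 3)%nat -> ~ In p (bx M) -> f (p, j) < d.
Proof.
  intros HK d Hd. apply NNPP. intros Hno.
  assert (Hbad : forall M, exists p j, (j < 3)%nat /\ ~ In p (bx M) /\ d <= f (p, j)).
  { intros M. apply NNPP. intros k. apply Hno. exists M. intros p j hj hp. apply Rnot_le_lt. intros h.
    apply k. exists p, j. auto. }
  assert (Hlist : forall t : nat, exists S, NoDup S /\ (forall b, In b S -> (snd b < 3)%nat) /\ INR t * d <= sumR f S).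
  { induction t as [|t [S [h1 [h2 h3]]]].
    - exists []. split; [constructor|split; [intros b []|]]. simpl. lra.
    - destruct (list_cells_bounded (map (fun b : pt * nat => (fst b, true)) S)) as [M HM].
      destruct (Hbad M) as [p [j [hj [hp hf]]]]. exists ((p, j) :: S). split; [|split].
      + constructor; [|exact h1]. intros h. apply hp. apply (HM (p, true)). apply in_map_iff. exists (p, j). auto.
      + intros b [e|hb]; [subst; exact hj|apply h2; exact hb].
      + rewrite S_INR. simpl. lra. }
  destruct (INR_unbounded (K / d)) as [t ht]. destruct (Hlist t) as [S [h1 [h2 h3]]].
  specialize (HK S h1 h2).
  assert (K < INR t * d); [|lra].
  apply Rmult_lt_compat_r with (r := d) in ht; [|exact Hd]. replace (K / d * d) with K in ht by (field; lra). lra.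
Qed.

Definition enumerable (A : Type) : Prop := exists d : nat -> A, forall x, exists n, d n = x.

Lemma enumerable_image {A B : Type} (f : A -> B) : (forall y, exists x, f x = y) ->
  enumerable A -> enumerable B.
Proof.
  intros Hf [d Hd]. exists (fun n => f (d n)). intros y. destruct (Hf y) as [x e]. destruct (Hd x) as [n e'].
  exists n. congruence.
Qed.

Lemma enumerable_prod (A B : Type) : enumerable A -> enumerable B -> enumerable (A * B).
Proof.
  intros [d Hd] [d' Hd']. exists (fun n => (d (fst (of_nat n)), d' (snd (of_nat n)))).
  intros [x y]. destruct (Hd x) as [n e], (Hd' y) as [n' e']. exists (to_nat (n, n')).
  rewrite cancel_of_to. cbn [fst snd]. congruence.
Qed.

Lemma enumerable_nat : enumerable nat.
Proof. exists (fun n => n). intros n. exists n. reflexivity. Qed.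

Lemma enumerable_Z : enumerable Z.
Proof.
  apply (enumerable_image (fun p : nat * nat => (Z.of_nat (fst p) - Z.of_nat (snd p))%Z)).
  - intros z. exists (Z.to_nat z, Z.to_nat (- z)). cbn [fst snd]. lia.
  - apply enumerable_prod; apply enumerable_nat.
Qed.

Lemma enumerable_pt : enumerable pt.
Proof. apply enumerable_prod; apply enumerable_Z. Qed.

Lemma enumerable_cell : enumerable cell.
Proof.
  apply enumerable_prod; [apply enumerable_pt|].
  exists (fun n => match n with 0%nat => true | _ => false end).
  intros []; [exists 0%nat|exists 1%nat]; reflexivity.
Qed.

Lemma diagonal_enumerable {A : Type} (f : nat -> A -> R) (B : A -> R) : enumerable A ->
  (forall k x, Rabs (f k x) <= B x) ->
  exists (phi : nat -> nat) (l : A -> R), (forall n, (n <= phi n)%nat) /\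
    forall x, is_lim_seq (fun n => f (phi n) x) (l x).
Proof.
  intros [d Hd] HB.
  destruct (diagonal (fun k i => f k (d i)) (fun i => B (d i))) as [phi [l [H1 H2]]].
  { intros k i. apply HB. }
  destruct (functional_choice_eps _ Hd) as [e He].
  exists phi, (fun x => l (e x)). split; [exact H1|]. intros x.
  apply (is_lim_seq_ext (fun n => f (phi n) (d (e x)))); [intros n; rewrite He; reflexivity|apply H2].
Qed.

(** * Clusters of cores along a sequence *)

(** The cell [c'] after the translation that takes the lattice point of [c] to the origin;
    orientations are kept. *)
Definition relc (c c' : cell) : cell := (psub (fst c') (fst c), snd c').

Lemma lg_max c c' : lg c c' = ln (IZR (Z.max 1 (dist2 c c'))).
Proof.
  unfold lg. assert (h := dist2_nonneg c c'). destruct (Z.eq_dec (dist2 c c') 0) as [e|n].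
  - rewrite e. change (Z.max 1 0) with 1%Z. rewrite ln_1. apply ln_nonpos. lra.
  - rewrite Z.max_r by lia. reflexivity.
Qed.

(** Two parallelogram inequalities give [dist2 a b <= 4 * dist2 a' b' + 6 * D]. *)
Lemma lg_perturb D a b a' b' : (0 <= D)%Z -> (dist2 a a' <= D)%Z -> (dist2 b b' <= D)%Z ->
  lg a b <= lg a' b' + ln (IZR (6 * D + 4)).
Proof.
  intros HD Ha Hb. rewrite !lg_max.
  rewrite <- ln_mult by (apply IZR_lt; lia). rewrite <- mult_IZR. apply ln_le; [apply IZR_lt; lia|]. apply IZR_le.
  assert (h1 := dist2_parallelogram a a' b). assert (h2 := dist2_parallelogram a' b' b).
  rewrite (dist2_sym b' b) in h2. assert (h3 := dist2_nonneg a' b'). nia.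
Qed.

Lemma lg_large T : exists D : Z, forall c c', (D <= dist2 c c')%Z -> T <= lg c c'.
Proof.
  exists (Z.max 1 (up (exp T))). intros c c' h. unfold lg. rewrite <- (ln_exp T). apply ln_le; [apply exp_pos|].
  destruct (archimed (exp T)) as [q _]. apply Rle_trans with (IZR (up (exp T))); [lra|]. apply IZR_le. lia.
Qed.

Definition near (X : nat -> nat -> cell) (i j : nat) : Prop := exists D, evt (fun k => (dist2 (X k i) (X k j) <= D)%Z).

Lemma near_refl X i : near X i i.
Proof. exists 0%Z. apply evt_all. intros k. rewrite dist2_refl. lia. Qed.

Lemma near_sym X i j : near X i j -> near X j i.
Proof. intros [D H]. exists D. apply (evt_imp _ _ (fun k h => eq_ind _ (fun z => (z <= D)%Z) h _ (dist2_sym _ _)) H). Qed.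

Lemma near_trans X i j l : near X i j -> near X j l -> near X i l.
Proof.
  intros [D H] [D' H']. exists (2 * (D + D'))%Z. refine (evt_imp _ _ _ (evt_and _ _ H H')).
  intros k [h h']. assert (q := dist2_parallelogram (X k i) (X k j) (X k l)). lia.
Qed.

Definition nearb (X : nat -> nat -> cell) (j i : nat) : bool := if excluded_middle_informative (near X i j) then true else false.
(** The least index in the cluster of [j], hence the same for all its members. *)
Definition rep (X : nat -> nat -> cell) (n j : nat) : nat := hd 0%nat (filter (nearb X j) (seq 0 n)).

Lemma rep_spec X n j : (j < n)%nat -> (rep X n j < n)%nat /\ near X (rep X n j) j.
Proof.
  intros hj. unfold rep.
  assert (Hin : In j (filter (nearb X j) (seq 0 n))).
  { apply filter_In. split; [apply in_seq; lia|]. unfold nearb.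
    destruct (excluded_middle_informative (near X j j)) as [h|h]; [reflexivity|exfalso; apply h, near_refl]. }
  assert (Hh : In (hd 0%nat (filter (nearb X j) (seq 0 n))) (filter (nearb X j) (seq 0 n))).
  { destruct (filter (nearb X j) (seq 0 n)); [contradiction|left; reflexivity]. }
  apply filter_In in Hh. destruct Hh as [h1 h2]. apply in_seq in h1. split; [lia|].
  unfold nearb in h2. destruct (excluded_middle_informative _) as [h|h]; [exact h|discriminate].
Qed.

Lemma rep_eq X n i j : near X i j -> rep X n i = rep X n j.
Proof.
  intros H. unfold rep. f_equal. apply filter_ext. intros l. unfold nearb.
  destruct (excluded_middle_informative (near X l i)) as [h|h], (excluded_middle_informative (near X l j)) as [h'|h']; auto; exfalso.
  - apply h'. apply (near_trans X l i j h H).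
  - apply h. apply (near_trans X l j i h' (near_sym _ _ _ H)).
Qed.

(** Moving every core onto the representative of its cluster changes the interaction by a bounded
    amount. For a suitable [k] the representatives are farther apart than any prescribed scale, so
    one of them carries total charge 1. *)
Lemma cluster_exists (X : nat -> nat -> cell) (n : nat) (s : nat -> R) (F : R) :
  (forall i j, near X i j \/ forall T, evt (fun k => (T <= dist2 (X k i) (X k j))%Z)) ->
  (forall k i j, (i < n)%nat -> (j < n)%nat -> X k i = X k j -> i = j) ->
  (forall i, (i < n)%nat -> Rabs (s i) <= 1 /\ exists z : Z, s i = IZR z) ->
  sumR s (seq 0 n) = 1 ->
  (forall k, - / 2 * dsum lg (map (fun i => (s i, X k i)) (seq 0 n)) <= F) ->
  exists i0, (i0 < n)%nat /\ sumR (fun j => if excluded_middle_informative (near X i0 j) then s j else 0) (seq 0 n) = 1.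
Proof.
  intros Hdich Hinj Hs Hsum HF.
  assert (HD : exists D : nat -> Z, forall j, (j < n)%nat -> evt (fun k => (dist2 (X k (rep X n j)) (X k j) <= D j)%Z)).
  { destruct (functional_choice_eps (fun j D => (j < n)%nat -> evt (fun k => (dist2 (X k (rep X n j)) (X k j) <= D)%Z))) as [D HD].
    - intros j. destruct (lt_dec j n) as [h|h].
      + destruct (rep_spec X n j h) as [_ [D HD]]. exists D. auto.
      + exists 0%Z. intros k; contradiction.
    - exists D. exact HD. }
  destruct HD as [Dj HDj]. destruct (list_Z_bounded (map Dj (seq 0 n))) as [M HM].
  set (D := Z.of_nat M). set (C := ln (IZR (6 * D + 4))).
  assert (HC : 0 <= C) by (unfold C; rewrite <- ln_1; apply ln_le; [lra|apply IZR_le; lia]).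
  set (F0 := F + / 2 * (INR n * INR n * C)).
  destruct (unit_cluster_of_energy (INR n) F0 n (pos_INR n)) as [T HT].
  destruct (lg_large T) as [DT HDT].
  assert (E1 : evt (fun k => forall j, In j (seq 0 n) -> (dist2 (X k (rep X n j)) (X k j) <= D)%Z)).
  { apply evt_list. intros j hj. assert (hj' := hj). apply in_seq in hj'. refine (evt_imp _ _ _ (HDj j ltac:(lia))).
    intros k h. assert (q := HM (Dj j) ltac:(apply in_map; exact hj)). unfold D. lia. }
  assert (E2 : evt (fun k => forall ij, In ij (list_prod (seq 0 n) (seq 0 n)) ->
     rep X n (fst ij) <> rep X n (snd ij) -> T <= lg (X k (rep X n (fst ij))) (X k (rep X n (snd ij))))).
  { apply evt_list. intros [i j] hij. apply in_prod_iff in hij. destruct hij as [hi hj].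
    apply in_seq in hi, hj. cbn [fst snd].
    destruct (Nat.eq_dec (rep X n i) (rep X n j)) as [e|ne]; [apply evt_all; intros k h; contradiction|].
    destruct (Hdich (rep X n i) (rep X n j)) as [h|h].
    - exfalso. apply ne. apply rep_eq. destruct (rep_spec X n i ltac:(lia)) as [_ q1]. destruct (rep_spec X n j ltac:(lia)) as [_ q2].
      apply (near_trans X i (rep X n i) j (near_sym _ _ _ q1)). apply (near_trans X _ (rep X n j) _ h q2).
    - refine (evt_imp _ _ _ (h DT)). intros k hk _. apply HDT. exact hk. }
  destruct (evt_ex _ (evt_and _ _ E1 E2)) as [k [H1 H2]].
  set (l := map (fun j => (s j, X k (rep X n j))) (seq 0 n)).
  destruct (HT l) as [x [hx hc]].
  - unfold l. rewrite length_map, length_seq. lia.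
  - intros x hx. apply in_map_iff in hx. destruct hx as [j [e hj]]. subst x. apply in_seq in hj. apply Hs. lia.
  - unfold total, l. rewrite sumR_map. exact Hsum.
  - unfold mass, l. rewrite sumR_map. cbn [fst].
    apply Rle_trans with (sumR (fun _ : nat => 1) (seq 0 n)).
    + apply sumR_le. intros j hj. apply in_seq in hj. apply Hs. lia.
    + rewrite sumR_const, length_seq. lra.
  - intros x y hx hy hne. apply in_map_iff in hx, hy. destruct hx as [i [e hi]], hy as [j [e' hj]]. subst x y. cbn [snd] in *.
    apply (H2 (i, j)); [apply in_prod_iff; auto|]. cbn [fst snd]. intros e. apply hne. rewrite e. reflexivity.
  - unfold F0. assert (q := HF k).
    assert (dsum lg (map (fun i => (s i, X k i)) (seq 0 n)) - dsum lg l <= INR n * INR n * C); [|lra].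
    unfold dsum, l. rewrite !sumR_map, <- sumR_minus.
    apply Rle_trans with (sumR (fun _ : nat => INR n * C) (seq 0 n)); [|rewrite sumR_const, length_seq; lra].
    apply sumR_le. intros i hi. rewrite !sumR_map, <- sumR_minus.
    apply Rle_trans with (sumR (fun _ : nat => C) (seq 0 n)); [|rewrite sumR_const, length_seq; lra].
    apply sumR_le. intros j hj. cbn [fst snd].
    assert (p1 := lg_perturb D (X k (rep X n i)) (X k (rep X n j)) (X k i) (X k j) ltac:(lia) (H1 i hi) (H1 j hj)).
    assert (p2 := lg_perturb D (X k i) (X k j) (X k (rep X n i)) (X k (rep X n j)) ltac:(lia)
       ltac:(rewrite dist2_sym; apply H1; exact hi) ltac:(rewrite dist2_sym; apply H1; exact hj)).
    fold C in p1, p2. rewrite <- Rmult_minus_distr_l.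
    eapply Rle_trans; [apply Rle_abs|]. rewrite !Rabs_mult. apply in_seq in hi, hj.
    destruct (Hs i ltac:(lia)) as [b1 _]. destruct (Hs j ltac:(lia)) as [b2 _].
    rewrite <- (Rmult_1_l C). apply Rmult_le_compat.
    + apply Rmult_le_pos; apply Rabs_pos.
    + apply Rabs_pos.
    + rewrite <- (Rmult_1_l 1). apply Rmult_le_compat; auto using Rabs_pos.
    + apply Rabs_le. lra.
  - apply in_map_iff in hx. destruct hx as [i [e hi]]. subst x. cbn [snd] in hc. apply in_seq in hi.
    exists i. split; [lia|]. rewrite <- hc. unfold charge_at, l. rewrite sumR_map. apply sumR_ext. intros j hj.
    apply in_seq in hj. cbn [fst snd]. unfold delta.
    destruct (rep_spec X n i ltac:(lia)) as [r1 q1]. destruct (rep_spec X n j ltac:(lia)) as [r2 q2].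
    destruct (excluded_middle_informative (near X i j)) as [h|h], (cell_dec (X k (rep X n i)) (X k (rep X n j))) as [e|ne]; try ring; exfalso.
    + apply ne. rewrite (rep_eq X n i j h). reflexivity.
    + apply h. apply Hinj in e; [|assumption|assumption]. apply (near_trans X _ (rep X n i) _ (near_sym _ _ _ q1)). rewrite e. exact q2.
Qed.

Lemma dist2_relc c c' : dist2 c c' = dist2 ((0, 0)%Z, snd c) (relc c c').
Proof. destruct c as [[x y] t], c' as [[x' y'] t']. unfold relc. lat_unfold. destruct t, t'; ring. Qed.

Lemma dist2_relc_le c c' : (dist2 c c' <= dist2 ((0, 0)%Z, true) (relc c c') + dist2 ((0, 0)%Z, false) (relc c c'))%Z.
Proof.
  rewrite dist2_relc. assert (h1 := dist2_nonneg ((0, 0)%Z, true) (relc c c')).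
  assert (h2 := dist2_nonneg ((0, 0)%Z, false) (relc c c')). destruct (snd c); lia.
Qed.

(** The indicator of each relative position is 0-1 valued, so on a diagonal subsequence all of them
    are eventually constant. A relative position then either stabilises or eventually avoids every
    given cell, hence leaves every box; this is the dichotomy needed for clusters. *)
Lemma cluster_limit (X : nat -> nat -> cell) (n : nat) (s : nat -> R) (F : R) :
  (forall k i j, (i < n)%nat -> (j < n)%nat -> X k i = X k j -> i = j) ->
  (forall i, (i < n)%nat -> Rabs (s i) <= 1 /\ exists z : Z, s i = IZR z) ->
  sumR s (seq 0 n) = 1 ->
  (forall k, - / 2 * dsum lg (map (fun i => (s i, X k i)) (seq 0 n)) <= F) ->
  exists (phi : nat -> nat) (i0 : nat) (cl : nat -> option cell),
    (forall k, (k <= phi k)%nat) /\ (i0 < n)%nat /\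
    (forall j, match cl j with
      | Some c => evt (fun k => relc (X (phi k) i0) (X (phi k) j) = c)
      | None => forall M, evt (fun k => ~ In (fst (relc (X (phi k) i0) (X (phi k) j))) (bx M)) end) /\
    sumR (fun j => if cl j then s j else 0) (seq 0 n) = 1.
Proof.
  intros Hinj Hs Hsum HF.
  set (f := fun k (t : nat * nat * cell) => delta (relc (X k (fst (fst t))) (X k (snd (fst t)))) (snd t)).
  assert (Hf01 : forall k t, f k t = 0 \/ f k t = 1) by (intros k t; unfold f, delta; destruct (cell_dec _ _); auto).
  destruct (diagonal_enumerable f (fun _ => 1)) as [phi [l [Hphi Hl]]].
  { apply enumerable_prod; [apply enumerable_prod; apply enumerable_nat|apply enumerable_cell]. }
  { intros k t. destruct (Hf01 k t) as [e|e]; rewrite e; [rewrite Rabs_R0|rewrite Rabs_R1]; lra. }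
  set (X' := fun k => X (phi k)).
  assert (Hev : forall i j c, evt (fun k => relc (X' k i) (X' k j) = c) \/ evt (fun k => relc (X' k i) (X' k j) <> c)).
  { intros i j c. destruct (lim_int_const _ _ ltac:(intros k; destruct (Hf01 (phi k) (i, j, c)) as [e|e]; [exists 0%Z|exists 1%Z]; exact e) (Hl (i, j, c))) as [_ H].
    destruct (Req_dec (l (i, j, c)) 1) as [e|ne]; [left|right]; refine (evt_imp _ _ _ H); intros k hk;
      unfold f, delta in hk; cbn [fst snd] in hk; fold (X' k) in hk; destruct (cell_dec _ _); [assumption|lra|lra|assumption]. }
  assert (Hcl : exists cl : nat * nat -> option cell, forall ij, match cl ij with
      | Some c => evt (fun k => relc (X' k (fst ij)) (X' k (snd ij)) = c)
      | None => forall M, evt (fun k => ~ In (fst (relc (X' k (fst ij)) (X' k (snd ij)))) (bx M)) end).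
  { apply (functional_choice_eps (fun (ij : nat * nat) (o : option cell) => match o with
      | Some c => evt (fun k => relc (X' k (fst ij)) (X' k (snd ij)) = c)
      | None => forall M, evt (fun k => ~ In (fst (relc (X' k (fst ij)) (X' k (snd ij)))) (bx M)) end)).
    intros [i j]. cbn [fst snd]. destruct (classic (exists c, evt (fun k => relc (X' k i) (X' k j) = c))) as [[c h]|h].
    - exists (Some c). exact h.
    - exists None. intros M.
      assert (q : evt (fun k => forall c, In c (cells M) -> relc (X' k i) (X' k j) <> c)).
      { apply evt_list. intros c _. destruct (Hev i j c) as [q|q]; [exfalso; apply h; exists c; exact q|exact q]. }
      refine (evt_imp _ _ _ q). intros k hk hin. apply (hk (relc (X' k i) (X' k j))); [apply In_cells; exact hin|reflexivity]. }
  destruct Hcl as [cl Hcl].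
  assert (Hfar : forall i j, cl (i, j) = None -> forall T, evt (fun k => (T <= dist2 (X' k i) (X' k j))%Z)).
  { intros i j e T. assert (q := Hcl (i, j)). rewrite e in q. cbn [fst snd] in q.
    refine (evt_imp _ _ _ (q (Z.to_nat T))). intros k hk. rewrite In_bx in hk.
    assert (h := dist2_supn (X' k i) (X' k j)). unfold relc in hk. cbn [fst] in hk.
    set (v := psub (fst (X' k j)) (fst (X' k i))) in *.
    assert (Z.of_nat (Z.to_nat T) < supn v)%Z by (unfold supn; lia). nia. }
  assert (Hnear : forall i j c, cl (i, j) = Some c -> near X' i j).
  { intros i j c e. assert (q := Hcl (i, j)). rewrite e in q. cbn [fst snd] in q.
    exists (dist2 ((0, 0)%Z, true) c + dist2 ((0, 0)%Z, false) c)%Z. refine (evt_imp _ _ _ q).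
    intros k hk. assert (h := dist2_relc_le (X' k i) (X' k j)). rewrite hk in h. exact h. }
  destruct (cluster_exists X' n s F) as [i0 [hi0 H1]].
  - intros i j. destruct (cl (i, j)) as [c|] eqn:e; [left; apply (Hnear i j c e)|right; apply (Hfar i j e)].
  - intros k. apply Hinj.
  - exact Hs.
  - exact Hsum.
  - intros k. apply HF.
  - exists phi, i0, (fun j => cl (i0, j)). split; [exact Hphi|split; [exact hi0|split]].
    + intros j. apply (Hcl (i0, j)).
    + rewrite <- H1. apply sumR_ext. intros j _.
      destruct (excluded_middle_informative (near X' i0 j)) as [[D h]|h], (cl (i0, j)) as [c|] eqn:e; try reflexivity.
      * exfalso. destruct (evt_ex _ (evt_and _ _ h (Hfar i0 j e (D + 1)%Z))) as [k q]. lia.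
      * exfalso. apply h. apply (Hnear i0 j c e).
Qed.

(** * Recentred configurations *)

(** The displacement is reduced modulo 1, which makes it bounded and gives pointwise limits. Square
    sums are bounded over arbitrary finite lists of bonds, as boxes are not preserved by
    recentring. *)
Record local (psi : R -> R) (n : nat) (s : nat -> R) (K e : R) (r : nat -> cell) (y : pt -> R) (a : flow) : Prop := {
  lc_bound : forall q, Rabs (y q) <= / 2;
  lc_lift : lift_of y a;
  lc_div : forall c, divf a c = sumR (fun i => s i * delta (r i) c) (seq 0 n);
  lc_l2 : forall S, NoDup S -> (forall b, In b S -> (snd b < 3)%nat) ->
    sumR (fun b => (a (fst b) (snd b) - sumR (fun i => s i * ang (r i) (fst b) (snd b)) (seq 0 n)) ^ 2) S <= K;
  lc_min : near_minimal psi y e }.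

Lemma sumR_nth {A : Type} (f : A -> R) (d : A) (l : list A) :
  sumR (fun i => f (nth i l d)) (seq 0 (length l)) = sumR f l.
Proof.
  induction l as [|a l IH]; [reflexivity|]. cbn [length seq sumR nth].
  rewrite <- seq_shift, sumR_map. cbn [nth]. rewrite IH. reflexivity.
Qed.

Lemma src_padd p P j : src (padd p P) j = padd (src p j) P.
Proof. destruct p, P, j as [|[|j]]; unfold src, padd; cbn [fst snd]; f_equal; lia. Qed.
Lemma dst_padd p P j : dst (padd p P) j = padd (dst p j) P.
Proof. destruct p, P, j as [|[|j]]; unfold dst, padd; cbn [fst snd]; f_equal; lia. Qed.

Lemma ang_padd c p P j : ang c (padd p P) j = ang (psub (fst c) P, snd c) p j.
Proof.
  unfold ang.
  replace (dup c (padd p P)) with (dup (psub (fst c) P, snd c) p)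
    by (destruct c as [[x z] t], p, P; lat_unfold; destruct t; ring).
  replace (ddn c (padd p P) j) with (ddn (psub (fst c) P, snd c) p j)
    by (destruct c as [[x z] t], p, P; lat_unfold; destruct (fv j), t; cbn [fst snd]; ring).
  reflexivity.
Qed.

Lemma divf_padd a P c : divf (fun p j => a (padd p P) j) c = divf a (padd (fst c) P, snd c).
Proof.
  destruct c as [p []]; unfold divf; cbn [fst snd]; [reflexivity|]. unfold sum3.
  assert (E : forall j, padd (padd p (fv j)) P = padd (padd p P) (fv j)) by (intros j; destruct p, P, (fv j); pt_eq).
  rewrite !E. reflexivity.
Qed.

(** By periodicity the energy sees a displacement only modulo 1, and the translation is transferred
    to the perturbation. *)
Lemma near_minimal_recentre psi (Y y : pt -> R) P e : (forall x, psi (x + 1) = psi x) ->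
  (forall q, exists k : Z, Y (padd q P) - Y P - y q = IZR k) ->
  near_minimal psi Y e -> near_minimal psi y e.
Proof.
  intros Hper Hy H m v Hv.
  set (v' := fun q => v (psub q P)). set (m' := (m + Z.to_nat (supn P))%nat).
  assert (Ev : forall p j, dlat v' p j = dlat v (psub p P) j).
  { intros p j. unfold dlat, v'. rewrite <- (padd_psub p P) at 1 2. rewrite dst_padd, src_padd, !psub_padd. reflexivity. }
  assert (Hin : forall p, In (psub p P) (bx m) -> In p (bx m')).
  { intros [x z]. destruct P as [X Z]. rewrite !In_bx. unfold m', supn, psub. cbn [fst snd]. lia. }
  assert (Hv' : fin_grad m' v').
  { intros p j hj hp. rewrite Ev. apply Hv; [exact hj|]. intros h. apply hp, Hin, h. }
  eapply Rle_trans; [apply (H m' v' Hv')|]. apply Req_le. unfold bsum.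
  apply (sumR_reindex (fun b : pt * nat => (psub (fst b) P, snd b))); try apply NoDup_bonds.
  - intros [p j] [p' j'] e'. cbn [fst snd] in e'. injection e' as e1 e2 e3. destruct p, p'; cbn [fst snd] in *. f_equal; [f_equal; lia|exact e3].
  - intros [p j] _. cbn [fst snd]. rewrite Ev.
    assert (Hd : exists k : Z, dlat Y p j - dlat y (psub p P) j = IZR k).
    { destruct (Hy (dst (psub p P) j)) as [k1 h1]. destruct (Hy (src (psub p P) j)) as [k2 h2].
      exists (k1 - k2)%Z. rewrite minus_IZR, <- h1, <- h2. rewrite <- dst_padd, <- src_padd, padd_psub. unfold dlat. ring. }
    destruct Hd as [k hk].
    rewrite (psi_eq_mod psi Hper (dlat Y p j) (dlat y (psub p P) j)) by (exists k; exact hk).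
    rewrite (psi_eq_mod psi Hper (dlat Y p j + dlat v (psub p P) j) (dlat y (psub p P) j + dlat v (psub p P) j))
      by (exists k; rewrite <- hk; ring). reflexivity.
  - intros [p j] hb hne. apply In_bonds in hb. cbn [fst snd] in *. apply In_bonds. cbn [fst snd]. split; [|tauto].
    apply NNPP. intros h. apply hne. rewrite Ev, (Hv (psub p P) j ltac:(tauto) h), Rplus_0_r. ring.
  - intros [p j] hb _. apply In_bonds in hb. cbn [fst snd] in hb. exists (padd p P, j). cbn [fst snd]. rewrite psub_padd. split; [|reflexivity].
    apply In_bonds. cbn [fst snd]. split; [|tauto]. apply Hin. rewrite psub_padd. tauto.
Qed.

Lemma config_local psi N K F e y a l P : (forall x, psi (x + 1) = psi x) -> config psi N K F e y a l ->
  local psi (length l) (fun i => divf a (nth i l c0)) K e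
    (fun i => (psub (fst (nth i l c0)) P, snd (nth i l c0)))
    (fun q => nearest (y (padd q P) - y P)) (fun p j => a (padd p P) j).
Proof.
  intros Hper H.
  assert (Hy : forall q, exists k : Z, y (padd q P) - y P - nearest (y (padd q P) - y P) = IZR k) by (intros q; apply nearest_spec).
  split.
  - intros q. apply nearest_spec.
  - intros p j hj. destruct (cf_lift _ _ _ _ _ _ _ _ H (padd p P) j hj) as [h1 [k hk]]. split; [exact h1|].
    destruct (Hy (dst p j)) as [k1 h2]. destruct (Hy (src p j)) as [k2 h3].
    exists (k - k1 + k2)%Z. rewrite plus_IZR, minus_IZR, <- hk, <- h2, <- h3. unfold dlat. rewrite dst_padd, src_padd. ring.
  - intros c. rewrite divf_padd.
    rewrite (sumR_ext _ (fun i => (fun x => divf a x * delta x (padd (fst c) P, snd c)) (nth i l c0))).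
    + rewrite (sumR_nth (fun x => divf a x * delta x (padd (fst c) P, snd c))).
      set (c' := (padd (fst c) P, snd c)).
      rewrite (sumR_support _ l [c']).
      * cbn [sumR]. unfold delta. destruct (cell_dec c' c'); [ring|contradiction].
      * apply H.
      * repeat constructor. intros [].
      * intros x hx. unfold delta in hx. destruct (cell_dec x c') as [ex|nx]; [|exfalso; apply hx; ring].
        subst x. split; [intros; left; reflexivity|]. intros _. apply H. intros h. apply hx. rewrite h. ring.
    + intros i _. f_equal. unfold delta. set (x := nth i l c0). destruct x as [[x z] t], c as [[x' z'] t'], P as [X Z].
      unfold psub, padd. cbn [fst snd].
      destruct (cell_dec _ _) as [e1|n1]; destruct (cell_dec _ _) as [e2|n2]; try reflexivity; exfalso.
      * apply n2. injection e1 as q1 q2 q3. subst. f_equal. f_equal; lia.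
      * apply n1. injection e2 as q1 q2 q3. subst. f_equal. f_equal; lia.
  - intros S HS Hj.
    destruct (list_cells_bounded (map (fun b : pt * nat => (padd (fst b) P, true)) S)) as [M HM].
    eapply Rle_trans; [|apply (cf_l2 _ _ _ _ _ _ _ _ H M)]. unfold bsum.
    rewrite (sumR_ext _ (fun b => (fun b' : pt * nat => (a (fst b') (snd b') - vortex_sum (divf a) l (fst b') (snd b')) ^ 2)
       ((fun b => (padd (fst b) P, snd b)) b))).
    + rewrite <- (sumR_map (fun b' : pt * nat => (a (fst b') (snd b') - vortex_sum (divf a) l (fst b') (snd b')) ^ 2)
         (fun b => (padd (fst b) P, snd b))).
      apply sumR_incl.
      * apply NoDup_map_inj; [|exact HS]. intros [p j] [p' j'] _ _ e'. cbn [fst snd] in e'. injection e' as e1 e2 e3.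
        destruct p, p'; cbn [fst snd] in *. f_equal; [f_equal; lia|exact e3].
      * apply NoDup_bonds.
      * intros b hb. apply in_map_iff in hb. destruct hb as [[p j] [e' hb]]. subst b. apply In_bonds. cbn [fst snd].
        split; [|apply (Hj _ hb)]. apply (HM (padd p P, true)). apply in_map_iff. exists (p, j). auto.
      * intros; apply pow2_ge_0.
    + intros [p j] _. cbn [fst snd]. f_equal. f_equal. unfold vortex_sum.
      rewrite <- (sumR_nth _ c0 l). apply sumR_ext. intros i _. rewrite ang_padd. reflexivity.
  - apply (near_minimal_recentre psi y _ P e Hper Hy). apply H.
Qed.

Lemma local_sequence psi : psi_assumptions psi ->
  exists n s K cl (r : nat -> nat -> cell) y a,
    (forall k, local psi n s K (/ (INR k + 1)) (r k) (y k) (a k)) /\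
    (forall j, match cl j with
      | Some c => evt (fun k => r k j = c)
      | None => forall M, evt (fun k => ~ In (fst (r k j)) (bx M)) end) /\
    sumR (fun j => if cl j : option cell then s j else 0) (seq 0 n) = 1.
Proof.
  intros Hpsi. assert (Hper : forall x, psi (x + 1) = psi x) by apply Hpsi.
  destruct (minimising_sequence psi Hpsi) as [N [K [F H]]].
  destruct (functional_choice_eps (fun k (t : (pt -> R) * flow * list cell) =>
     config psi N K F (/ (INR k + 1)) (fst (fst t)) (snd (fst t)) (snd t))) as [t Ht].
  { intros k. destruct (H k) as [y [a [l h]]]. exists (y, a, l). exact h. }
  set (Y := fun k => fst (fst (t k))) in *. set (A := fun k => snd (fst (t k))) in *. set (L := fun k => snd (t k)) in *.
  assert (Hc : forall k, config psi N K F (/ (INR k + 1)) (Y k) (A k) (L k)) by exact Ht.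
  (* Coordinate 0 is the number of cores and coordinate [i + 1] the charge of the [i]-th. All are
     bounded integers, hence constant along a subsequence. *)
  set (f := fun k i => match i with 0%nat => INR (length (L k)) | S i => divf (A k) (nth i (L k) c0) end).
  assert (Hfint : forall k i, exists z : Z, f k i = IZR z).
  { intros k [|i]; cbn [f]; [exists (Z.of_nat (length (L k))); apply INR_IZR_INZ|]. apply (lift_div_int (Y k)). apply Hc. }
  destruct (diagonal f (fun i => INR N + 1)) as [phi [l [Hphi Hl]]].
  { intros k i. assert (q := pos_INR N). destruct i as [|i]; cbn [f].
    - rewrite Rabs_pos_eq by apply pos_INR. assert (h := le_INR _ _ (cf_len _ _ _ _ _ _ _ _ (Hc k))). lra.
    - assert (h := lift_div_abs (Y k) (A k) (cf_lift _ _ _ _ _ _ _ _ (Hc k)) (nth i (L k) c0)). lra. }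
  assert (Hev : forall i, evt (fun k => f (phi k) i = l i)) by (intros i; apply (lim_int_const _ _ (fun k => Hfint (phi k) i) (Hl i))).
  assert (Hlen : exists n, (n <= N)%nat /\ evt (fun k => length (L (phi k)) = n)).
  { destruct (evt_ex _ (Hev 0%nat)) as [k0 h0]. exists (length (L (phi k0))). split; [apply Hc|].
    refine (evt_imp _ _ _ (Hev 0%nat)). intros k hk. apply INR_eq. cbn [f] in *. congruence. }
  destruct Hlen as [n [Hn Hlen]].
  assert (Hall : evt (fun k => length (L (phi k)) = n /\ forall i, In i (seq 1 n) -> f (phi k) i = l i)).
  { apply evt_and; [exact Hlen|]. apply evt_list. intros; apply Hev. }
  destruct Hall as [k1 Hall].
  set (ph := fun k => phi (k + k1)%nat).
  assert (Hph : forall k, (k <= ph k)%nat) by (intros k; unfold ph; specialize (Hphi (k + k1)%nat); lia).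
  set (s := fun i => l (S i)).
  assert (Hlk : forall k, length (L (ph k)) = n) by (intros k; apply Hall; lia).
  assert (Hsk : forall k i, (i < n)%nat -> divf (A (ph k)) (nth i (L (ph k)) c0) = s i).
  { intros k i hi. apply (proj2 (Hall (k + k1)%nat ltac:(lia)) (S i)). apply in_seq. lia. }
  set (X := fun k i => nth i (L (ph k)) c0).
  assert (Hsums : forall k (g : R -> cell -> R), sumR (fun i => g (s i) (X k i)) (seq 0 n) = sumR (fun c => g (divf (A (ph k)) c) c) (L (ph k))).
  { intros k g. rewrite <- (sumR_nth _ c0 (L (ph k))), Hlk. apply sumR_ext. intros i hi. apply in_seq in hi.
    rewrite Hsk by lia. reflexivity. }
  destruct (cluster_limit X n s F) as [th [i0 [cl [Hth [hi0 [Hcl Hsum]]]]]].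
  - intros k i j hi hj e. apply (NoDup_nth (L (ph k)) c0); [apply Hc|rewrite Hlk; exact hi|rewrite Hlk; exact hj|exact e].
  - intros i hi. rewrite <- (Hsk 0%nat i hi). split.
    + apply (lift_div_abs (Y (ph 0%nat))). apply Hc.
    + apply (lift_div_int (Y (ph 0%nat))). apply Hc.
  - rewrite <- (cf_total _ _ _ _ _ _ _ _ (Hc (ph 0%nat))), total_charges. apply (Hsums 0%nat (fun x _ => x)).
  - intros k. eapply Rle_trans; [|apply (cf_log _ _ _ _ _ _ _ _ (Hc (ph k)))]. apply Req_le. f_equal.
    unfold dsum, charges. rewrite !sumR_map. cbn [fst snd].
    rewrite <- (Hsums k (fun x c => sumR (fun y => x * fst y * lg c (snd y)) (map (fun c => (divf (A (ph k)) c, c)) (L (ph k))))).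
    apply sumR_ext. intros i _. rewrite !sumR_map. cbn [fst snd].
    apply (Hsums k (fun x c => s i * x * lg (X k i) c)).
  - set (w := fun k => ph (th k)).
    assert (Hw : forall k, (k <= w k)%nat) by (intros k; unfold w; specialize (Hph (th k)); specialize (Hth k); lia).
    set (P := fun k => fst (X (th k) i0)).
    exists n, s, K, cl, (fun k i => relc (X (th k) i0) (X (th k) i)),
      (fun k q => nearest (Y (w k) (padd q (P k)) - Y (w k) (P k))), (fun k p j => A (w k) (padd p (P k)) j).
    split; [|split; [exact Hcl|exact Hsum]].
    intros k. destruct (config_local psi N K F _ _ _ _ (P k) Hper (Hc (w k))) as [h1 h2 h3 h4 h5].
    unfold w in h3, h4. rewrite Hlk in h3, h4.
    assert (Es : forall g : nat -> R, sumR (fun i => divf (A (ph (th k))) (nth i (L (ph (th k))) c0) * g i) (seq 0 n)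
       = sumR (fun i => s i * g i) (seq 0 n)).
    { intros g. apply sumR_ext. intros i hi. apply in_seq in hi. rewrite Hsk by lia. reflexivity. }
    split.
    + exact h1.
    + exact h2.
    + intros c. unfold w. rewrite h3. apply Es.
    + intros S HS Hj. eapply Rle_trans; [|apply (h4 S HS Hj)]. apply Req_le. apply sumR_ext. intros b _.
      f_equal. f_equal. symmetry. apply Es.
    + intros m v Hv. eapply Rle_trans; [|apply (h5 m v Hv)]. apply Ropp_le_contravar.
      apply Rinv_le_contravar; [assert (q := pos_INR k); lra|]. assert (q := le_INR _ _ (Hw k)). lra.
Qed.

(** * The limit *)

Lemma ang_small d : 0 < d -> exists N : Z, forall c p j, (N <= supn (psub p (fst c)))%Z -> Rabs (ang c p j) < d.
Proof.
  intros Hd. exists (up (2 / d)). intros c p j h. eapply Rle_lt_trans; [apply ang_bound|].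
  apply IZR_le in h. destruct (archimed (2 / d)) as [q _].
  assert (q1 := NN_ge1 c p). assert (q2 : 2 / d < NN c p) by (unfold NN; lra).
  apply Rmult_lt_reg_r with (NN c p); [lra|]. rewrite Rmult_assoc, Rinv_l by lra.
  apply Rmult_lt_compat_l with (r := d) in q2; [|exact Hd]. replace (d * (2 / d)) with 2 in q2 by (field; lra). lra.
Qed.

Lemma vortex_decay (I : list item) d : 0 < d ->
  exists M, forall p j, ~ In p (bx M) -> Rabs (sumR (fun x : item => fst x * ang (snd x) p j) I) < d.
Proof.
  revert d. induction I as [|[s c] I IH]; intros d Hd.
  - exists 0%nat. intros p j _. cbn [sumR]. rewrite Rabs_R0. exact Hd.
  - destruct (IH (d / 2) ltac:(lra)) as [M HM].
    assert (Hs := Rabs_pos s).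
    destruct (ang_small (d / 2 * / (Rabs s + 1))) as [N HN].
    { apply Rmult_lt_0_compat; [lra|apply Rinv_0_lt_compat; lra]. }
    exists (M + Z.to_nat (supn (fst c)) + Z.to_nat N)%nat. intros p j hp. cbn [sumR fst snd].
    eapply Rle_lt_trans; [apply Rabs_triang|].
    assert (h1 := HM p j ltac:(intros h; apply hp; revert h; apply bx_mono; lia)).
    assert (h2 : Rabs (ang c p j) < d / 2 * / (Rabs s + 1)).
    { apply HN. rewrite In_bx in hp. destruct p as [x z], c as [[x' z'] t]. unfold supn, psub in *. cbn [fst snd] in *. lia. }
    assert (h3 : Rabs (s * ang c p j) <= d / 2).
    { rewrite Rabs_mult. apply Rle_trans with ((Rabs s + 1) * (d / 2 * / (Rabs s + 1))).
      - apply Rmult_le_compat; [lra|apply Rabs_pos|lra|lra].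
      - apply Req_le. field. lra. }
    lra.
Qed.

Lemma lim_inv_succ : is_lim_seq (fun k => - / (INR k + 1)) 0.
Proof.
  apply is_lim_seq_spec. intros e. destruct (INR_unbounded (/ e)) as [N HN]. exists N. intros k hk.
  assert (He := cond_pos e). assert (q := le_INR _ _ hk). assert (q0 := pos_INR k).
  rewrite Rminus_0_r, Rabs_Ropp, Rabs_pos_eq by (left; apply Rinv_0_lt_compat; lra).
  rewrite <- (Rinv_inv e). apply Rinv_lt_contravar; [|lra].
  apply Rmult_lt_0_compat; [apply Rinv_0_lt_compat; exact He|lra].
Qed.

(** Every requirement survives pointwise limits: the integers of the lift are eventually constant,
    cores either settle or escape with vanishing contribution at each fixed bond, and minimality
    concerns a finite sum of continuous terms for each fixed perturbation. *)
Lemma limit_exists psi : psi_assumptions psi ->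
  exists (y : pt -> R) (a : flow) (I : list item), lift_of y a /\ total I = 1 /\
    (forall c, divf a c = charge_at I c) /\
    (forall d, 0 < d -> exists M, forall p j, (j < 3)%nat -> ~ In p (bx M) -> Rabs (a p j) < d) /\
    near_minimal psi y 0.
Proof.
  intros Hpsi. destruct (local_sequence psi Hpsi) as [n [s [K [cl [r [y [a [Hloc [Hcl Hsum]]]]]]]]].
  assert (Hcont : forall x, continuous psi x) by apply Hpsi.
  (* One family holds both objects: the flow at the indices below 3 and the displacement at the
     others, of which 3 is read. *)
  set (f := fun k (t : pt * nat) => if lt_dec (snd t) 3 then a k (fst t) (snd t) else y k (fst t)).
  destruct (diagonal_enumerable f (fun _ => / 2)) as [phi [l [Hphi Hl]]].
  { apply enumerable_prod; [apply enumerable_pt|apply enumerable_nat]. }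
  { intros k [p j]. unfold f. cbn [fst snd]. destruct (lt_dec j 3) as [h|h].
    - apply (lc_lift _ _ _ _ _ _ _ _ (Hloc k) p j h).
    - apply (lc_bound _ _ _ _ _ _ _ _ (Hloc k)). }
  set (yl := fun q => l (q, 3%nat)). set (al := fun p j => l (p, j)).
  assert (Hyl : forall q, is_lim_seq (fun k => y (phi k) q) (yl q)) by (intros q; exact (Hl (q, 3%nat))).
  assert (Hal : forall p j, (j < 3)%nat -> is_lim_seq (fun k => a (phi k) p j) (al p j)).
  { intros p j hj. assert (h := Hl (p, j)). unfold f in h. cbn [fst snd] in h. destruct (lt_dec j 3); [exact h|contradiction]. }
  assert (Hdl : forall p j, is_lim_seq (fun k => dlat (y (phi k)) p j) (dlat yl p j)).
  { intros p j. apply (is_lim_seq_minus' _ _ _ _ (Hyl (dst p j)) (Hyl (src p j))). }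
  (* Escaping cores are kept as items of charge 0, at an arbitrary position, so that the list
     retains its length. *)
  set (it := fun i => match cl i with Some c => (s i, c) | None => (0, c0) end).
  set (I := map it (seq 0 n)).
  assert (Hvor : forall (g : cell -> R), (forall i, cl i = None -> is_lim_seq (fun k => g (r (phi k) i)) 0) ->
     is_lim_seq (fun k => sumR (fun i => s i * g (r (phi k) i)) (seq 0 n)) (sumR (fun x : item => fst x * g (snd x)) I)).
  { intros g Hg. unfold I. rewrite sumR_map. apply (lim_sumR (fun k i => s i * g (r (phi k) i))). intros i _.
    unfold it. assert (q := Hcl i). destruct (cl i) as [c|] eqn:e; cbn [fst snd].
    - apply lim_evt_const. refine (evt_imp _ _ _ (evt_sub _ phi Hphi q)). intros k hk. rewrite hk. reflexivity.
    - replace (0 * g c0) with (s i * 0) by ring. apply (is_lim_seq_mult' (fun _ => s i)); [apply is_lim_seq_const|apply Hg; exact e]. }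
  assert (Hang : forall p j, is_lim_seq (fun k => sumR (fun i => s i * ang (r (phi k) i) p j) (seq 0 n))
     (sumR (fun x : item => fst x * ang (snd x) p j) I)).
  { intros p j. apply (Hvor (fun c => ang c p j)). intros i e. assert (q := Hcl i). rewrite e in q.
    apply is_lim_seq_spec. intros d. destruct (ang_small d (cond_pos d)) as [N HN].
    refine (evt_imp _ _ _ (evt_sub _ phi Hphi (q (Z.to_nat (supn p) + Z.to_nat N)%nat))). intros k hk.
    rewrite Rminus_0_r. apply HN. rewrite In_bx in hk. destruct p as [x z], (r (phi k) i) as [[x' z'] t].
    unfold supn, psub in *. cbn [fst snd] in *. lia. }
  exists yl, al, I. split; [|split; [|split; [|split]]].
  - intros p j hj. split.
    + assert (q := is_lim_seq_abs _ _ (Hal p j hj)).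
      apply (is_lim_seq_le (fun k => Rabs (a (phi k) p j)) (fun _ => / 2) (Rabs (al p j)) (/ 2));
        [|exact q|apply is_lim_seq_const].
      intros k. apply (lc_lift _ _ _ _ _ _ _ _ (Hloc (phi k)) p j hj).
    + apply (lim_int_const (fun k => dlat (y (phi k)) p j - a (phi k) p j)).
      * intros k. apply (lc_lift _ _ _ _ _ _ _ _ (Hloc (phi k)) p j hj).
      * apply is_lim_seq_minus'; [apply Hdl|apply Hal; exact hj].
  - unfold total, I. rewrite sumR_map, <- Hsum. apply sumR_ext. intros i _. unfold it. destruct (cl i); reflexivity.
  - intros c.
    assert (H1 : is_lim_seq (fun k => divf (a (phi k)) c) (divf al c)).
    { destruct c as [p []]; unfold divf, sum3; cbn [fst snd].
      - repeat apply is_lim_seq_plus'; apply Hal; lia.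
      - apply (is_lim_seq_opp (fun k => a (phi k) (padd p (fv 0)) 0%nat + a (phi k) (padd p (fv 1)) 1%nat + a (phi k) (padd p (fv 2)) 2%nat)
          (Finite (al (padd p (fv 0)) 0%nat + al (padd p (fv 1)) 1%nat + al (padd p (fv 2)) 2%nat))).
        repeat apply is_lim_seq_plus'; apply Hal; lia. }
    assert (H2 : is_lim_seq (fun k => divf (a (phi k)) c) (charge_at I c)).
    { apply (is_lim_seq_ext (fun k => sumR (fun i => s i * delta c (r (phi k) i)) (seq 0 n))).
      - intros k. rewrite (lc_div _ _ _ _ _ _ _ _ (Hloc (phi k)) c). apply sumR_ext. intros i _. rewrite delta_sym. reflexivity.
      - apply (Hvor (delta c)). intros i e. assert (q := Hcl i). rewrite e in q. apply lim_evt_const.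
        destruct (list_cells_bounded [c]) as [M HM]. specialize (HM c ltac:(left; reflexivity)).
        refine (evt_imp _ _ _ (evt_sub _ phi Hphi (q M))). intros k hk. unfold delta.
        destruct (cell_dec c (r (phi k) i)) as [e'|e']; [|reflexivity]. exfalso. apply hk. rewrite <- e'. exact HM. }
    assert (E := is_lim_seq_unique _ _ H1). rewrite (is_lim_seq_unique _ _ H2) in E. congruence.
  - intros d Hd.
    destruct (vortex_decay I (d / 2) ltac:(lra)) as [M1 HM1].
    destruct (summable_tail (fun b => (al (fst b) (snd b) - sumR (fun x : item => fst x * ang (snd x) (fst b) (snd b)) I) ^ 2) K) with (d := (d / 2) ^ 2) as [M2 HM2].
    (* The bound on square sums over finite lists passes to the limit, so the remainder is small
       outside some box, like the finite superposition of vortices. *)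
    + intros S HS Hj.
      apply (is_lim_seq_le (fun k => sumR (fun b => (a (phi k) (fst b) (snd b) - sumR (fun i => s i * ang (r (phi k) i) (fst b) (snd b)) (seq 0 n)) ^ 2) S)
         (fun _ => K) (Finite _) (Finite K)); [|apply lim_sumR|apply is_lim_seq_const].
      * intros k. apply (lc_l2 _ _ _ _ _ _ _ _ (Hloc (phi k)) S HS Hj).
      * intros b hb.
        assert (q : is_lim_seq (fun k => a (phi k) (fst b) (snd b) - sumR (fun i => s i * ang (r (phi k) i) (fst b) (snd b)) (seq 0 n))
           (al (fst b) (snd b) - sumR (fun x : item => fst x * ang (snd x) (fst b) (snd b)) I)).
        { apply is_lim_seq_minus'; [apply Hal; apply Hj; exact hb|apply Hang]. }
        assert (q2 := is_lim_seq_mult' _ _ _ _ q q).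
        eapply is_lim_seq_ext; [|replace (_ ^ 2) with ((al (fst b) (snd b) - sumR (fun x : item => fst x * ang (snd x) (fst b) (snd b)) I) * (al (fst b) (snd b) - sumR (fun x : item => fst x * ang (snd x) (fst b) (snd b)) I)) by ring; exact q2].
        intros k. cbn beta. ring.
    + apply pow_lt. lra.
    + exists (M1 + M2)%nat. intros p j hj hp.
      assert (h1 := HM1 p j ltac:(intros h; apply hp; revert h; apply bx_mono; lia)).
      assert (h2 := HM2 p j hj ltac:(intros h; apply hp; revert h; apply bx_mono; lia)). cbn [fst snd] in h2.
      set (V := sumR (fun x : item => fst x * ang (snd x) p j) I) in *.
      assert (h3 : Rabs (al p j - V) <= d / 2) by (apply abs_le_of_sq; lra).
      replace (al p j) with ((al p j - V) + V) by ring. eapply Rle_lt_trans; [apply Rabs_triang|]. lra.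
  - intros m u Hu. rewrite Ropp_0.
    apply (is_lim_seq_le (fun k => - / (INR k + 1)) (fun k => bsum m (fun p j => psi (dlat (y (phi k)) p j + dlat u p j) - psi (dlat (y (phi k)) p j)))
       (Finite 0) (Finite _)); [|apply lim_inv_succ|].
    + intros k. eapply Rle_trans; [|apply (lc_min _ _ _ _ _ _ _ _ (Hloc (phi k)) m u Hu)]. apply Ropp_le_contravar.
      apply Rinv_le_contravar; [assert (q := pos_INR k); lra|]. assert (q := le_INR _ _ (Hphi k)). lra.
    + unfold bsum. apply (lim_sumR (fun k (b : pt * nat) => psi (dlat (y (phi k)) (fst b) (snd b) + dlat u (fst b) (snd b)) - psi (dlat (y (phi k)) (fst b) (snd b)))
        (fun b => psi (dlat yl (fst b) (snd b) + dlat u (fst b) (snd b)) - psi (dlat yl (fst b) (snd b)))).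
      intros b _.
      assert (Hpc : forall (x : nat -> R) (z : R), is_lim_seq x z -> is_lim_seq (fun k => psi (x k)) (psi z)).
      { intros x z hx. apply (filterlim_comp _ _ _ x psi _ (locally z)); [exact hx|apply Hcont]. }
      apply is_lim_seq_minus'; apply Hpc; [|apply Hdl].
      apply is_lim_seq_plus'; [apply Hdl|apply is_lim_seq_const].
Qed.

(** * Bonds as ordered pairs *)

Lemma is_bond_qz b : is_bond b <-> qz (psub (snd b) (fst b)) = 1%Z.
Proof.
  destruct b as [[x y] [x' y']]. unfold is_bond, posx, posy, qz, psub. cbn [fst snd].
  assert (E : (/ 2 + IZR x' + IZR y' / 2 - (/ 2 + IZR x + IZR y / 2)) ^ 2 +
    (sqrt 3 / 6 + IZR y' * (sqrt 3 / 2) - (sqrt 3 / 6 + IZR y * (sqrt 3 / 2))) ^ 2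
    = IZR ((x' - x) * (x' - x) + (x' - x) * (y' - y) + (y' - y) * (y' - y))).
  { rewrite !plus_IZR, !mult_IZR, !minus_IZR. destruct sqrt3_bounds as [h _].
    replace ((sqrt 3 / 6 + IZR y' * (sqrt 3 / 2) - (sqrt 3 / 6 + IZR y * (sqrt 3 / 2))) ^ 2)
      with ((sqrt 3 * sqrt 3) * (IZR y' - IZR y) ^ 2 / 4) by field.
    rewrite h. field. }
  rewrite E. split; [intros h; apply (eq_IZR _ 1); exact h|intros h; rewrite h; reflexivity].
Qed.

Definition fwd (b : pt * nat) : bond := (src (fst b) (snd b), dst (fst b) (snd b)).
(* The [p] for which [fwd (p, j)] starts at [q]. *)
Definition base (q : pt) (j : nat) : pt := psub q (src (0, 0)%Z j).

Lemma is_bond_fwd b : is_bond (fwd b) /\ is_bond (opp_bond (fwd b)).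
Proof.
  destruct b as [[x y] j]. rewrite !is_bond_qz. unfold fwd, opp_bond, src, dst, padd, psub, qz. destruct j as [|[|j]]; cbn [fst snd]; lia.
Qed.

Lemma bond_cases b : is_bond b -> exists e, (snd e < 3)%nat /\ (b = fwd e \/ b = opp_bond (fwd e)).
Proof.
  intros H. apply is_bond_qz in H. destruct b as [[x y] [x' y']].
  assert (Hd : exists d1 d2, x' = (x + d1)%Z /\ y' = (y + d2)%Z) by (exists (x' - x)%Z, (y' - y)%Z; lia).
  destruct Hd as [d1 [d2 [e1 e2]]]. subst x' y'. unfold qz, psub in H. cbn [fst snd] in H.
  replace (x + d1 - x)%Z with d1 in H by ring. replace (y + d2 - y)%Z with d2 in H by ring.
  assert (B1 : (-1 <= d1 <= 1)%Z) by nia. assert (B2 : (-1 <= d2 <= 1)%Z) by nia.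
  assert (C1 : (d1 = -1 \/ d1 = 0 \/ d1 = 1)%Z) by lia. assert (C2 : (d2 = -1 \/ d2 = 0 \/ d2 = 1)%Z) by lia.
  destruct C1 as [e|[e|e]], C2 as [e'|[e'|e']]; subst d1 d2; try (exfalso; lia).
  - exists ((x - 1, y)%Z, 2%nat). split; [cbn; lia|]. right. unfold opp_bond, fwd, src, dst, padd; cbn [fst snd]. apply (f_equal2 pair); apply (f_equal2 pair); lia.
  - exists ((x - 1, y)%Z, 0%nat). split; [cbn; lia|]. left. unfold opp_bond, fwd, src, dst, padd; cbn [fst snd]. apply (f_equal2 pair); apply (f_equal2 pair); lia.
  - exists ((x, y - 1)%Z, 1%nat). split; [cbn; lia|]. left. unfold opp_bond, fwd, src, dst, padd; cbn [fst snd]. apply (f_equal2 pair); apply (f_equal2 pair); lia.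
  - exists ((x, y)%Z, 1%nat). split; [cbn; lia|]. right. unfold opp_bond, fwd, src, dst, padd; cbn [fst snd]. apply (f_equal2 pair); apply (f_equal2 pair); lia.
  - exists ((x, y - 1)%Z, 0%nat). split; [cbn; lia|]. right. unfold opp_bond, fwd, src, dst, padd; cbn [fst snd]. apply (f_equal2 pair); apply (f_equal2 pair); lia.
  - exists ((x, y)%Z, 2%nat). split; [cbn; lia|]. left. unfold opp_bond, fwd, src, dst, padd; cbn [fst snd]. apply (f_equal2 pair); apply (f_equal2 pair); lia.
Qed.

Ltac fwd_inj h := unfold opp_bond, fwd, src, dst, padd in h; cbn [fst snd] in h; injection h as ? ? ? ?.

Lemma fwd_inj b b' : (snd b < 3)%nat -> (snd b' < 3)%nat -> fwd b = fwd b' -> b = b'.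
Proof.
  intros h h' H. destruct b as [[x y] j], b' as [[x' y'] j']. cbn [snd] in *.
  destruct j as [|[|[|j]]]; [| | |lia]; destruct j' as [|[|[|j']]]; try lia; fwd_inj H; try (exfalso; lia); repeat f_equal; lia.
Qed.

Lemma fwd_opp b b' : (snd b < 3)%nat -> (snd b' < 3)%nat -> fwd b <> opp_bond (fwd b').
Proof.
  intros h h' H. destruct b as [[x y] j], b' as [[x' y'] j']. cbn [snd] in *.
  destruct j as [|[|[|j]]]; [| | |lia]; destruct j' as [|[|[|j']]]; try lia; fwd_inj H; lia.
Qed.

Lemma base_fwd b : base (fst (fwd b)) (snd b) = fst b.
Proof. destruct b as [[x y] j]. unfold base, fwd, src, padd, psub. destruct j as [|[|j]]; cbn [fst snd]; f_equal; lia. Qed.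

(** The antisymmetric extension of a flow to ordered pairs: for each type [j], the pair is compared
    with the one bond of that type that starts at either end. *)
Definition form (a : flow) (b : bond) : R :=
  sum3 (fun j => (if pt_dec (snd b) (dst (base (fst b) j) j) then a (base (fst b) j) j else 0)
    - (if pt_dec (fst b) (dst (base (snd b) j) j) then a (base (snd b) j) j else 0)).

Lemma form_opp a b : form a (opp_bond b) = - form a b.
Proof. unfold form, sum3, opp_bond. cbn [fst snd]. ring. Qed.

Lemma form_fwd a b : (snd b < 3)%nat -> form a (fwd b) = a (fst b) (snd b).
Proof.
  destruct b as [p j]. cbn [fst snd]. intros hj.
  assert (Hb : base (fst (fwd (p, j))) j = p) by apply (base_fwd (p, j)).
  assert (H1 : forall i, (i < 3)%nat -> i <> j -> snd (fwd (p, j)) <> dst (base (fst (fwd (p, j))) i) i).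
  { intros i hi hne e. apply hne. enough ((base (fst (fwd (p, j))) i, i) = (p, j)) by congruence.
    apply fwd_inj; [exact hi|exact hj|]. unfold fwd at 1. cbn [fst snd]. rewrite <- e.
    rewrite (surjective_pairing (fwd (p, j))) at 3. f_equal.
    destruct (fst (fwd (p, j))) as [x y], i as [|[|i]]; unfold base, src, padd, psub; cbn [fst snd]; f_equal; lia. }
  assert (H2 : forall i, (i < 3)%nat -> fst (fwd (p, j)) <> dst (base (snd (fwd (p, j))) i) i).
  { intros i hi e. apply (fwd_opp (base (snd (fwd (p, j))) i, i) (p, j) hi hj). unfold fwd at 1. cbn [fst snd]. rewrite <- e.
    unfold opp_bond. f_equal.
    destruct (snd (fwd (p, j))) as [x y], i as [|[|i]]; unfold base, src, padd, psub; cbn [fst snd]; f_equal; lia. }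
  assert (T : forall i, (i < 3)%nat ->
    (if pt_dec (snd (fwd (p, j))) (dst (base (fst (fwd (p, j))) i) i) then a (base (fst (fwd (p, j))) i) i else 0)
    - (if pt_dec (fst (fwd (p, j))) (dst (base (snd (fwd (p, j))) i) i) then a (base (snd (fwd (p, j))) i) i else 0)
    = if Nat.eq_dec i j then a p j else 0).
  { intros i hi. destruct (pt_dec (fst (fwd (p, j))) _) as [e|_]; [exfalso; apply (H2 i hi e)|].
    destruct (Nat.eq_dec i j) as [e|ne].
    - subst i. rewrite Hb. destruct (pt_dec _ _) as [_|n]; [ring|]. exfalso. apply n. reflexivity.
    - destruct (pt_dec _ _) as [e|_]; [exfalso; apply (H1 i hi ne e)|ring]. }
  unfold form, sum3. rewrite !T by lia.
  destruct j as [|[|[|j]]]; [| | |lia]; destruct (Nat.eq_dec 0 _), (Nat.eq_dec 1 _), (Nat.eq_dec 2 _); try lia; ring.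
Qed.

(** The counterclockwise boundary runs along the reference orientation of the sides of an up cell
    and against it on a down cell, which is the sign in [divf]. *)
Lemma circ_form a c : circ (form a) c = divf a c.
Proof.
  destruct c as [[x y] []]; unfold circ, divf, cell_vertices, sum3, Defs.shift; cbn [fst snd].
  - assert (F : forall q j, (j < 3)%nat -> a q j = form a (fwd (q, j))) by
      (intros q j hj; rewrite form_fwd by exact hj; reflexivity).
    rewrite !F by lia. unfold fwd, src, dst, padd. cbn [fst snd]. rewrite !Z.add_0_r. ring.
  - assert (F : forall q j, (j < 3)%nat -> a q j = - form a (opp_bond (fwd (q, j)))) by
      (intros q j hj; rewrite form_opp, form_fwd by exact hj; cbn [fst snd]; ring).
    rewrite !F by lia. unfold opp_bond, fwd, src, dst, padd, fv. cbn [fst snd].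
    rewrite !Z.add_0_r. ring.
Qed.

Lemma form_in_Dy y a : lift_of y a -> in_Dy y (form a).
Proof.
  intros H b hb. split; [|split; [apply form_opp|]]; destruct (bond_cases b hb) as [e [he [E|E]]]; subst b;
    rewrite ?form_opp, form_fwd by exact he; destruct (H (fst e) (snd e) he) as [h [k hk]].
  - apply Rabs_le_between in h. lra.
  - apply Rabs_le_between in h. lra.
  - exists k. exact hk.
  - exists (- k)%Z. rewrite opp_IZR, <- hk. unfold Defs.D, opp_bond, fwd, dlat. cbn [fst snd]. ring.
Qed.

Lemma bond_dist_nonneg b : 0 <= bond_dist b.
Proof. apply sqrt_pos. Qed.

Lemma form_decays a : (forall d, 0 < d -> exists M, forall p j, (j < 3)%nat -> ~ In p (bx M) -> Rabs (a p j) < d) ->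
  decays (form a).
Proof.
  intros H d Hd. destruct (H d Hd) as [M HM].
  (* Any common bound for the distances of the finitely many bonds of the box will do; their sum is
     one. *)
  set (g := fun e => bond_dist (fwd e) + bond_dist (opp_bond (fwd e))).
  exists (sumR g (bonds M)). intros b hb hR. destruct (bond_cases b hb) as [e [he E]].
  assert (Ea : Rabs (form a b) = Rabs (a (fst e) (snd e))).
  { destruct E as [E|E]; subst b; rewrite ?form_opp, ?Rabs_Ropp, form_fwd by exact he; reflexivity. }
  rewrite Ea. apply HM; [exact he|]. intros hin.
  assert (q : sumR g [e] <= sumR g (bonds M)).
  { apply sumR_incl; [repeat constructor; intros []|apply NoDup_bonds| |].
    - intros x [h|[]]. subst x. apply In_bonds. auto.
    - intros x _. unfold g. assert (h1 := bond_dist_nonneg (fwd x)). assert (h2 := bond_dist_nonneg (opp_bond (fwd x))). lra. }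
  cbn [sumR] in q. unfold g at 1 in q. assert (h1 := bond_dist_nonneg (fwd e)). assert (h2 := bond_dist_nonneg (opp_bond (fwd e))).
  destruct E as [E|E]; subst b; lra.
Qed.

Lemma form_burgers y a (I : list item) : lift_of y a -> total I = 1 -> (forall c, divf a c = charge_at I c) ->
  (forall d, 0 < d -> exists M, forall p j, (j < 3)%nat -> ~ In p (bx M) -> Rabs (a p j) < d) ->
  net_burgers y 1.
Proof.
  intros Hl Ht Hdiv Hd. exists (form a). split; [apply form_in_Dy; exact Hl|split; [apply form_decays; exact Hd|]].
  destruct (list_cells_bounded (map snd I)) as [M HM].
  set (nz := fun c : cell => if Req_EM_T (divf a c) 0 then false else true).
  assert (Hsupp : forall c, divf a c <> 0 -> In c (cells M)).
  { intros c hc. apply NNPP. intros h. apply hc. rewrite Hdiv. unfold charge_at. apply sumR_0. intros x hx.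
    unfold delta. destruct (cell_dec c (snd x)) as [e|_]; [|ring]. exfalso. apply h. apply In_cells, HM. rewrite e. apply in_map, hx. }
  assert (Hin : forall c, In c (filter nz (cells M)) <-> divf a c <> 0).
  { intros c. rewrite filter_In. unfold nz. destruct (Req_EM_T (divf a c) 0) as [e|n].
    - split; [intros [_ h]; discriminate|intros h; contradiction].
    - split; [auto|]. intros _. split; [apply Hsupp; exact n|reflexivity]. }
  assert (N : NoDup (filter nz (cells M))) by (apply NoDup_filter, NoDup_cells).
  exists (filter nz (cells M)). split; [exact N|split].
  - intros c. rewrite circ_form. apply Hin.
  - rewrite (sumR_ext _ (divf a)) by (intros; apply circ_form).
    rewrite (sumR_support _ _ (cells M) N (NoDup_cells M)).
    + rewrite (sumR_ext _ (charge_at I)) by (intros; apply Hdiv). unfold charge_at. rewrite sumR_exchange, <- Ht. unfold total.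
      apply sumR_ext. intros x hx. rewrite sumR_scal.
      rewrite (sumR_ext _ (delta (snd x))) by (intros; apply delta_sym).
      rewrite sum_delta_cells; [ring|]. apply In_cells, HM, in_map, hx.
    + intros c hc. rewrite Hin. split; [intros; apply Hsupp; exact hc|auto].
Qed.

(** As [psi] is even, the two orientations of a bond contribute equally, so the sum over ordered
    bonds is twice the one in [near_minimal]. Finiteness of the list gives the box that contains all
    bonds where [u] varies. *)
Lemma minimal_stable psi y : (forall x, psi (- x) = psi x) -> near_minimal psi y 0 -> globally_stable psi y.
Proof.
  intros Hev H u _ L NL HL HuL.
  set (f := fun b => psi (Defs.D y b + Defs.D u b) - psi (Defs.D y b)).
  destruct (list_cells_bounded (flat_map (fun b => map (fun j => (base (fst b) j, true)) [0%nat; 1%nat; 2%nat]) L)) as [M HM].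
  assert (Hfin : fin_grad M u).
  { intros p j hj hp. apply NNPP. intros h. apply hp. apply (HM (p, true)). apply in_flat_map. exists (fwd (p, j)). split.
    - apply HuL; [apply is_bond_fwd|exact h].
    - apply in_map_iff. exists j. split; [f_equal; apply (base_fwd (p, j))|]. cbn [In]. lia. }
  assert (Hopp : forall e, f (opp_bond (fwd e)) = f (fwd e)).
  { intros e. unfold f. assert (E : forall w, Defs.D w (opp_bond (fwd e)) = - Defs.D w (fwd e)) by (intros w; unfold Defs.D, opp_bond; cbn [fst snd]; ring).
    rewrite !E, <- Ropp_plus_distr, !Hev. reflexivity. }
  assert (Hnz : forall b, f b <> 0 -> Defs.D u b <> 0).
  { intros b hb e. apply hb. unfold f. rewrite e, Rplus_0_r. ring. }
  rewrite (sumR_support f L (map fwd (bonds M) ++ map (fun e => opp_bond (fwd e)) (bonds M)) NL).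
  - rewrite sumR_app, !sumR_map, (sumR_ext (fun e => f (opp_bond (fwd e))) (fun e => f (fwd e))) by (intros; apply Hopp).
    assert (q := H M u Hfin). rewrite Ropp_0 in q. unfold bsum in q.
    change (0 <= sumR (fun e => f (fwd e)) (bonds M)) in q. lra.
  - assert (Hi : forall e e', In e (bonds M) -> In e' (bonds M) -> fwd e = fwd e' -> e = e').
    { intros e e' h h'. apply In_bonds in h, h'. apply fwd_inj; tauto. }
    apply NoDup_app.
    + apply NoDup_map_inj; [exact Hi|apply NoDup_bonds].
    + apply NoDup_map_inj; [|apply NoDup_bonds]. intros e e' h h' E. apply Hi; [exact h|exact h'|].
      unfold opp_bond in E. rewrite (surjective_pairing (fwd e)), (surjective_pairing (fwd e')). congruence.
    + intros b hb hb'. apply in_map_iff in hb, hb'. destruct hb as [e [E he]], hb' as [e' [E' he']].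
      apply In_bonds in he, he'. apply (fwd_opp e e'); [tauto|tauto|congruence].
  - intros b hb. apply Hnz in hb. split.
    + intros hL. destruct (bond_cases b (HL b hL)) as [e [he E]]. apply in_or_app.
      assert (He : In e (bonds M)).
      { apply In_bonds. split; [|exact he]. apply NNPP. intros h. apply hb.
        assert (q := Hfin (fst e) (snd e) he h). destruct E as [E|E]; subst b; unfold Defs.D, opp_bond, fwd, dlat in *; cbn [fst snd] in *; lra. }
      destruct E as [E|E]; subst b; [left|right]; apply in_map_iff; exists e; auto.
    + intros h. apply HuL; [|exact hb]. apply in_app_or in h. destruct h as [h|h]; apply in_map_iff in h; destruct h as [e [E _]]; subst b; apply is_bond_fwd.
Qed.

Theorem theorem3p3 (psi : R -> R) (Hpsi : psi_assumptions psi) :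
  exists y : pt -> R, globally_stable psi y /\ net_burgers y 1.
Proof.
  destruct (limit_exists psi Hpsi) as [y [a [I [Hl [Ht [Hdiv [Hdec Hmin]]]]]]].
  exists y. split; [apply minimal_stable; [apply Hpsi|exact Hmin]|apply (form_burgers y a I Hl Ht Hdiv Hdec)].
Qed.
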